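(* Let $\{X(t)\}_{t\ge 0}=\{X(t,\omega)\}$ be the stochastic replicator process with payoff matrix $A\in\mathbb{R}^{n\times n}$, noise parameters $\sigma_1,\dots,\sigma_n$ and initial value $\mathbf{x}_0\in\operatorname{int}\Delta$, and let $\tilde A=(\tilde a_{ij})=(a_{ij}-\tfrac12\sigma_i^2)_{i,j}$. For fixed $\omega$, call a matrix $(p_{ij})_{i,j=1}^n=(p_{ij}(\omega))$ a limit point if for some sequence of times $T_k(\omega)\to\infty$, $$p_{ij}=\lim_{k\to\infty}\frac1{T_k(\omega)}\int_0^{T_k(\omega)}X_i(t,\omega)X_j(t,\omega)\,dt\qquad\text{for all } i,j,$$ and let $p_i=\sum_{j=1}^n p_{ij}$ and $\mathbf{p}=(p_1,\dots,p_n)^T$. Then, with probability $1$, each limit point $(p_{ij})$ satisfies $$(\tilde A\mathbf{p})_l\le\sum_{i,j}\tilde a_{ij}p_{ij}+\frac12\sum_{j=1}^n\sigma_j^2(p_j-p_{jj})$$ for all $l\in\{1,\dots,n\}$, and equality holds for at least one $l$.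
   Context: Setting. $n\ge2$; $A=(a_{ij})\in\mathbb{R}^{n\times n}$ is an arbitrary payoff matrix; $\sigma_1,\dots,\sigma_n>0$; $W=(W_1,\dots,W_n)^T$ is a standard $n$-dimensional Brownian motion (independent components). $\Delta=\{\mathbf{y}\in[0,1]^n:y_1+\cdots+y_n=1\}$ and $\operatorname{int}\Delta=\{\mathbf{y}\in\Delta: y_i>0\ \forall i\}$. The stochastic replicator process $\{X(t)\}$ is a strong solution of the Itô equation $$dX(t)=\mathbf{b}(X(t))\,dt+C(X(t))\,dW(t),\qquad X(0)=\mathbf{x}_0\in\operatorname{int}\Delta,$$ with $\mathbf{b}(\mathbf{x})=[\operatorname{diag}(x_1,\dots,x_n)-\mathbf{x}\mathbf{x}^T][A-\operatorname{diag}(\sigma_1^2,\dots,\sigma_n^2)]\mathbf{x}$ and $C(\mathbf{x})=[\operatorname{diag}(x_1,\dots,x_n)-\mathbf{x}\mathbf{x}^T]\operatorname{diag}(\sigma_1,\dots,\sigma_n)$ for $\mathbf{x}\in\Delta$. Equivalently, $X_i=Z_i/(Z_1+\cdots+Z_n)$ where $dZ_i(t)=Z_i(t)[\{AX(t)\}_i\,dt+\sigma_i\,dW_i(t)]$, $Z_i(0)>0$. Almost surely $X(t)\in\operatorname{int}\Delta$ for all $t\ge0$. *)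

(* Defs.v *)
From HB Require Import structures.
From mathcomp Require Import all_boot all_order all_algebra.
From mathcomp Require Import all_classical all_reals all_analysis.

Set Implicit Arguments.
Unset Strict Implicit.
Unset Printing Implicit Defensive.

Import Order.TTheory GRing.Theory Num.Theory.
Import numFieldNormedType.Exports.

Local Open Scope classical_set_scope.
Local Open Scope ring_scope.

Section simplex.
Context {R : realType} {n : nat}.

Definition in_simplex (y : 'cV[R]_n) : Prop :=
  (forall i, 0 <= y i 0 <= 1) /\ \sum_i y i 0 = 1.

Definition in_int_simplex (y : 'cV[R]_n) : Prop :=
  in_simplex y /\ forall i, 0 < y i 0.

End simplex.

Section replicator_coefficients.
Context {R : realType} {n : nat}.

Definition replicator_op (x : 'cV[R]_n) : 'M[R]_n := diag_mx x^T - x *m x^T.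

Definition replicator_drift (A : 'M[R]_n) (sigma : 'I_n -> R) (x : 'cV[R]_n) :
    'cV[R]_n :=
  replicator_op x *m (A - diag_mx (\row_i sigma i ^+ 2)) *m x.

Definition replicator_diffusion (sigma : 'I_n -> R) (x : 'cV[R]_n) : 'M[R]_n :=
  replicator_op x *m diag_mx (\row_i sigma i).

Definition modified_payoff (A : 'M[R]_n) (sigma : 'I_n -> R) : 'M[R]_n :=
  \matrix_(i, j) (A i j - 2^-1 * sigma i ^+ 2).

End replicator_coefficients.

(* Processes with values in R^n are functions Y : R -> T -> 'cV[R]_n of time
   and of the sample point; only their values at times t >= 0 are used. *)
Section stochastic_calculus.
Context {d : measure_display} {T : measurableType d} {R : realType}.
Variable P : probability T R.

(* The sets B i may be the whole line, so the product rule for the full family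
   gives it for every subfamily. *)
Definition mutually_independent (I : finType) (Y : I -> T -> R) : Prop :=
  forall B : I -> set R, (forall i, measurable (B i)) ->
    P (\bigcap_i (Y i @^-1` B i)) = (\prod_i P (Y i @^-1` B i))%E.

Definition continuous_paths (n : nat) (Y : R -> T -> 'cV[R]_n) : Prop :=
  {ae P, forall w, forall i,
    {within `[0, +oo[, continuous (fun t => Y t w i 0)}}.

(* normal_prob takes the standard deviation as its second parameter. *)
Definition standard_brownian_motion (n : nat) (W : R -> T -> 'cV[R]_n) :
    Prop :=
  [/\ forall t i, 0 <= t -> measurable_fun setT (fun w => W t w i 0),
      {ae P, forall w, W 0 w = 0},
      continuous_paths W,
      forall s t i, 0 <= s -> s < t ->
        forall B : set R, measurable B ->
          P ((fun w => W t w i 0 - W s w i 0) @^-1` B) =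
          normal_prob 0 (Num.sqrt (t - s)) B
    & forall (m : nat) (t : nat -> R),
        0 <= t 0%N -> (forall k, (k < m)%N -> t k < t k.+1) ->
        mutually_independent (fun (ik : 'I_n * 'I_m) w =>
          W (t ik.2.+1) w ik.1 0 - W (t ik.2) w ik.1 0)].

(* The filtration generated by W, augmented by the P-null events. *)
Definition brownian_filtration (n : nat) (W : R -> T -> 'cV[R]_n) (t : R) :
    set (set T) :=
  <<s [set E | (exists s i B, [/\ 0 <= s <= t, measurable (B : set R)
                                & E = (fun w => W s w i 0) @^-1` B])
               \/ (measurable E /\ P E = 0%E)] >>.

Definition measurable_wrt (G : set (set T)) (f : T -> R) : Prop :=
  forall B : set R, measurable B -> G (f @^-1` B).

Definition adapted (F : R -> set (set T)) (n : nat) (Y : R -> T -> 'cV[R]_n) :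
    Prop :=
  forall t i, 0 <= t -> measurable_wrt (F t) (fun w => Y t w i 0).

(* The elementary process \sum_k e_k 1_[t_k, t_(k+1)[ on [0, t]. *)
Record elementary := Elementary {
  el_size : nat;
  el_time : nat -> R;
  el_val : nat -> T -> R }.

Definition elementary_process (phi : elementary) (s : R) (w : T) : R :=
  \sum_(k < el_size phi)
     el_val phi k w * \1_(`[el_time phi k, el_time phi k.+1[) s.

Definition elementary_on (F : R -> set (set T)) (t : R) (phi : elementary) :
    Prop :=
  [/\ el_time phi 0%N = 0, el_time phi (el_size phi) = t,
      forall k, (k < el_size phi)%N -> el_time phi k < el_time phi k.+1
    & forall k, (k < el_size phi)%N ->
        measurable_wrt (F (el_time phi k)) (el_val phi k) /\
        exists c, forall w, `|el_val phi k w| <= c].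

Definition elementary_integral (B : R -> T -> R) (phi : elementary) (w : T) :
    R :=
  \sum_(k < el_size phi)
     el_val phi k w * (B (el_time phi k.+1) w - B (el_time phi k) w).

(* J is (a version of) the Ito integral of H dB over [0, t]: the L^2(P)-limit
   of the integrals of elementary processes which approximate H in
   L^2(P x Lebesgue). By the Ito isometry J does not depend, up to a null
   event, on the approximating sequence. *)
Definition is_ito_integral (F : R -> set (set T)) (B : R -> T -> R)
    (H : R -> T -> R) (t : R) (J : T -> R) : Prop :=
  measurable_fun setT J /\
  exists phi : nat -> elementary,
    [/\ forall m, elementary_on F t (phi m),
        (\int[P]_w \int[lebesgue_measure]_(s in `[0%R, t])
            ((H s w - elementary_process (phi m) s w) ^+ 2)%:E)%E
          @[m --> \oo] --> 0%E
      & (\int[P]_w ((J w - elementary_integral B (phi m) w) ^+ 2)%:E)%E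
          @[m --> \oo] --> 0%E].

(* X is a strong solution, with values in the simplex, of
   dX = b(X) dt + C(X) dW, X(0) = x0. *)
Definition stochastic_replicator (n : nat) (A : 'M[R]_n) (sigma : 'I_n -> R)
    (x0 : 'cV[R]_n) (W X : R -> T -> 'cV[R]_n) : Prop :=
  [/\ adapted (brownian_filtration W) X,
      continuous_paths X,
      {ae P, forall w, forall t, 0 <= t -> in_simplex (X t w)},
      {ae P, forall w, X 0 w = x0}
    & forall t, 0 <= t ->
        exists2 J : 'I_n -> 'I_n -> T -> R,
          forall i j, is_ito_integral (brownian_filtration W)
            (fun s w => W s w j 0)
            (fun s w => replicator_diffusion sigma (X s w) i j) t (J i j)
        & {ae P, forall w, forall i,
            X t w i 0 = x0 i 0
              + \int[lebesgue_measure]_(s in `[0%R, t])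
                  replicator_drift A sigma (X s w) i 0
              + \sum_j J i j w}].

End stochastic_calculus.

Definition time_average_limit_point {T : Type} {R : realType} {n : nat}
    (X : R -> T -> 'cV[R]_n) (w : T) (p : 'M[R]_n) : Prop :=
  exists2 tau : nat -> R, tau k @[k --> \oo] --> +oo
    & forall i j,
        (tau k)^-1 * (\int[lebesgue_measure]_(t in `[0%R, tau k])
                        (X t w i 0 * X t w j 0))
          @[k --> \oo] --> p i j.

(* Main.v *)
Require Import Defs.
From HB Require Import structures.
From mathcomp Require Import all_boot all_order all_algebra.
From mathcomp Require Import all_classical all_reals all_analysis.
From mathcomp Require Import measurable_realfun ring lra.

Set Implicit Arguments.
Unset Strict Implicit.
Unset Printing Implicit Defensive.

Import Order.TTheory GRing.Theory Num.Theory.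
Import numFieldNormedType.Exports.

Local Open Scope classical_set_scope.
Local Open Scope ring_scope.

(* On the simplex, Ito's formula reads
     ln X_l(t) = ln X_l(0) + int_0^t g_l(X(s)) ds + N_l(t)
   with g_l a quadratic form in the products x_i x_j and E N_l(t)^2 <= kappa t.
   Hence sum_k E (N_l(k^2) / k^2)^2 < oo, so N_l(k^2) / k^2 -> 0 almost surely.
   Let tau_k be times that produce the limit point (p_ij) and m_k^2 the largest
   square below tau_k. As g_l is bounded, ln X_l(m_k^2) / tau_k converges to D_l,
   the left side minus the right side of the claimed inequality. Then D_l <= 0
   because X_l <= 1, and the D_l are not all negative, since otherwise all
   coordinates would tend to 0 along m_k^2 although they add up to 1.

   The bound on N_l needs no pathwise stochastic calculus. For
   phi(x) = ln (x_l + delta), the errors phi(X(t + h)) - phi(X(t)) - (L phi)(X(t)) h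
   made over a partition of mesh h, L being the generator, have conditional mean
   O(h^(3/2)) and second moment at most kappa' h + O(h^(3/2)), where kappa' does
   not depend on delta. Summing, refining the partition, and letting delta tend
   to 0 with Fatou's lemma gives the bound and also X_l > 0. *)

(** * Expectations and second moments *)

(** The integrals in [is_ito_integral] are L^2 limits at one fixed time, with no null event common
    to all times. All they yield are moments at fixed times: the isometry and the vanishing
    conditional mean of increments. The mean and the second moment of a one-step error play
    different roles. Second moments alone, summed by Cauchy-Schwarz over t / h steps, would give
    order t^2 / h. Expanding the square of the partial sums step by step uses the small conditional
    mean for the cross terms, and leaves the diagonal terms, of total order t. Uniformity in delta
    comes from the factor x_l^2 in the variance rate of the l-th coordinate: times the squared
    derivative of ln (x_l + delta) it gives (x_l / (x_l + delta))^2 <= 1, although that derivative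
    blows up. Squares are sparse enough for the sum of k^2 / k^4 to converge, and dense enough for
    the gap 2k + 1 to be negligible against k^2. In the one-step estimates the mesh is written h^2,
    so that half-integer powers become integer powers. *)

Section quadratic_inequalities.
Context {R : realFieldType}.
Implicit Types a b c h : R.

Lemma sqrD_le2 a b : (a + b) ^+ 2 <= 2 * a ^+ 2 + 2 * b ^+ 2.
Proof. by have := sqr_ge0 (a - b); nra. Qed.

Lemma sqrB_le2 a b : (a - b) ^+ 2 <= 2 * a ^+ 2 + 2 * b ^+ 2.
Proof. by have := sqrD_le2 a (- b); rewrite sqrrN. Qed.

Lemma sqrD_le3 a b c : (a + b + c) ^+ 2 <= 3 * (a ^+ 2 + b ^+ 2 + c ^+ 2).
Proof.
by have := sqr_ge0 (a - b); have := sqr_ge0 (a - c); have := sqr_ge0 (b - c); nra.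
Qed.

Lemma weighted_AGM h a b : 0 < h -> 2 * (a * b) <= h * a ^+ 2 + h^-1 * b ^+ 2.
Proof.
move=> h0; rewrite -(ler_pM2l h0) [leRHS]mulrDr (mulrA h h^-1) mulfV ?gt_eqF // mul1r.
by have := sqr_ge0 (h * a - b); nra.
Qed.

End quadratic_inequalities.

Section expectation_calculus.
Context {d : measure_display} {T : measurableType d} {R : realType}.
Variable P : probability T R.
Implicit Types (f g : T -> R) (c k : R).

Definition int1 (f : T -> R) := P.-integrable setT (EFin \o f).
Definition Ex (f : T -> R) : R := \int[P]_w f w.

Lemma int1_meas f : int1 f -> measurable_fun setT f.
Proof. by move=> /measurable_int /measurable_EFinP. Qed.

Lemma int1D f g : int1 f -> int1 g -> int1 (fun w => f w + g w).
Proof.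
move=> hf hg; rewrite /int1 (_ : EFin \o _ = (EFin \o f) \+ (EFin \o g))%E //.
exact: integrableD.
Qed.

Lemma int1Z k f : int1 f -> int1 (fun w => k * f w).
Proof.
move=> hf.
rewrite /int1 (_ : EFin \o _ = (fun w => k%:E * (EFin \o f) w)%E) //.
exact: integrableZl.
Qed.

Lemma int1N f : int1 f -> int1 (fun w => - f w).
Proof.
move=> /(int1Z (-1)); by rewrite (_ : (fun w => -1 * f w) = (fun w => - f w)) //;
  apply/funext => w; rewrite mulN1r.
Qed.

Lemma int1B f g : int1 f -> int1 g -> int1 (fun w => f w - g w).
Proof. by move=> hf hg; apply: int1D => //; exact: int1N. Qed.

Lemma int1_le f g : measurable_fun setT f -> int1 g ->
  (forall w, `|f w| <= g w) -> int1 f.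
Proof.
move=> mf hg fg; apply: (@le_integrable _ T R P setT measurableT _ (EFin \o g)) => //.
  exact/measurable_EFinP.
by move=> w _ /=; rewrite lee_fin (le_trans (fg w)) // ler_norm.
Qed.

Lemma int1_cst c : int1 (fun=> c).
Proof. exact: (@finite_measure_integrable_cst _ T R P setT c). Qed.

Lemma int1_bdd f c : measurable_fun setT f -> (forall w, `|f w| <= c) -> int1 f.
Proof. move=> mf fc; exact: int1_le mf (int1_cst c) fc. Qed.

Lemma int1_abs f : int1 f -> int1 (fun w => `|f w|).
Proof.
move=> hf; apply: (@integrable_abse _ T R P setT (EFin \o f)) => //.
Qed.

Lemma int1_sum (I : Type) (r : seq I) (p : pred I) (F : I -> T -> R) :
  (forall i, int1 (F i)) -> int1 (fun w => \sum_(i <- r | p i) F i w).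
Proof.
move=> hF; elim: r => [|i r ih].
  rewrite (_ : (fun w => _) = fun=> 0); first exact: int1_cst.
  by apply/funext => w; rewrite big_nil.
case pi : (p i); last first.
  by under [X in int1 X]eq_fun do rewrite big_cons pi.
under [X in int1 X]eq_fun do rewrite big_cons pi.
exact: int1D.
Qed.

Lemma ExD f g : int1 f -> int1 g -> Ex (fun w => f w + g w) = Ex f + Ex g.
Proof. by move=> hf hg; apply: RintegralD. Qed.

Lemma ExB f g : int1 f -> int1 g -> Ex (fun w => f w - g w) = Ex f - Ex g.
Proof. by move=> hf hg; apply: RintegralB. Qed.

Lemma ExZ k f : int1 f -> Ex (fun w => k * f w) = k * Ex f.
Proof. by move=> hf; apply: RintegralZl. Qed.

Lemma int1Zr f k : int1 f -> int1 (fun w => f w * k).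
Proof.
by move=> hf; rewrite (_ : (fun w => _) = fun w => k * f w); [exact: int1Z|apply/funext => w; rewrite mulrC].
Qed.

Lemma ExZr f k : int1 f -> Ex (fun w => f w * k) = Ex f * k.
Proof. by move=> hf; apply: RintegralZr. Qed.

Lemma ExN f : int1 f -> Ex (fun w => - f w) = - Ex f.
Proof.
move=> hf; rewrite -[RHS]mulN1r -ExZ //.
by congr Ex; apply/funext => w; rewrite mulN1r.
Qed.

Lemma Ex_cst c : Ex (fun=> c) = c.
Proof.
rewrite /Ex Rintegral_cst // [X in fine X](_ : _ = 1%E) ?mulr1 //.
exact: probability_setT.
Qed.

Lemma Ex_sum (I : Type) (r : seq I) (p : pred I) (F : I -> T -> R) :
  (forall i, int1 (F i)) ->
  Ex (fun w => \sum_(i <- r | p i) F i w) = \sum_(i <- r | p i) Ex (F i).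
Proof.
move=> hF; elim: r => [|i r ih].
  rewrite big_nil (_ : (fun w => _) = fun=> 0); first exact: Ex_cst.
  by apply/funext => w; rewrite big_nil.
rewrite big_cons; case pi : (p i); last first.
  by under [X in Ex X]eq_fun do rewrite big_cons pi.
under [X in Ex X]eq_fun do rewrite big_cons pi.
by rewrite ExD ?ih //; exact: int1_sum.
Qed.

Lemma Ex_le f g : int1 f -> int1 g -> (forall w, f w <= g w) -> Ex f <= Ex g.
Proof. by move=> hf hg fg; apply: le_Rintegral. Qed.

Lemma Ex_ge0 f : (forall w, 0 <= f w) -> 0 <= Ex f.
Proof. by move=> f0; apply: Rintegral_ge0. Qed.

Lemma Ex_abs f : int1 f -> `|Ex f| <= Ex (fun w => `|f w|).
Proof. by move=> hf; apply: le_normr_Rintegral. Qed.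

Lemma Ex_abs_le f g : int1 f -> int1 g -> (forall w, `|f w| <= g w) ->
  `|Ex f| <= Ex g.
Proof.
move=> hf hg fg; apply: (le_trans (Ex_abs hf)); apply: Ex_le => //.
exact: int1_abs.
Qed.

Lemma Ex_ae f g : measurable_fun setT f -> measurable_fun setT g ->
  {ae P, forall w, f w = g w} -> Ex f = Ex g.
Proof.
move=> mf mg fg; congr fine; apply: ae_eq_integral => //.
- exact/measurable_EFinP.
- exact/measurable_EFinP.
- by apply: filterS fg => w /= ->.
Qed.

Lemma Ex_fin f : int1 f -> (\int[P]_w (f w)%:E = (Ex f)%:E)%E.
Proof. by move=> hf; rewrite /Ex /Rintegral fineK //; apply: integrable_fin_num. Qed.

Lemma int1_ge0 f : measurable_fun setT f -> (forall w, 0 <= f w) ->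
  (\int[P]_w (f w)%:E < +oo)%E -> int1 f.
Proof.
move=> mf f0 fy; apply/integrableP; split; first exact/measurable_EFinP.
by under eq_integral do rewrite /= ger0_norm //.
Qed.

Definition L2 (f : T -> R) := measurable_fun setT f /\ int1 (fun w => f w ^+ 2).

Lemma L2_bdd f c : measurable_fun setT f -> (forall w, `|f w| <= c) -> L2 f.
Proof.
move=> mf fc; split => //; apply: (@int1_bdd _ (c ^+ 2)).
  exact: measurable_funX.
by move=> w; rewrite normrX ler_pXn2r // ?nnegrE // (le_trans _ (fc w)).
Qed.

Lemma L2_le f g : measurable_fun setT f -> L2 g -> (forall w, `|f w| <= `|g w|) ->
  L2 f.
Proof.
move=> mf [mg ig] fg; split => //; apply: int1_le ig _.
  exact: measurable_funX.
move=> w; rewrite normrX -(real_normK (num_real (g w))).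
by rewrite ler_pXn2r // ?nnegrE.
Qed.

Lemma L2_mul f g : L2 f -> L2 g -> int1 (fun w => f w * g w).
Proof.
move=> [mf hf] [mg hg]; apply: int1_le (int1D hf hg) _.
  exact: measurable_funM.
move=> w; rewrite normrM -(real_normK (num_real (f w))).
rewrite -(real_normK (num_real (g w))).
have := sqr_ge0 (`|f w| - `|g w|).
have := sqr_ge0 (`|f w|); have := sqr_ge0 (`|g w|).
nra.
Qed.

Lemma L2_int1 f : L2 f -> int1 f.
Proof.
move=> hf; have h1 : L2 (fun=> 1) by exact: (@L2_bdd _ `|1|).
have := L2_mul hf h1; by under [X in int1 X -> _]eq_fun do rewrite mulr1.
Qed.

Lemma L2D f g : L2 f -> L2 g -> L2 (fun w => f w + g w).
Proof.
move=> [mf hf] [mg hg]; split; first exact: measurable_funD.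
apply: int1_le (int1Z 2 (int1D hf hg)) _.
  by apply: measurable_funX; exact: measurable_funD.
move=> w; rewrite ger0_norm ?sqr_ge0 //.
by have := sqr_ge0 (f w - g w); nra.
Qed.

Lemma L2M_bdd c f g : measurable_fun setT f -> (forall w, `|f w| <= c) ->
  L2 g -> L2 (fun w => f w * g w).
Proof.
move=> mf fc [mg hg]; split; first exact: measurable_funM.
apply: int1_le (int1Z (c ^+ 2) hg) _.
  by apply: measurable_funX; exact: measurable_funM.
move=> w; rewrite ger0_norm ?sqr_ge0 // exprMn ler_wpM2r ?sqr_ge0 //.
rewrite -(real_normK (num_real (f w))) ler_pXn2r // ?nnegrE //.
by rewrite (le_trans _ (fc w)).
Qed.

Lemma L2Z k f : L2 f -> L2 (fun w => k * f w).
Proof. by apply: (@L2M_bdd `|k|) => //; exact: measurable_cst. Qed.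

Lemma L2N f : L2 f -> L2 (fun w => - f w).
Proof.
by move=> /(L2Z (-1)); under [X in L2 X -> _]eq_fun do rewrite mulN1r.
Qed.

Lemma L2B f g : L2 f -> L2 g -> L2 (fun w => f w - g w).
Proof. by move=> hf hg; apply: L2D => //; exact: L2N. Qed.

Lemma L2_sum (I : Type) (r : seq I) (p : pred I) (F : I -> T -> R) :
  (forall i, L2 (F i)) -> L2 (fun w => \sum_(i <- r | p i) F i w).
Proof.
move=> hF; elim: r => [|i r ih].
  rewrite (_ : (fun w => _) = fun=> 0).
    by apply: (@L2_bdd _ 0) => [|w]; [exact: measurable_cst|rewrite normr0].
  by apply/funext => w; rewrite big_nil.
case pi : (p i); last first.
  by under [X in L2 X]eq_fun do rewrite big_cons pi.
under [X in L2 X]eq_fun do rewrite big_cons pi.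
exact: L2D.
Qed.

Lemma Ex_sqD f g : L2 f -> L2 g ->
  Ex (fun w => (f w + g w) ^+ 2) <= 2 * (Ex (fun w => f w ^+ 2) + Ex (fun w => g w ^+ 2)).
Proof.
move=> hf hg; rewrite -ExD ?hf.2 ?hg.2 // -ExZ; last exact: int1D hf.2 hg.2.
apply: Ex_le; [exact: (L2D hf hg).2 |apply: int1Z; exact: int1D hf.2 hg.2|].
by move=> w; rewrite mulrDr; exact: sqrD_le2.
Qed.

(** The free weight [th] replaces the square roots of Cauchy-Schwarz; it is later chosen so as to
    balance the two terms, for instance as a power of the mesh. *)
Lemma Ex_mul_le th f g : 0 < th -> L2 f -> L2 g ->
  Ex (fun w => `|f w * g w|) <=
  th * Ex (fun w => f w ^+ 2) + th^-1 * Ex (fun w => g w ^+ 2).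
Proof.
move=> th0 hf hg; rewrite -!ExZ ?hf.2 ?hg.2 // -ExD; last 2 first.
- exact: int1Z hf.2.
- exact: int1Z hg.2.
apply: Ex_le.
- exact: int1_abs (L2_mul hf hg).
- by apply: int1D; [exact: int1Z hf.2|exact: int1Z hg.2].
move=> w; rewrite normrM -(real_normK (num_real (f w))).
rewrite -(real_normK (num_real (g w))).
set a := `|f w|; set b := `|g w|.
have := weighted_AGM a b th0; have : 0 <= a * b by rewrite mulr_ge0 ?normr_ge0.
lra.
Qed.

(** The induction splits the square with weights n + 1 and 1 + 1/n, and (1 + 1/n) n = n + 1 restores
    the constant. The weight 1/n makes n = 0 a separate case. *)
Lemma Ex_sq_sum n (F : 'I_n -> T -> R) : (forall i, L2 (F i)) ->
  Ex (fun w => (\sum_i F i w) ^+ 2) <= n%:R * \sum_i Ex (fun w => F i w ^+ 2).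
Proof.
elim: n F => [|n ih] F hF.
  rewrite big_ord0 mulr0 (_ : (fun w => _) = fun=> 0) ?Ex_cst //.
  by apply/funext => w; rewrite big_ord0 expr0n.
have hS : L2 (fun w => \sum_(i < n) F (lift ord0 i) w) by apply: L2_sum.
have [n0|n0] := eqVneq n 0%N.
  subst n; rewrite big_ord_recl big_ord0 addr0 mul1r.
  rewrite (_ : (fun w => (\sum_(i < 1) _) ^+ 2) = (fun w => F ord0 w ^+ 2)) //.
  by apply/funext => w; rewrite big_ord_recl big_ord0 addr0.
have np : 0 < n%:R :> R by rewrite ltr0n lt0n.
rewrite big_ord_recl.
under [X in Ex X]eq_fun do rewrite big_ord_recl.
have hS2 := ih (fun i => F (lift ord0 i)) (fun i => hF _).
set A := Ex (fun w => F ord0 w ^+ 2); set B := \sum_(i < n) _.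
set S := fun w => \sum_(i < n) F (lift ord0 i) w.
rewrite -/S in hS hS2 *.
have : Ex (fun w => (F ord0 w + S w) ^+ 2) <=
   (n%:R + 1) * A + (1 + n%:R^-1) * Ex (fun w => S w ^+ 2).
  rewrite -!ExZ ?hS.2 ?(hF _).2 // -ExD; last 2 first.
  - exact: int1Z (hF _).2.
  - exact: int1Z hS.2.
  apply: Ex_le; first exact: (L2D (hF _) hS).2.
    by apply: int1D; [exact: int1Z (hF _).2|exact: int1Z hS.2].
  move=> w; set a := F _ w; set b := S w.
  have := sqr_ge0 (n%:R * a - b) => h.
  rewrite -(ler_pM2l np) mulrDr (mulrA n%:R (1 + _)) mulrDr mulr1 mulfV ?gt_eqF //.
  nra.
move=> /le_trans; apply.
have : (1 + n%:R^-1) * Ex (fun w => S w ^+ 2) <= (1 + n%:R^-1) * (n%:R * B).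
  by rewrite ler_wpM2l // addr_ge0 // invr_ge0 ltW.
rewrite (_ : (1 + n%:R^-1) * (n%:R * B) = (n%:R + 1) * B); last by field; rewrite gt_eqF.
rewrite -[X in _ -> _ <= X * _]natr1 mulrDr.
lra.
Qed.

End expectation_calculus.

(** * Gaussian moments and independence *)

Section normal_moments.
Context {R : realType}.
Variable s : R.
Hypothesis s0 : 0 < s.
Notation mu := (@lebesgue_measure R).
Notation N := (@normal_prob R 0 s).

Lemma normal_pdf0E : normal_pdf 0 s = fun x => normal_peak s * expR (- ((2 * s ^+ 2)^-1 * x ^+ 2)).
Proof.
rewrite normal_pdfE ?gt_eqF //; apply/funext => x; rewrite /normal_fun subr0.
by congr (_ * expR _); rewrite mulrC mulrN; congr (- (_^-1 * _)); rewrite mulr_natl.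
Qed.

(** The Radon-Nikodym derivative of the normal law agrees almost everywhere with the density,
    because both have the same integral over every measurable set. *)
Lemma ge0_integral_normal f : (forall x, 0 <= f x)%E -> measurable_fun setT f ->
  (\int[N]_x f x = \int[mu]_x (f x * (normal_pdf 0 s x)%:E))%E.
Proof.
move=> f0 mf.
have dom := normal_prob_dominates 0 s.
rewrite -(Radon_Nikodym_SigmaFinite.change_of_variables dom) //.
have intRN := Radon_Nikodym_SigmaFinite.f_integrable dom.
apply: ae_eq_integral => //.
- by apply: emeasurable_funM => //; apply: measurable_int intRN.
- by apply: emeasurable_funM => //; apply/measurable_EFinP; exact: measurable_normal_pdf.
- apply: ae_eqe_mul2l; apply: integral_ae_eq => //.
  + by apply/measurable_EFinP; exact: measurable_normal_pdf.
  + by move=> E _ mE; rewrite -Radon_Nikodym_SigmaFinite.f_integral.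
Qed.

Let q (j : nat) (x : R) : R := x ^+ j * normal_pdf 0 s x.

Let cq j : continuous (q j).
Proof.
move=> x; apply: cvgM; first exact: exprn_continuous.
by apply: continuous_normal_pdf; rewrite gt_eqF.
Qed.

Let is_derive_pdf (x : R) : is_derive x (1 : R) (normal_pdf 0 s : R -> R) (- (s ^+ 2)^-1 * q 1 x).
Proof.
rewrite /q expr1 !normal_pdf0E.
apply: is_derive_eq; rewrite ?scaler0 ?addr0 ?add0r.
by rewrite /GRing.scale /=; field; rewrite ?gt_eqF.
Qed.

(** The integrand is the derivative of -s^2 x^(j+1) times the density. Working on a compact interval
    postpones every question of integrability at infinity. *)
Let ibp (j : nat) (A : R) : 0 < A ->
  (\int[mu]_(x in `[(- A)%R, A]) (q j.+2 x - s ^+ 2 * j.+1%:R * q j x)%:E =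
   (- s ^+ 2 * (q j.+1 A - q j.+1 (- A)))%:E)%E.
Proof.
move=> A0.
pose F (x : R) : R := - s ^+ 2 * q j.+1 x.
pose f (x : R) : R := q j.+2 x - s ^+ 2 * j.+1%:R * q j x.
have dF (x : R) : is_derive x (1 : R) F (f x).
  rewrite (_ : F = - s ^+ 2 *: ((id : R -> R) ^+ j.+1 * normal_pdf 0 s)); last first.
    by apply/funext => y; rewrite /F /q exprfctE.
  apply: (is_derive_eq (is_deriveZ _ (is_deriveM (is_deriveX _ (is_derive_id x 1)) (is_derive_pdf x)))).
  rewrite /f /q /GRing.scale /= exprfctE /= !exprS expr0; field.
  by rewrite gt_eqF.
rewrite -[LHS]/(\int[mu]_(x in `[(- A)%R, A]) (f x)%:E)%E.
rewrite (@continuous_FTC2 _ f F); first last.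
- by move=> x _; rewrite derive1E; apply: derive_val.
- have cF : continuous F by move=> x; apply: cvgM; [exact: cvg_cst|exact: cq].
  split; [by move=> x _; exact: ex_derive| |].
  + exact/cvg_at_right_filter/cF.
  + exact/cvg_at_left_filter/cF.
- apply: continuous_subspaceT => x; apply: cvgB; first exact: cq.
  by apply: cvgM; [exact: cvg_cst|exact: cq].
- by rewrite gtrN.
by rewrite -EFinB /F mulrBr.
Qed.

Let q_ge0 j x : 0 <= q (2 * j)%N x.
Proof. by rewrite mulr_ge0 ?normal_pdf_ge0 // exprM exprn_ge0 // sqr_ge0. Qed.

Let pdfN x : normal_pdf 0 s (- x) = normal_pdf 0 s x.
Proof. by rewrite !normal_pdf0E /= sqrrN. Qed.

Let mq j : measurable_fun setT (q j).
Proof. exact: continuous_measurable_fun. Qed.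

Let intq j (A : R) : mu.-integrable `[- A, A] (EFin \o q j).
Proof.
apply: continuous_compact_integrable; first exact: segment_compact.
exact: continuous_subspaceT.
Qed.

Let a j n : R := \int[mu]_(x in `[- (n.+1%:R), n.+1%:R]) q (2 * j)%N x.

(** The power 2j + 1 is odd, so the boundary terms at both ends add up instead of cancelling. *)
Let aS j n : a j.+1 n = s ^+ 2 * (2 * j).+1%:R * a j n
   - 2 * s ^+ 2 * q (2 * j).+1 n.+1%:R.
Proof.
have n0 : 0 < n.+1%:R :> R by [].
have := ibp (2 * j) n0.
have h1 : mu.-integrable `[- n.+1%:R : R, n.+1%:R]
   (EFin \o (fun x => s ^+ 2 * (2 * j).+1%:R * q (2 * j) x)).
  have := @integrableZl _ _ _ mu _ (measurable_itv _) (s ^+ 2 * (2 * j).+1%:R) _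
    (intq (2 * j) n.+1%:R).
  by apply: eq_integrable.
move=> /(congr1 fine); rewrite -/(Rintegral _ _ _) /= RintegralB //.
rewrite RintegralZl //.
rewrite -/(a j n) /a mulnS => h.
have qN : q (2 * j).+1 (- n.+1%:R) = - q (2 * j).+1 n.+1%:R.
  by rewrite /q pdfN exprNn -signr_odd /= mul2n odd_double /= expr1 mulN1r mulNr.
rewrite qN in h; move: h; lra.
Qed.

Let M j : \bar R := (\int[mu]_x (q (2 * j)%N x)%:E)%E.

Let cvga j : (a j n)%:E @[n --> \oo] --> M j.
Proof.
have nd : nondecreasing_seq (fun n : nat => `[- (n.+1%:R : R), n.+1%:R]%classic).
  move=> m n mn; apply/subsetPset => x /=; rewrite !in_itv /= => /andP[h1 h2].
  have mn' : m.+1%:R <= n.+1%:R :> R by rewrite ler_nat.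
  by rewrite (le_trans h2 mn') andbT (le_trans _ h1) // lerN2.
have : (\int[mu]_(x in `[(- n.+1%:R)%R, (n.+1%:R)%R]) (q (2 * j)%N x)%:E)%E
    @[n --> \oo] --> (\int[mu]_(x in \bigcup_i `[(- i.+1%:R)%R, (i.+1%:R : R)%R]%classic) (q (2 * j)%N x)%:E)%E.
  apply: ge0_nondecreasing_set_cvg_integral => //.
  - move=> i; apply: measurable_funTS; apply/measurable_EFinP; exact: mq.
  - by move=> i x _; rewrite lee_fin q_ge0.
rewrite (_ : \bigcup_i _ = setT); last first.
  apply/seteqP; split => // x _.
  exists (Num.truncn `|x|) => //=; rewrite in_itv /= -ler_norml.
  by rewrite ltW // truncnS_gt.
apply: cvg_trans; apply: near_eq_cvg; near=> n.
by rewrite /a /Rintegral fineK // integrable_fin_num //=; exact: intq.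
Unshelve. all: by end_near. Qed.

Let M0 : M 0 = 1%E.
Proof.
rewrite /M muln0 /q -(@integral_normal_pdf R 0 s).
by apply: eq_integral => x _; rewrite expr0 mul1r.
Qed.

(** The boundary term is nonnegative, so dropping it leaves an upper bound, which is enough for the
    fourth moment. *)
Let MS j : (M j.+1 <= (s ^+ 2 * (2 * j).+1%:R)%:E * M j)%E.
Proof.
have h : ((s ^+ 2 * (2 * j).+1%:R)%:E * (a j n)%:E)%E @[n --> \oo] -->
   ((s ^+ 2 * (2 * j).+1%:R)%:E * M j)%E.
  by apply: cvgeZl => //; exact: @cvga.
apply: (lee_cvg_to (@cvga j.+1) h).
near=> n; rewrite -EFinM lee_fin aS gerBl.
apply: mulr_ge0; first by rewrite mulr_ge0 ?sqr_ge0.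
by apply: mulr_ge0; [exact: exprn_ge0|exact: normal_pdf_ge0].
Unshelve. all: by end_near. Qed.

(** The variance is required exactly, so this boundary term has to vanish: exp u >= 1 + u bounds x
    times the density by a constant over x. *)
Let q1_cvg0 : q 1 n.+1%:R @[n --> \oo] --> 0.
Proof.
pose c := normal_peak s * (2 * s ^+ 2).
have hc : c * harmonic n @[n --> \oo] --> 0.
  by rewrite -(mulr0 c); apply: cvgM; [exact: cvg_cst|exact: cvg_harmonic].
apply: (squeeze_cvgr _ (cvg_cst 0) hc); near=> n.
rewrite /q expr1 mulr_ge0 ?normal_pdf_ge0 //= normal_pdf0E /harmonic /c.
set x : R := n.+1%:R; have x0 : 0 < x by rewrite ltr0n.
rewrite mulrCA -mulrA ler_wpM2l ?normal_peak_ge0 //.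
rewrite ler_pdivlMr // mulrAC -expr2 expRN ler_pdivrMr ?expR_gt0 //.
apply: le_trans (_ : 2 * s ^+ 2 * (1 + ((2 * s ^+ 2)^-1 * x ^+ 2)) <= _).
  rewrite (_ : _ * (1 + _) = 2 * s ^+ 2 + x ^+ 2); last by field; rewrite gt_eqF.
  by rewrite lerDr mulr_ge0 ?sqr_ge0.
by rewrite ler_wpM2l ?expR_ge1Dx // mulr_ge0 ?sqr_ge0.
Unshelve. all: by end_near. Qed.

Let M1 : M 1 = (s ^+ 2)%:E.
Proof.
have h0 : a 0 n @[n --> \oo] --> (1 : R).
  by have := @cvga 0; rewrite M0 => /fine_cvg.
have h : a 1 n @[n --> \oo] --> s ^+ 2 * 1 * 1 - 2 * s ^+ 2 * 0.
  rewrite (_ : a 1 = fun n => s ^+ 2 * 1 * a 0 n - 2 * s ^+ 2 * q 1 n.+1%:R); last first.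
    by apply/funext => n; rewrite aS.
  apply: cvgB; (apply: cvgM; first exact: cvg_cst) => //.
rewrite !mulr1 mulr0 subr0 in h.
have h' : (a 1 n)%:E @[n --> \oo] --> (s ^+ 2)%:E by apply: cvg_EFin => //; exact: nearW.
exact: cvg_unique (@cvga 1) h'.
Qed.

Lemma normal_moment2 : (\int[N]_x (x ^+ 2)%:E = (s ^+ 2)%:E)%E.
Proof.
rewrite ge0_integral_normal; last 2 first.
- by move=> x; rewrite lee_fin sqr_ge0.
- by apply/measurable_EFinP; exact: measurable_funX.
by rewrite -M1; apply: eq_integral => x _; rewrite -EFinM.
Qed.

Lemma normal_moment4 : (\int[N]_x (x ^+ 4)%:E <= (3 * s ^+ 4)%:E)%E.
Proof.
rewrite ge0_integral_normal; last 2 first.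
- by move=> x; rewrite lee_fin (exprM x 2 2) sqr_ge0.
- by apply/measurable_EFinP; exact: measurable_funX.
have -> : (\int[mu]_x ((x ^+ 4)%:E * (normal_pdf 0 s x)%:E))%E = M 2.
  by apply: eq_integral => x _; rewrite -EFinM.
apply: (le_trans (MS 1)); rewrite M1 -EFinM lee_fin.
by rewrite (_ : s ^+ 2 * (2 * 1).+1%:R * s ^+ 2 = 3 * s ^+ 4) //; ring.
Qed.

Let normal_opp (A : set R) : measurable A -> N ((-%R : R -> R) @^-1` A) = N A.
Proof.
move=> mA; rewrite /normal_prob.
transitivity (\int[pushforward mu (-%R : R -> measurableTypeR R)]_(x in A) (normal_pdf 0 s x)%:E)%E.
  rewrite ge0_integral_pushforward; last 4 first.
  - exact: oppr_measurable.
  - exact: mA.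
  - by apply: measurable_funTS; apply/measurable_EFinP; exact: measurable_normal_pdf.
  - by move=> x _; rewrite lee_fin normal_pdf_ge0.
  by apply: eq_integral => x _ /=; rewrite pdfN.
by apply: eq_measure_integral => //= B mB _; rewrite lebesgue_measureN.
Qed.

Lemma normal_mean : \int[N]_x x = 0.
Proof.
have hL : L2 N (fun x => x).
  split => //; apply: int1_ge0 => //.
  - by move=> x; exact: sqr_ge0.
  - by rewrite normal_moment2 ltry.
have hi := L2_int1 hL.
have : \int[N]_x x = \int[N]_x (- x).
  congr fine.
  transitivity (\int[pushforward N (-%R : R -> measurableTypeR R)]_x (x%:E))%E.
    by apply: eq_measure_integral => //= B mB _; rewrite -normal_opp.
  rewrite integral_pushforward //=; exact: int1N hi.
have := ExN hi.
rewrite /Ex; lra.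
Qed.
End normal_moments.

Section independence_expectation.
Context {d : measure_display} {T : measurableType d} {R : realType}.
Variable P : probability T R.

(** The product rule on rectangles identifies the joint law of [Z] and [V] with the product of their
    laws, and Fubini then splits the integral of the product. *)
Lemma indep_int1_Ex (Z V : T -> R) :
  (forall A B, measurable A -> measurable B ->
     P (Z @^-1` A `&` V @^-1` B) = (P (Z @^-1` A) * P (V @^-1` B))%E) ->
  int1 P Z -> int1 P V ->
  int1 P (fun w => Z w * V w) /\ Ex P (fun w => Z w * V w) = Ex P Z * Ex P V.
Proof.
move=> ind iZ iV.
have mZ := int1_meas iZ; have mV := int1_meas iV.
pose Z' : {mfun T >-> R} := HB.pack Z (@isMeasurableFun.Build _ _ T R Z mZ).
pose V' : {mfun T >-> R} := HB.pack V (@isMeasurableFun.Build _ _ T R V mV).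
pose m1 := distribution P Z'; pose m2 := distribution P V'.
pose ZV w := (Z w, V w).
have mZV : measurable_fun setT ZV by exact: measurable_fun_pair.
pose ZV' : {mfun T >-> (R * R)%type} := HB.pack ZV (@isMeasurableFun.Build _ _ T (R * R)%type ZV mZV).
pose m' := distribution P ZV'.
have mE : forall X, measurable X -> (m1 \x m2)%E X = m' X.
  by apply: product_measure_unique => A B mA mB; rewrite -ind.
have mprod : measurable_fun setT (fun x : R * R => x.1 * x.2).
  by apply: measurable_funM.
have tr f : (forall x, (0 <= f x)%E) -> measurable_fun setT f ->
    (\int[P]_w f (ZV w) = \int[m1 \x m2]_x f x)%E.
  move=> f0 mf; rewrite (@eq_measure_integral _ _ _ _ m' ) ?ge0_integral_pushforward //.
  by move=> A mA _; exact: mE.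
have absE (X : {mfun T >-> R}) : int1 P X ->
   (\int[distribution P X]_x `|x|%:E = (Ex P (fun w => `|X w|))%:E)%E.
  move=> iX; rewrite ge0_integral_distribution //; first by rewrite -(Ex_fin (int1_abs iX)).
  by apply/measurable_EFinP; exact: normr_measurable.
have iZV : int1 P (fun w => Z w * V w).
  apply/integrableP; split; first by apply/measurable_EFinP; exact: measurable_funM.
  have := tr (fun x => `|x.1 * x.2|%:E) (fun x => normr_ge0 _).
  move=> /= ->; last by apply/measurable_EFinP; exact: measurableT_comp.
  rewrite fubini_tonelli1 //; last first.
    by apply/measurable_EFinP; exact: measurableT_comp.
  rewrite /fubini_F /=.
  under eq_integral => x _.
    under eq_integral => y _ do rewrite normrM EFinM.
    rewrite ge0_integralZl //; last by apply/measurable_EFinP; exact: normr_measurable.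
    rewrite (absE V' iV); over.
  rewrite ge0_integralZr //; last 2 first.
    by apply/measurable_EFinP; exact: normr_measurable.
    by rewrite lee_fin Ex_ge0.
  by rewrite (absE Z' iZ) -EFinM ltry.
split => //.
have tri f : measurable_fun setT f -> int1 P (fun w => f (ZV w)) ->
   Ex P (fun w => f (ZV w)) = fine (\int[m1 \x m2]_x (f x)%:E)%E.
  move=> mf fi; rewrite (@eq_measure_integral _ _ _ _ m').
    by rewrite integral_pushforward //; exact/measurable_EFinP.
  by move=> A mA _; exact: mE.
rewrite (tri (fun x => x.1 * x.2) mprod iZV).
have iprod : (m1 \x m2)%E.-integrable setT (fun x => (x.1 * x.2)%:E).
  apply/integrableP; split; first exact/measurable_EFinP.
  rewrite -(tr (fun x => `|x.1 * x.2|%:E)) //; last first.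
    by apply/measurable_EFinP; exact: measurableT_comp.
  by case/integrableP: iZV.
rewrite -integral12_prod_meas1 // /fubini_F /=.
have iD (X : {mfun T >-> R}) : int1 P X -> (distribution P X).-integrable setT EFin.
  move=> iX; apply/integrableP; split; first exact/measurable_EFinP.
  rewrite absE //; exact: ltry.
have eD (X : {mfun T >-> R}) : int1 P X ->
    (\int[distribution P X]_x x%:E = (Ex P X)%:E)%E.
  by move=> iX; rewrite integral_distribution ?Ex_fin.
rewrite (_ : (\int[m1]_x \int[m2]_y (x * y)%:E)%E = (Ex P Z * Ex P V)%:E) //.
transitivity (\int[m1]_x (x%:E * (Ex P V)%:E))%E.
  apply: eq_integral => x _; rewrite -(eD V' iV) -integralZl //; last exact: iD V' iV.
rewrite integralZr //; last exact: iD Z' iZ.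
by rewrite (eD Z' iZ).
Qed.

End independence_expectation.

(** * Independence of events by the pi-lambda argument *)

Section independent_events.
Context {d : measure_display} {T : measurableType d} {R : realType}.
Variable P : probability T R.

Definition indep_events (E A : set T) := P (A `&` E) = (P A * P E)%E.

Lemma prob_fin (A : set T) : measurable A -> exists2 x : R, P A = x%:E & 0 <= x.
Proof.
move=> mA; exists (fine (P A)); last exact: fine_ge0.
by rewrite fineK // fin_num_measure.
Qed.

Lemma indep_events_dynkin E : measurable E ->
  dynkin [set A | measurable A /\ indep_events E A].
Proof.
move=> mE; split => /=.
- split => //; rewrite /indep_events setTI.
  by rewrite [P setT](_ : _ = 1%E) ?mul1e //; exact: probability_setT.
- move=> A [mA iA]; split; first exact: measurableC.
  rewrite /indep_events.
  have mAE : measurable (A `&` E) by exact: measurableI.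
  have mCE : measurable (~` A `&` E) by apply: measurableI => //; exact: measurableC.
  have := @measureU _ _ _ P _ _ mAE mCE.
  rewrite -setIUl setUv setTI => h.
  have {}h : P E = (P (A `&` E) + P (~` A `&` E))%E.
    by apply: h; rewrite setIACA setICr set0I.
  rewrite iA in h.
  rewrite probability_setC //.
  have [a Pa _] := prob_fin mA; have [e Pe _] := prob_fin mE.
  have [c Pc _] := prob_fin mCE.
  move: h; rewrite Pa Pe Pc -!EFinM -EFinD => -[h].
  by congr (_%:E); lra.
- move=> F tF hF; split; first by apply: bigcup_measurable => i _; case: (hF i).
  have mF i : measurable (F i) by case: (hF i).
  have mFE i : measurable (F i `&` E) by exact: measurableI.
  rewrite /indep_events setI_bigcupl measure_bigcup //; last exact: trivIset_setIr.
  rewrite measure_bigcup //.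
  have [e Pe _] := prob_fin mE.
  rewrite Pe muleC -nneseriesZl; last by move=> i _; exact: measure_ge0.
  apply: eq_eseriesr => i _; transitivity (P (F i) * P E)%E; first exact: (hF i).2.
  by rewrite Pe muleC.
Qed.

Lemma indep_events_generated E (G : set (set T)) : measurable E ->
  setI_closed G -> (forall A, G A -> measurable A /\ indep_events E A) ->
  forall A, <<s G >> A -> measurable A /\ indep_events E A.
Proof.
move=> mE GI GH A; apply: (lambda_system_subset GI _ GH) => //.
exact/dynkin_lambda_system/indep_events_dynkin.
Qed.

Lemma prob_eq_off_null (N A B : set T) : measurable A -> measurable B ->
  measurable N -> P N = 0%E -> (forall w, ~ N w -> (A w <-> B w)) -> P A = P B.
Proof.
move=> mA mB mN PN AB.
rewrite -(measureU0 mA mN PN) -(measureU0 mB mN PN); congr (P _).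
apply/seteqP; split => w [h|h]; try by right.
- by have [Nw|Nw] := pselect (N w); [right|left; apply/AB].
- by have [Nw|Nw] := pselect (N w); [right|left; apply/AB].
Qed.

Lemma ae_null_set (Q : T -> Prop) : {ae P, forall w, Q w} ->
  exists N, [/\ measurable N, P N = 0%E & forall w, ~ N w -> Q w].
Proof.
move=> [N [mN PN h]]; exists N; split => // w Nw.
by apply: contrapT => Qw; apply: Nw; apply: h.
Qed.

End independent_events.

Section strictly_increasing_times.
Context {R : realType}.

(** Independence of Brownian increments is available only along strictly increasing times. An
    arbitrary finite list of past times is therefore sorted, without repetition, into a grid from 0
    to s, to which t is appended as last point. *)
Lemma increasing_times (l : seq R) (s t : R) : 0 <= s -> s < t ->
  (forall u, u \in l -> 0 <= u <= s) ->
  exists m (tt : nat -> R), [/\ tt 0%N = 0, tt m = s, tt m.+1 = t,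
     forall k, (k < m.+1)%N -> tt k < tt k.+1
   & forall u, u \in l -> exists2 k, (k <= m)%N & tt k = u].
Proof.
move=> s0 st hl.
pose L := sort <=%R (undup (0 :: s :: l)).
have Lsorted : sorted <%R L by rewrite sort_lt_sorted undup_uniq.
have memL u : (u \in L) = (u \in 0 :: s :: l) by rewrite mem_sort mem_undup.
have Lin u : u \in L -> 0 <= u <= s.
  rewrite memL !inE => /orP[/eqP ->|/orP[/eqP ->|]]; rewrite ?lexx ?s0 //.
  exact: hl.
have lt_nth i j : (i < j)%N -> (j < size L)%N -> nth t L i < nth t L j.
  move=> ij jL; apply: (sorted_ltn_nth lt_trans) => //.
  by rewrite inE (ltn_trans ij).
have sL : s \in L by rewrite memL !inE eqxx orbT.
have zL : 0 \in L by rewrite memL !inE eqxx.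
have size0 : (0 < size L)%N by case: (L) sL.
have idx u : u \in L -> (index u L <= (size L).-1)%N.
  by move=> uL; rewrite -ltnS prednK // index_mem.
exists (size L).-1, (nth t L); split.
- apply/eqP; rewrite eq_le; apply/andP; split; last first.
    by have /andP[] := Lin _ (mem_nth t size0).
  rewrite -[X in _ <= X](nth_index t zL); have [->//|i0] := eqVneq (index 0 L) 0%N.
  by rewrite ltW // lt_nth ?lt0n // index_mem.
- apply/eqP; rewrite eq_le; apply/andP; split.
    suff /andP[] : 0 <= nth t L (size L).-1 <= s by [].
    by apply: Lin; rewrite mem_nth // ltn_predL.
  rewrite -[X in X <= _](nth_index t sL); have [->//|i0] := eqVneq (index s L) (size L).-1.
  by rewrite ltW // lt_nth ?ltn_predL // ltn_neqAle i0 idx.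
- by rewrite prednK // nth_default.
- move=> k; rewrite prednK // => kL.
  have [kL'|kL'] := ltnP k.+1 (size L); first exact: lt_nth.
  rewrite (nth_default _ kL') (le_lt_trans _ st) //.
  by have /andP[] := Lin _ (mem_nth t kL).
- move=> u ul; have uL : u \in L by rewrite memL !inE ul !orbT.
  by exists (index u L); [exact: idx|rewrite nth_index].
Qed.

End strictly_increasing_times.

(** * Brownian increments and the filtration *)

Section brownian_motion.
Context {d : measure_display} {T : measurableType d} {R : realType}.
Variable P : probability T R.
Variables (n : nat) (W : R -> T -> 'cV[R]_n).
Hypothesis W_bm : standard_brownian_motion P W.

Definition path_events (U : R -> 'I_n -> Prop) : set (set T) :=
  [set E | (exists s i B, [/\ U s i, measurable (B : set R)
                            & E = (fun w => W s w i 0) @^-1` B])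
           \/ (measurable E /\ P E = 0%E)].

(* The past up to time s, enlarged by the values at time t of the components
   other than k. *)
Definition past_or_other (s t : R) (k : 'I_n) (u : R) (i : 'I_n) : Prop :=
  0 <= u <= s \/ u = t /\ i != k.

Let mW t i : 0 <= t -> measurable_fun setT (fun w => W t w i 0).
Proof. by case: W_bm => + _ _ _ _; apply. Qed.

Lemma measurable_path_events U : (forall u i, U u i -> 0 <= u) ->
  forall A, <<s (path_events U) >> A -> measurable A.
Proof.
move=> U0 A; apply: smallest_sub; first exact: sigma_algebra_measurable.
move=> E [[s [i [B [Us mB ->]]]]|[]//].
by rewrite -[_ @^-1` _]setTI; apply: mW => //; exact: U0 Us.
Qed.

Section rectangles.
Variables (s t : R) (k : 'I_n).
Hypotheses (s0 : 0 <= s) (st : s < t).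

Let dW w : R := W t w k 0 - W s w k 0.

Let mdW B : measurable B -> measurable (dW @^-1` B).
Proof.
move=> mB; rewrite -[_ @^-1` _]setTI; apply: measurable_funB => //; apply: mW => //.
exact: le_trans (ltW st).
Qed.

Let cylinder (l : seq (R * 'I_n * set R)) : set T :=
  [set w | forall x, x \in l -> x.2 (W x.1.1 w x.1.2 0)].

Let valid (l : seq (R * 'I_n * set R)) :=
  forall x, x \in l -> past_or_other s t k x.1.1 x.1.2 /\ measurable x.2.

Let past_ge0 u i : past_or_other s t k u i -> 0 <= u.
Proof. by case=> [/andP[]//|[-> _]]; rewrite (le_trans s0) // ltW. Qed.

Let measurable_cylinder (X : R * 'I_n -> T -> R) (l : seq (R * 'I_n * set R))
   (G : set (set T)) :
   (forall x, x \in l -> <<s G >> (X x.1 @^-1` x.2)) ->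
  <<s G >> [set w | forall x, x \in l -> x.2 (X x.1 w)].
Proof.
elim: l => [|x l ih] h.
  rewrite (_ : [set w | _] = setT); last by apply/seteqP; split.
  exact: (@measurableT _ (g_sigma_algebraType G)).
rewrite (_ : [set w | _] = (X x.1 @^-1` x.2) `&` [set w | forall x, x \in l -> x.2 (X x.1 w)]).
  apply: (@measurableI _ (g_sigma_algebraType G)); first by apply: h; rewrite mem_head.
  by apply: ih => y yl; apply: h; rewrite inE yl orbT.
apply/seteqP; split => w /=.
  by move=> hw; split; [apply: hw; rewrite mem_head|move=> y yl; apply: hw; rewrite inE yl orbT].
by move=> [hx hl] y; rewrite inE => /orP[/eqP ->|/hl].
Qed.

Let valid_cylinder_measurable l : valid l -> measurable (cylinder l).
Proof.
move=> vl.
have sTT : <<s measurable >> = @measurable _ T.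
  by apply: sigma_algebra_id; exact: sigma_algebra_measurable.
have := @measurable_cylinder (fun ui w => W ui.1 w ui.2 0) l (@measurable _ T).
rewrite sTT; apply => x xl; have [vx mx] := vl x xl.
by rewrite -[_ @^-1` _]setTI; apply: mW => //; exact: past_ge0 vx.
Qed.

(** Outside the null event where [W 0] differs from 0, every value of [W] in the cylinder is a sum
    of grid increments other than the increment of component [k] over [s, t]. The cylinder thus
    agrees, up to a null event, with an event generated by increments independent of [dW]. *)
Let cylinder_indep l B : valid l -> measurable B ->
  indep_events P (dW @^-1` B) (cylinder l).
Proof.
move=> vl mB.
pose past := [seq u <- [seq x.1.1 | x <- l] | u <= s].
have hpast u : u \in past -> 0 <= u <= s.
  rewrite mem_filter => /andP[us /mapP[x xl eu]].
  by rewrite us andbT eu; apply: past_ge0; case: (vl x xl) => + _; exact.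
have [m [tt [tt0 ttm ttm1 tt_incr tt_past]]] := increasing_times s0 st hpast.
pose Y (ik : 'I_n * 'I_m.+1) w := W (tt ik.2.+1) w ik.1 0 - W (tt ik.2) w ik.1 0.
have Yind : mutually_independent P Y.
  by case: W_bm => _ _ _ _; apply => //; rewrite tt0.
have ttge0 j : (j <= m.+1)%N -> 0 <= tt j.
  elim: j => [|j ih] jm; first by rewrite tt0.
  by rewrite (le_trans (ih _)) ?(ltnW jm) // ltW // tt_incr.
have mY ik : measurable_fun setT (Y ik).
  by apply: measurable_funB; apply: mW; apply: ttge0; [exact: ltn_ord|exact/ltnW/ltn_ord].
pose kk : 'I_n * 'I_m.+1 := (k, ord_max).
have YdW : Y kk = dW by rewrite /Y /kk /= ttm ttm1.
(* A pi-system: rectangles in the grid increments with no constraint on the increment [kk], which is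
   [dW]. *)
pose G : set (set T) := [set A | exists B : 'I_n * 'I_m.+1 -> set R,
  [/\ forall ik, measurable (B ik), B kk = setT & A = \bigcap_ik (Y ik @^-1` B ik)]].
have mYB ik B0 : measurable B0 -> measurable (Y ik @^-1` B0).
  by move=> mB0; rewrite -[_ @^-1` _]setTI; exact: mY.
have Gind A : G A -> measurable A /\ indep_events P (dW @^-1` B) A.
  move=> [C [mC Ckk ->]]; split.
    apply: fin_bigcap_measurable => [|ik _]; [exact: finite_finset|exact: mYB].
  rewrite /indep_events -YdW.
  rewrite (_ : _ `&` _ = \bigcap_ik (Y ik @^-1` (if ik == kk then B else C ik))).
    rewrite !Yind => //; last by move=> ik; case: eqP.
    rewrite (bigD1 kk) //= eqxx [X in _ = (X * _)%E](bigD1 kk) //= Ckk.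
    rewrite preimage_setT [P setT](_ : _ = 1%E); last exact: probability_setT.
    rewrite mul1e muleC; congr (_ * _)%E.
    by apply: eq_bigr => ik /negbTE ->.
  apply/seteqP; split => w /=.
    by move=> [hC hB] ik _ /=; case: eqP => [->|_] //; exact: hC.
  move=> h; split => [ik _|]; last by have := h kk I; rewrite /= eqxx.
  have := h ik I; rewrite /=; case: eqP => // -> _.
  by rewrite Ckk.
have GI : setI_closed G.
  move=> _ _ [C [mC Ckk ->]] [D [mD Dkk ->]]; exists (fun ik => C ik `&` D ik).
  split; [by move=> ik; exact: measurableI|by rewrite Ckk Dkk setTI|].
  by rewrite -bigcapI.
have sGind := indep_events_generated (mdW mB) GI Gind.
have tt_lt i j : (i < j)%N -> (j <= m.+1)%N -> tt i < tt j.
  elim: j => // j ih; rewrite ltnS leq_eqVlt => /orP[/eqP ->|ij] jm.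
    exact: tt_incr.
  by rewrite (lt_trans (ih ij (ltnW jm))) // tt_incr.
have vtt u i : past_or_other s t k u i -> (exists x, [/\ x \in l, x.1.1 = u & x.1.2 = i]) ->
    exists2 j, (j <= m.+1)%N & tt j = u.
  case=> [/andP[u0 us] [x [xl xu _]]|[-> _] _]; last by exists m.+1.
  have [|j jm <-] := tt_past u; last by exists j => //; exact: leqW.
  by rewrite mem_filter us; apply/mapP; exists x.
(* The value of [W] relative to time 0, rebuilt from the increments that end no later than the given
   time. *)
pose X (ui : R * 'I_n) w := \sum_(q < m.+1 | tt q.+1 <= ui.1) Y (ui.2, q) w.
have XW w u i j : (j <= m.+1)%N -> tt j = u -> X (u, i) w = W u w i 0 - W 0 w i 0.
  move=> jm <-; rewrite /X /=.
  rewrite (eq_bigl (fun q : 'I_m.+1 => (q < j)%N)); last first.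
    move=> q; apply/idP/idP => [h|qj].
      rewrite ltnNge; apply/negP => jq.
      by have := tt_lt j q.+1 jq (ltn_ord q); rewrite ltNge h.
    move: qj; rewrite leq_eqVlt => /orP[/eqP ->//|qj].
    by rewrite ltW // tt_lt.
  rewrite -(@big_ord_widen _ _ _ j m.+1 (fun q => W (tt q.+1) w i 0 - W (tt q) w i 0) jm).
  by rewrite -(big_mkord xpredT (fun q => W (tt q.+1) w i 0 - W (tt q) w i 0)) (@telescope_sumr _ 0 j (fun q => W (tt q) w i 0)) // tt0.
have GX x : x \in l -> <<s G >> (X x.1 @^-1` x.2).
  move=> xl; have [vx mx] := vl x xl.
  have mXx : @measurable_fun _ _ (g_sigma_algebraType G) R setT (X x.1).
    rewrite (_ : X x.1 = fun w => \sum_(q < m.+1)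
        if tt q.+1 <= x.1.1 then Y (x.1.2, q) w else 0); last first.
      by apply/funext => w; rewrite /X big_mkcond.
    apply: measurable_sum => q; case tq : (tt q.+1 <= x.1.1); last exact: measurable_cst.
    move=> _ C mC; rewrite setTI; apply: sub_gen_smallest.
    exists (fun ik => if ik == (x.1.2, q) then C else setT); split.
    - by move=> ik; case: eqP.
    (* The increment [kk] never enters: a time in the past is smaller than t, and a constraint at
       time t concerns a component other than [k]. *)
    - case: eqP => // -[ek eq]; exfalso; move: tq; rewrite -eq /= ttm1.
      case: vx => [/andP[_ us] tu|[_]]; last by rewrite ek eqxx.
      by move: (lt_le_trans st (le_trans tu us)); rewrite ltxx.
    - apply/seteqP; split => w /= h; first by move=> ik _ /=; case: eqP => [->|].
      by have := h (x.1.2, q) I; rewrite /= eqxx.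
  by have := mXx measurableT _ mx; rewrite setTI.
pose Xcyl : set T := [set w | forall x, x \in l -> x.2 (X x.1 w)].
have [mXcyl iXcyl] := sGind _ (measurable_cylinder GX).
have mcyl := valid_cylinder_measurable vl.
have [N [mN PN hN]] := ae_null_set (let: And5 _ h _ _ _ := W_bm in h).
have cylX w : ~ N w -> (cylinder l w <-> Xcyl w).
  move=> Nw; have W0 := hN w Nw.
  have XWx x : x \in l -> X x.1 w = W x.1.1 w x.1.2 0.
    move=> xl; have [vx _] := vl x xl.
    have [|j jm jx] := vtt _ _ vx; first by exists x.
    by case: (x) jx => -[u i] B' /= jx; rewrite (XW _ _ _ _ jm jx) W0 mxE subr0.
  by split => h x xl; have := h x xl; rewrite XWx.
rewrite /indep_events (prob_eq_off_null mcyl mXcyl mN PN cylX).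
rewrite [RHS](_ : _ = P (Xcyl `&` dW @^-1` B)); last exact: esym.
apply: (prob_eq_off_null _ _ mN PN).
- by apply: measurableI => //; exact: mdW.
- by apply: measurableI => //; exact: mdW.
- by move=> w Nw; have [h1 h2] := cylX w Nw; split => -[h h']; split => //; auto.
Qed.

(** Null events are among the generators of the augmented filtration, so the pi-system has to
    consist of the cylinders together with all null events; intersecting with a null event stays in
    the class. *)
Lemma increment_indep A B : <<s (path_events (past_or_other s t k)) >> A ->
  measurable B -> P (A `&` dW @^-1` B) = (P A * P (dW @^-1` B))%E.
Proof.
move=> sA mB; have mE := mdW mB.
pose G : set (set T) := [set A | (measurable A /\ P A = 0%E) \/
   exists2 l, valid l & A = cylinder l].
have mG E : G E -> measurable E.
  by case=> [[]//|[l vl ->]]; exact: valid_cylinder_measurable.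
have G0 E F : G E -> G F -> P E = 0%E -> G (E `&` F).
  move=> GE GF PE; left.
  have mEF : measurable (E `&` F) by apply: measurableI; exact: mG.
  split => //; apply/eqP; rewrite -measure_le0 -PE; apply: le_measure; rewrite ?inE //.
  exact: mG.
have GI : setI_closed G.
  move=> E F GE GF; have [[_ PE]|[l vl El]] := GE; first exact: G0.
  have [[_ PF]|[l' vl' Fl]] := GF; first by rewrite setIC; exact: G0.
  right; exists (l ++ l').
    by move=> x; rewrite mem_cat => /orP[/vl|/vl'].
  rewrite El Fl; apply/seteqP; split => w /=.
    by move=> [h1 h2] x; rewrite mem_cat => /orP[/h1|/h2].
  by move=> h; split => x xl; apply: h; rewrite mem_cat xl ?orbT.
have GH E : G E -> measurable E /\ indep_events P (dW @^-1` B) E.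
  move=> GE; split; first exact: mG.
  case: GE => [[mE' PE]|[l vl ->]]; last exact: cylinder_indep.
  rewrite /indep_events PE mul0e; apply/eqP; rewrite -measure_le0 -PE.
  apply: le_measure; rewrite ?inE //; exact: measurableI.
have sub : path_events (past_or_other s t k) `<=` G.
  move=> E [[u [i [C [Uu mC ->]]]]|h]; last by left.
  right; exists [:: (u, i, C)].
    by move=> x; rewrite inE => /eqP ->.
  apply/seteqP; split => w /= h; last by apply: (h (u, i, C)); rewrite mem_head.
  by move=> x; rewrite inE => /eqP ->.
by case: (indep_events_generated mE GI GH (sub_smallest2r (smallest_sigma_algebra _ _) sub sA)).
Qed.

End rectangles.
Local Notation F := (brownian_filtration P W).

Lemma measurable_wrtE (G : set (set T)) (f : T -> R) :
  measurable_wrt <<s G >> f <->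
  @measurable_fun _ _ (g_sigma_algebraType G) R setT f.
Proof.
split => [h _ B mB|h B mB]; first by rewrite setTI; exact: h.
by have := h measurableT B mB; rewrite setTI.
Qed.

Lemma measurable_wrt_sub (G G' : set (set T)) (f : T -> R) :
  G `<=` G' -> measurable_wrt G f -> measurable_wrt G' f.
Proof. by move=> GG' h B mB; apply: GG'; exact: h. Qed.


Lemma path_events_sub U V : (forall u i, U u i -> V u i) ->
  <<s path_events U >> `<=` <<s path_events V >>.
Proof.
move=> UV; apply: sub_smallest2r; first exact: smallest_sigma_algebra.
move=> E [[u [i [B [Uu mB ->]]]]|h]; last by right.
by left; exists u, i, B; split => //; exact: UV.
Qed.

Lemma filtration_mono s t : s <= t -> F s `<=` F t.
Proof.
move=> st; apply: path_events_sub => u _ /andP[-> us].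
exact: le_trans st.
Qed.

Lemma filtration_past s t k : F s `<=` <<s path_events (past_or_other s t k) >>.
Proof. by apply: path_events_sub => u i h; left. Qed.

Lemma filtration_measurable t (f : T -> R) : measurable_wrt (F t) f ->
  measurable_fun setT f.
Proof.
move=> h _ B mB; rewrite setTI; apply: measurable_path_events (h B mB).
by move=> u _ /andP[].
Qed.

Lemma filtrationW s t i : 0 <= s <= t -> measurable_wrt (F t) (fun w => W s w i 0).
Proof.
by move=> st B mB; apply: sub_gen_smallest; left; exists s, i, B.
Qed.

Lemma measurable_wrtM t (f g : T -> R) : measurable_wrt (F t) f -> measurable_wrt (F t) g ->
  measurable_wrt (F t) (fun w => f w * g w).
Proof.
by move=> /measurable_wrtE hf /measurable_wrtE hg; apply/measurable_wrtE; exact: measurable_funM.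
Qed.

Lemma measurable_wrtB t (f g : T -> R) : measurable_wrt (F t) f -> measurable_wrt (F t) g ->
  measurable_wrt (F t) (fun w => f w - g w).
Proof.
by move=> /measurable_wrtE hf /measurable_wrtE hg; apply/measurable_wrtE; exact: measurable_funB.
Qed.

Definition incr k s t w : R := W t w k 0 - W s w k 0.

Lemma measurable_dW k s t : 0 <= s -> 0 <= t -> measurable_fun setT (incr k s t).
Proof. by move=> s0 t0; apply: measurable_funB; exact: mW. Qed.

Lemma filtration_dW k s t u : 0 <= s <= u -> 0 <= t <= u ->
  measurable_wrt (F u) (incr k s t).
Proof. by move=> su tu; apply: measurable_wrtB; exact: filtrationW. Qed.

Section increment_moments.
Variables (k : 'I_n) (s t : R).
Hypotheses (s0 : 0 <= s) (st : s < t).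
Let t0 : 0 <= t. Proof. exact: le_trans (ltW st). Qed.
Let sd := Num.sqrt (t - s).
Let sd0 : 0 < sd. Proof. by rewrite sqrtr_gt0 subr_gt0. Qed.
Let sd2 : sd ^+ 2 = t - s. Proof. by rewrite sqr_sqrtr // subr_ge0 ltW. Qed.

Let lawE f : measurable_fun setT f -> (forall x, (0 <= f x)%E) ->
  (\int[P]_w f (incr k s t w) = \int[normal_prob 0 sd]_x f x)%E.
Proof.
move=> mf f0.
pose X : {mfun T >-> measurableTypeR R} := HB.pack (incr k s t : T -> measurableTypeR R)
  (@isMeasurableFun.Build _ _ T (measurableTypeR R) (incr k s t) (measurable_dW k s0 t0)).
rewrite -[LHS](ge0_integral_distribution X) //.
apply: eq_measure_integral => A mA _.
by have [_ _ _ law _] := W_bm; apply: law.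
Qed.

Lemma L2_dW : L2 P (incr k s t).
Proof.
have md := measurable_dW k s0 t0; split => //.
apply: int1_ge0 => [|w|]; [exact: measurable_funX|exact: sqr_ge0|].
rewrite (lawE (f := fun x => (x ^+ 2)%:E)); first by rewrite normal_moment2 // ltry.
- by apply/measurable_EFinP; exact: measurable_funX.
- by move=> x; rewrite lee_fin sqr_ge0.
Qed.

Lemma Ex_dW2 : Ex P (fun w => incr k s t w ^+ 2) = t - s.
Proof.
apply: EFin_inj; rewrite -Ex_fin; last by case: L2_dW.
rewrite (lawE (f := fun x => (x ^+ 2)%:E)); first by rewrite normal_moment2 // sd2.
- by apply/measurable_EFinP; exact: measurable_funX.
- by move=> x; rewrite lee_fin sqr_ge0.
Qed.

Lemma L2_dW2 : L2 P (fun w => incr k s t w ^+ 2).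
Proof.
have md := measurable_dW k s0 t0; split; first exact: measurable_funX.
rewrite (_ : (fun w => _) = (fun w => incr k s t w ^+ 4)); last first.
  by apply/funext => w; rewrite -exprM.
apply: int1_ge0 => [|w|]; [exact: measurable_funX|by rewrite (exprM _ 2 2) sqr_ge0|].
rewrite (lawE (f := fun x => (x ^+ 4)%:E)).
- by rewrite (le_lt_trans (normal_moment4 sd0)) // ltry.
- by apply/measurable_EFinP; exact: measurable_funX.
- by move=> x; rewrite lee_fin (exprM _ 2 2) sqr_ge0.
Qed.

Lemma Ex_dW4 : Ex P (fun w => incr k s t w ^+ 4) <= 3 * (t - s) ^+ 2.
Proof.
have [_] := L2_dW2; rewrite (_ : (fun w => _) = (fun w => incr k s t w ^+ 4)) => [i4|]; last first.
  by apply/funext => w; rewrite -exprM.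
rewrite -lee_fin -Ex_fin // (lawE (f := fun x => (x ^+ 4)%:E)).
- by rewrite (le_trans (normal_moment4 sd0)) // lee_fin (exprM _ 2 2) sd2.
- by apply/measurable_EFinP; exact: measurable_funX.
- by move=> x; rewrite lee_fin (exprM _ 2 2) sqr_ge0.
Qed.

Lemma Ex_dW : Ex P (incr k s t) = 0.
Proof.
pose X : {mfun T >-> measurableTypeR R} := HB.pack (incr k s t : T -> measurableTypeR R)
  (@isMeasurableFun.Build _ _ T (measurableTypeR R) (incr k s t) (measurable_dW k s0 t0)).
rewrite -(normal_mean sd0); congr fine.
rewrite -[LHS](@integral_distribution _ _ _ _ _ _ X EFin) //; last exact: L2_int1 L2_dW.
apply: eq_measure_integral => A mA _.
by have [_ _ _ law _] := W_bm; apply: law.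
Qed.

Let past := <<s path_events (past_or_other s t k) >>.

Lemma Ex_past_dW Z : measurable_wrt past Z -> int1 P Z ->
  int1 P (fun w => Z w * incr k s t w) /\ Ex P (fun w => Z w * incr k s t w) = 0.
Proof.
move=> mZ iZ; rewrite -(mulr0 (Ex P Z)) -Ex_dW.
apply: indep_int1_Ex => //; last exact: L2_int1 L2_dW.
by move=> A B mA mB; apply: increment_indep => //; exact: mZ.
Qed.

Lemma Ex_past_dW2 Z : measurable_wrt past Z -> int1 P Z ->
  int1 P (fun w => Z w * incr k s t w ^+ 2) /\
  Ex P (fun w => Z w * incr k s t w ^+ 2) = Ex P Z * (t - s).
Proof.
move=> mZ iZ; rewrite -Ex_dW2.
apply: indep_int1_Ex => //; last by case: L2_dW.
move=> A B mA mB.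
have mB' : measurable ((fun x : R => x ^+ 2) @^-1` B).
  by rewrite -[_ @^-1` _]setTI; apply: measurable_funX.
exact: (increment_indep s0 st (mZ A mA) mB').
Qed.

End increment_moments.

Lemma L2_dW_le k s t : 0 <= s -> s <= t -> L2 P (incr k s t).
Proof.
move=> s0; rewrite le_eqVlt => /orP[/eqP ->|st]; last exact: L2_dW.
rewrite (_ : incr k t t = fun=> 0); last by apply/funext => w; rewrite /incr subrr.
by apply: (@L2_bdd _ _ _ _ _ 0) => [|w]; [exact: measurable_cst|rewrite normr0].
Qed.

Lemma Ex_filtration_dW k s t Z : 0 <= s -> s <= t -> measurable_wrt (F s) Z ->
  int1 P Z -> int1 P (fun w => Z w * incr k s t w) /\ Ex P (fun w => Z w * incr k s t w) = 0.
Proof.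
move=> s0; rewrite le_eqVlt => /orP[/eqP -> _ _|st mZ iZ].
  rewrite (_ : (fun w => _) = fun=> 0); first by split; [exact: int1_cst|exact: Ex_cst].
  by apply/funext => w; rewrite /incr subrr mulr0.
by apply: Ex_past_dW => //; apply: measurable_wrt_sub mZ; exact: filtration_past.
Qed.

Lemma Ex_filtration_dW2 k s t Z : 0 <= s -> s <= t -> measurable_wrt (F s) Z ->
  int1 P Z -> int1 P (fun w => Z w * incr k s t w ^+ 2) /\
  Ex P (fun w => Z w * incr k s t w ^+ 2) = Ex P Z * (t - s).
Proof.
move=> s0; rewrite le_eqVlt => /orP[/eqP -> _ _|st mZ iZ].
  rewrite (_ : (fun w => _) = fun=> 0).
    by split; [exact: int1_cst|rewrite Ex_cst subrr mulr0].
  by apply/funext => w; rewrite /incr subrr expr0n mulr0.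
by apply: Ex_past_dW2 => //; apply: measurable_wrt_sub mZ; exact: filtration_past.
Qed.

(** The increment of component [j] is counted as part of the enlarged past of component [k]. The
    increment of [k] is then a centred factor independent of everything else in the product. *)
Lemma Ex_filtration_dW_cross j k s t xi c : j != k -> 0 <= s -> s <= t ->
  measurable_wrt (F s) xi -> (forall w, `|xi w| <= c) ->
  int1 P (fun w => xi w * (incr j s t w * incr k s t w)) /\
  Ex P (fun w => xi w * (incr j s t w * incr k s t w)) = 0.
Proof.
move=> jk s0; rewrite le_eqVlt => /orP[/eqP -> _ _|st mxi bxi].
  rewrite (_ : (fun w => _) = fun=> 0); first by split; [exact: int1_cst|exact: Ex_cst].
  by apply/funext => w; rewrite /incr subrr mul0r mulr0.
rewrite (_ : (fun w => _) = fun w => (xi w * incr j s t w) * incr k s t w); last first.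
  by apply/funext => w; rewrite mulrA.
apply: Ex_past_dW => //; last first.
  apply: L2_int1; apply: (L2M_bdd (filtration_measurable mxi) bxi); exact: L2_dW.
have mxi' := measurable_wrt_sub (filtration_past (t := t) (k := k)) mxi.
apply/measurable_wrtE; apply: measurable_funM; first exact/measurable_wrtE.
apply: measurable_funB; apply/measurable_wrtE => B mB; apply: sub_gen_smallest; left.
  by exists t, j, B; split => //; right.
by exists s, j, B; split => //; left; rewrite s0 lexx.
Qed.

End brownian_motion.

(** * Ito integrals *)

Section simple_integrands.
Context {d : measure_display} {T : measurableType d} {R : realType}.
Variable P : probability T R.
Variables (n : nat) (W : R -> T -> 'cV[R]_n).
Hypothesis W_bm : standard_brownian_motion P W.
Local Notation F := (brownian_filtration P W).
Local Notation dW := (incr W).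
Local Notation mu := (@lebesgue_measure R).

(* The adapted process v 1_[a, b[. Unlike in [elementary], the intervals of a
   list of steps may overlap, so that lists are closed under addition. *)
Record step := Step {
  st_a : R; st_b : R; st_v : T -> R;
  st_ab : 0 <= st_a <= st_b;
  st_meas : measurable_wrt (F st_a) st_v;
  st_bdd : exists c, forall w, `|st_v w| <= c }.

Arguments st_meas _ [B] _.

Implicit Types (x y : step) (l : seq step) (k : 'I_n).

Definition step_process l (r : R) (w : T) : R :=
  \sum_(x <- l) st_v x w * \1_(`[st_a x, st_b x[%classic) r.

Definition step_integral k l (w : T) : R :=
  \sum_(x <- l) st_v x w * dW k (st_a x) (st_b x) w.

(** The length of the intersection of the two time intervals, equal to 0 when they are disjoint. *)
Definition overlap x y : R :=
  Num.max 0 (Num.min (st_b x) (st_b y) - Num.max (st_a x) (st_a y)).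

Let mv x : measurable_fun setT (st_v x).
Proof. exact (filtration_measurable W_bm (st_meas x)). Qed.

Let step_L2 k x : L2 P (fun w => st_v x w * dW k (st_a x) (st_b x) w).
Proof.
have [c hc] := st_bdd x; have /andP[a0 ab] := st_ab x.
by apply: (L2M_bdd (mv x) hc); exact: L2_dW_le.
Qed.

Let v_L2 x : L2 P (st_v x).
Proof. by have [c hc] := st_bdd x; exact: (L2_bdd _ (mv x) hc). Qed.

Lemma overlapC x y : overlap x y = overlap y x.
Proof. by rewrite /overlap minC (maxC (st_a x)). Qed.

(** The two increments are cut at the later start a' and at the earlier end c. Each product of
    increments over disjoint intervals has a later factor that is centred given the rest, so only
    the square over [a', c] contributes. *)
Let step_isometry_le k x y : st_a x <= st_a y ->
  Ex P (fun w => (st_v x w * dW k (st_a x) (st_b x) w) *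
                 (st_v y w * dW k (st_a y) (st_b y) w)) =
  Ex P (fun w => st_v x w * st_v y w) * overlap x y.
Proof.
move=> aa'.
set a := st_a x; set b := st_b x; set a' := st_a y; set b' := st_b y.
have /andP[a0 ab] := st_ab x; have /andP[a'0 ab'] := st_ab y.
rewrite -/a -/b in a0 ab; rewrite -/a' -/b' in a'0 ab'.
have [c1 hc1] := st_bdd x; have [c2 hc2] := st_bdd y.
set ee := fun w => st_v x w * st_v y w.
have mee : measurable_wrt (F a') ee.
  apply: measurable_wrtM; last exact: st_meas.
  by apply: measurable_wrt_sub (st_meas x); exact: filtration_mono.
have bee w : `|ee w| <= c1 * c2 by rewrite normrM ler_pM.
have mee' := filtration_measurable W_bm mee.
have iee : int1 P ee by exact: int1_bdd mee' bee.
have eL2 f : L2 P f -> L2 P (fun w => ee w * f w) by move=> hf; exact: (L2M_bdd mee' bee hf).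
rewrite /overlap -/a -/b -/a' -/b' (max_idPr aa').
have [ba|ab2] := leP b a'.
  rewrite (max_idPl _) ?mulr0; last first.
    by rewrite subr_le0 (le_trans _ ba) // ge_min lexx.
  rewrite (_ : (fun w => _) = fun w => (ee w * dW k a b w) * dW k a' b' w); last first.
    by apply/funext => w; rewrite /ee -!mulrA; congr (_ * _); rewrite mulrCA.
  apply: (Ex_filtration_dW W_bm k a'0 ab' _ _).2.
    apply: measurable_wrtM => //; apply: filtration_dW; first by rewrite a0.
    by rewrite (le_trans a0 ab).
  by apply: L2_int1; apply: eL2; exact: L2_dW_le.
set c := Num.min b b'.
have a'c : a' <= c by rewrite le_min (ltW ab2).
have c0 : 0 <= c by exact: le_trans a'c.
have cb : c <= b by rewrite ge_min lexx.
have cb' : c <= b' by rewrite ge_min lexx orbT.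
rewrite (max_idPr _) ?subr_ge0 //.
pose t1 w := (ee w * dW k a a' w) * dW k a' b' w.
pose t2 w := ee w * dW k a' c w ^+ 2.
pose t3 w := (ee w * dW k a' c w) * dW k c b' w.
pose t4 w := (ee w * dW k a' c w) * dW k c b w.
rewrite (_ : (fun w => _) = fun w => t1 w + t2 w + t3 w + t4 w); last first.
  apply/funext => w; rewrite /t1 /t2 /t3 /t4 /incr.
  (* One of b and b' equals c, so one of the two increments after c is 0. *)
  have : (W b w k 0 - W c w k 0) * (W b' w k 0 - W c w k 0) = 0.
    by rewrite /c; case: (leP b b') => _; rewrite subrr ?mul0r ?mulr0.
  move=> h; have : ee w * ((W b w k 0 - W c w k 0) * (W b' w k 0 - W c w k 0)) = 0.
    by rewrite h mulr0.
  by rewrite /ee; nra.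
have [i1 e1] : int1 P t1 /\ Ex P t1 = 0.
  apply: Ex_filtration_dW => //.
    by apply: measurable_wrtM => //; apply: filtration_dW; rewrite ?a0 ?a'0 ?lexx.
  by apply: L2_int1; apply: eL2; exact: L2_dW_le.
have [i2 e2] : int1 P t2 /\ Ex P t2 = Ex P ee * (c - a').
  exact: Ex_filtration_dW2.
have mc : measurable_wrt (F c) (fun w => ee w * dW k a' c w).
  apply: measurable_wrtM; last by apply: filtration_dW; rewrite ?a'0 ?c0 ?lexx.
  by apply: measurable_wrt_sub mee; exact: filtration_mono.
have ic : int1 P (fun w => ee w * dW k a' c w).
  by apply: L2_int1; apply: eL2; exact: L2_dW_le.
have [i3 e3] : int1 P t3 /\ Ex P t3 = 0 by exact: Ex_filtration_dW.
have [i4 e4] : int1 P t4 /\ Ex P t4 = 0 by exact: Ex_filtration_dW.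
by rewrite (ExD (int1D (int1D i1 i2) i3) i4) (ExD (int1D i1 i2) i3) (ExD i1 i2) e1 e2 e3 e4
  add0r !addr0.
Qed.

Lemma step_isometry k x y :
  Ex P (fun w => (st_v x w * dW k (st_a x) (st_b x) w) *
                 (st_v y w * dW k (st_a y) (st_b y) w)) =
  Ex P (fun w => st_v x w * st_v y w) * overlap x y.
Proof.
have [h|h] := leP (st_a x) (st_a y); first exact: step_isometry_le.
rewrite overlapC -[in RHS](funext (fun w => mulrC (st_v y w) (st_v x w))).
rewrite -(step_isometry_le k (ltW h)).
by congr Ex; apply/funext => w; rewrite mulrC.
Qed.

Lemma step_integral_L2 k l : L2 P (step_integral k l).
Proof. by apply: L2_sum => x; exact: step_L2. Qed.

Let Ex_step_integral2 k l : Ex P (fun w => step_integral k l w ^+ 2) =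
  \sum_(x <- l) \sum_(y <- l) Ex P (fun w => st_v x w * st_v y w) * overlap x y.
Proof.
rewrite (_ : (fun w => _) = fun w => \sum_(x <- l) \sum_(y <- l)
   (st_v x w * dW k (st_a x) (st_b x) w) * (st_v y w * dW k (st_a y) (st_b y) w)).
  rewrite Ex_sum; last by move=> x; apply: int1_sum => y; exact: L2_mul.
  apply: eq_bigr => x _; rewrite Ex_sum; last by move=> y; exact: L2_mul.
  by apply: eq_bigr => y _; exact: step_isometry.
by apply/funext => w; rewrite expr2 big_distrlr.
Qed.

Let integral_indic_overlap c x y :
  mu.-integrable setT (fun r => (c * (\1_(`[st_a x, st_b x[%classic) r *
      \1_(`[st_a y, st_b y[%classic) r))%:E) /\
  (\int[mu]_r (c * (\1_(`[st_a x, st_b x[%classic) r *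
      \1_(`[st_a y, st_b y[%classic) r))%:E = (c * overlap x y)%:E)%E.
Proof.
set A := `[Num.max (st_a x) (st_a y), Num.min (st_b x) (st_b y)[%classic.
have AE r : \1_(`[st_a x, st_b x[%classic) r * \1_(`[st_a y, st_b y[%classic) r = \1_A r :> R.
  rewrite -[LHS]/((\1_(`[st_a x, st_b x[%classic) \* \1_(`[st_a y, st_b y[%classic)) r).
  rewrite -indicI; congr (\1_ _ _); apply/seteqP; split => u; rewrite /A /=
    !in_itv /= ge_max lt_min.
    by move=> [/andP[-> ->] /andP[-> ->]].
  by move=> /andP[/andP[-> ->] /andP[-> ->]].
have muA : mu A = (overlap x y)%:E.
  rewrite lebesgue_measure_itv /= lte_fin /overlap.
  set p := Num.max _ (st_a y); set q := Num.min _ _.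
  case: ltP => pq; rewrite ?EFinB.
    by rewrite (max_idPr _) // subr_ge0 ltW.
  by rewrite (max_idPl _) // subr_le0.
have iA : mu.-integrable setT (EFin \o (\1_A : R -> R)).
  by apply: integrable_indic_itv.
have fE : (fun r => (c * (\1_(`[st_a x, st_b x[%classic) r *
      \1_(`[st_a y, st_b y[%classic) r))%:E) = (fun r => c%:E * (\1_A r)%:E)%E.
  by apply/funext => r; rewrite AE EFinM.
rewrite fE; split; first exact: integrableZl.
rewrite integralZl // integral_indic; last 2 first.
- by [].
- exact: measurable_itv.
transitivity (c%:E * mu A)%E; first by congr (_ * mu _)%E; exact: setIT.
by rewrite muA.
Qed.

(** Both sides are bilinear in the steps and reduce to the same double sum of E (v_x v_y) times the
    overlap, so overlapping intervals cause no difficulty. *)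
Lemma step_process_isometry k l :
  (\int[P]_w \int[mu]_r ((step_process l r w) ^+ 2)%:E =
   (Ex P (fun w => step_integral k l w ^+ 2))%:E)%E.
Proof.
rewrite Ex_step_integral2.
transitivity (\int[P]_w (\sum_(x <- l) \sum_(y <- l) (st_v x w * st_v y w) * overlap x y)%:E)%E.
  apply: eq_integral => w _.
  transitivity (\int[mu]_r (\sum_(x <- l) \sum_(y <- l) ((st_v x w * st_v y w) *
     (\1_(`[st_a x, st_b x[%classic) r * \1_(`[st_a y, st_b y[%classic) r))%:E))%E.
    apply: eq_integral => r _; under [RHS]eq_bigr do rewrite sumEFin.
    rewrite sumEFin; congr EFin; rewrite /step_process expr2 big_distrlr /=.
    by apply: eq_bigr => x _; apply: eq_bigr => y _; rewrite mulrACA.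
  rewrite integral_sum //; last first.
    by move=> x; apply: integrable_sum => // y; case: (integral_indic_overlap (st_v x w * st_v y w) x y).
  rewrite -sumEFin; apply: eq_bigr => x _.
  rewrite integral_sum //; last first.
    by move=> y; case: (integral_indic_overlap (st_v x w * st_v y w) x y).
  rewrite -sumEFin; apply: eq_bigr => y _.
  by case: (integral_indic_overlap (st_v x w * st_v y w) x y).
have ivv x y : int1 P (fun w => st_v x w * st_v y w * overlap x y).
  by apply: int1Zr; exact: L2_mul.
rewrite Ex_fin; last by apply: int1_sum => x; apply: int1_sum => y.
congr EFin; rewrite Ex_sum; last by move=> x; apply: int1_sum => y.
apply: eq_bigr => x _; rewrite Ex_sum //.
by apply: eq_bigr => y _; rewrite ExZr //; exact: L2_mul.
Qed.

End simple_integrands.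

(** * Mean-square norms on the product of sample space and time *)

Section ito_approximation.
Context {d : measure_display} {T : measurableType d} {R : realType}.
Variable P : probability T R.

Import HBNNSimple.

(** Made for an [f] that comes from the original solution, whose joint measurability is unknown. Its
    integral is a supremum over simple functions below it, and those below [g] restricted to the
    complement of [N] are among them. *)
Lemma le_integral_off_null (f g : T -> \bar R) (N : set T) :
  (forall w, (0 <= f w)%E) -> (forall w, (0 <= g w)%E) -> measurable_fun setT g ->
  measurable N -> P N = 0%E -> (forall w, ~ N w -> (g w <= f w)%E) ->
  (\int[P]_w g w <= \int[P]_w f w)%E.
Proof.
move=> f0 g0 mg mN PN gf.
rewrite (ge0_negligible_integral mN measurableT mg (fun w _ => g0 w) PN).
rewrite setTD integral_mkcond !ge0_integralTE //; last first.
  by move=> w; rewrite patchE; case: ifP.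
apply: ereal_sup_le => _ [h hh <-]; exists h => // w.
apply: (le_trans (hh w)); rewrite patchE; case: ifPn => //.
by rewrite inE => /gf.
Qed.

Notation mu := (@lebesgue_measure R).
Definition jointly_measurable (f : R -> T -> R) :=
  measurable_fun setT (fun x : T * R => f x.2 x.1).

Definition sq_norm (f : R -> T -> R) : \bar R :=
  (\int[P]_w \int[mu]_r ((f r w) ^+ 2)%:E)%E.

Definition sq_norm_on (D : set R) (f : R -> T -> R) : \bar R :=
  (\int[P]_w \int[mu]_(r in D) ((f r w) ^+ 2)%:E)%E.

Lemma jointly_measurableB f g : jointly_measurable f -> jointly_measurable g ->
  jointly_measurable (fun r w => f r w - g r w).
Proof. by move=> mf mg; exact: measurable_funB. Qed.

Lemma sq_norm_onE D f : measurable D ->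
  sq_norm_on D f = sq_norm (fun r w => f r w * \1_D r).
Proof.
move=> mD; apply: eq_integral => w _; rewrite integral_mkcond.
apply: eq_integral => r _; rewrite patchE indicE.
by case: ifPn => _; rewrite ?mulr1 // mulr0 expr0n.
Qed.

Lemma jointly_measurable_cst (f : T -> R) : measurable_fun setT f ->
  jointly_measurable (fun=> f).
Proof. by move=> mf; exact: (measurableT_comp mf measurable_fst). Qed.

Lemma jointly_measurable_time (f : R -> R) : measurable_fun setT f ->
  jointly_measurable (fun r _ => f r).
Proof. by move=> mf; exact: (measurableT_comp mf measurable_snd). Qed.

Lemma jointly_measurable_sq f : jointly_measurable f ->
  measurable_fun setT (fun x : T * R => (f x.2 x.1 ^+ 2)%:E).
Proof. by move=> mf; apply/measurable_EFinP; exact: measurable_funX. Qed.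

Lemma sq_norm_prod f : jointly_measurable f ->
  sq_norm f = (\int[P \x mu]_x (f x.2 x.1 ^+ 2)%:E)%E.
Proof.
move=> mf; rewrite fubini_tonelli1 //; first exact: jointly_measurable_sq.
by move=> x; rewrite lee_fin sqr_ge0.
Qed.

Lemma measurable_sq_norm_section D f : measurable D -> jointly_measurable f ->
  measurable_fun setT (fun w => \int[mu]_(r in D) ((f r w) ^+ 2)%:E)%E.
Proof.
move=> mD mf.
rewrite (_ : (fun w => _) = fun w => \int[mu]_r (((f r w * \1_D r)) ^+ 2)%:E)%E; last first.
  apply/funext => w; rewrite integral_mkcond; apply: eq_integral => r _.
  by rewrite patchE indicE; case: ifPn => _; rewrite ?mulr1 // mulr0 expr0n.
apply: (measurable_fun_fubini_tonelli_F (m2 := mu)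
  (fun x : T * R => (((f x.2 x.1 * \1_D x.2)) ^+ 2)%:E)).
  apply: (@jointly_measurable_sq (fun r w => f r w * \1_D r)).
  by apply: measurable_funM => //; apply: jointly_measurable_time; exact: measurable_indic.
by move=> x; rewrite lee_fin sqr_ge0.
Qed.

Lemma sq_norm_le3 f f1 f2 f3 :
  jointly_measurable f -> jointly_measurable f1 -> jointly_measurable f2 ->
  jointly_measurable f3 ->
  (forall r w, f r w ^+ 2 <= 2 * f1 r w ^+ 2 + 2 * f2 r w ^+ 2 + 2 * f3 r w ^+ 2) ->
  (sq_norm f <= 2%:E * sq_norm f1 + 2%:E * sq_norm f2 + 2%:E * sq_norm f3)%E.
Proof.
move=> mf m1 m2 m3 h; rewrite !sq_norm_prod //.
have mZ g : jointly_measurable g ->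
    measurable_fun setT (fun x : T * R => 2%:E * (g x.2 x.1 ^+ 2)%:E)%E.
  by move=> mg; apply: measurable_funeM; exact: jointly_measurable_sq.
have Z0 (g : R -> T -> R) (x : T * R) : (0 <= 2%:E * (g x.2 x.1 ^+ 2)%:E)%E.
  by rewrite mule_ge0 // lee_fin sqr_ge0.
have S0 (g : R -> T -> R) (x : T * R) : (0 <= (g x.2 x.1 ^+ 2)%:E)%E.
  by rewrite lee_fin sqr_ge0.
rewrite -!ge0_integralZl //; try exact: jointly_measurable_sq.
rewrite -!ge0_integralD //; first last.
- exact: mZ.
- exact: mZ.
- exact: mZ.
- by apply: emeasurable_funD; exact: mZ.
- by move=> x _; exact: adde_ge0.
apply: ge0_le_integral => //.
- exact: jointly_measurable_sq.
- by apply: emeasurable_funD; [apply: emeasurable_funD|]; exact: mZ.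
- by move=> x _; rewrite -!EFinM -!EFinD lee_fin.
Qed.
End ito_approximation.

Section ito_integral.
Context {d : measure_display} {T : measurableType d} {R : realType}.
Variable P : probability T R.
Variables (n : nat) (W : R -> T -> 'cV[R]_n).
Hypothesis W_bm : standard_brownian_motion P W.
Variable k : 'I_n.
Local Notation F := (brownian_filtration P W).
Local Notation dW := (incr W k).
Local Notation mu := (@lebesgue_measure R).
Local Notation step := (step P W).
Local Notation before t := (all (fun x : step => st_b x <= t)).

Lemma steps_of_elementary t phi : elementary_on F t phi ->
  exists l : seq step, [/\ before t l,
    step_process l = elementary_process phi
  & step_integral k l = elementary_integral (fun s w => W s w k 0) phi].
Proof.
case=> t0 tN tinc hv.
have tle i j : (i <= j)%N -> (j <= el_size phi)%N -> el_time phi i <= el_time phi j.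
  elim: j => [|j ih]; first by rewrite leqn0 => /eqP ->.
  rewrite leq_eqVlt => /orP[/eqP ->//|]; rewrite ltnS => ij jN.
  by rewrite (le_trans (ih ij (ltnW jN))) // ltW // tinc.
suff: forall m, (m <= el_size phi)%N -> exists l : seq step, [/\ before t l,
    (forall r w, step_process l r w = \sum_(i < m)
       el_val phi i w * \1_(`[el_time phi i, el_time phi i.+1[%classic) r)
  & (forall w, step_integral k l w = \sum_(i < m)
       el_val phi i w * (W (el_time phi i.+1) w k 0 - W (el_time phi i) w k 0))].
  move=> /(_ _ (leqnn _)) [l [bl pl il]]; exists l; split => //.
    by apply/funext => r; apply/funext => w; exact: pl.
  by apply/funext => w; exact: il.
elim=> [_|m ih mN].
  by exists [::]; split => // *; rewrite /step_process /step_integral big_nil big_ord0.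
have [l [bl pl il]] := ih (ltnW mN).
have [mv bv] := hv m mN.
have ab : 0 <= el_time phi m <= el_time phi m.+1.
  by rewrite -t0 !tle // ltnW.
exists (rcons l (Step ab mv bv)); split.
- by rewrite all_rcons bl andbT /= -tN tle.
- move=> r w; rewrite /step_process -cats1 big_cat big_seq1 big_ord_recr /=.
  by rewrite -pl.
- move=> w; rewrite /step_integral -cats1 big_cat big_seq1 big_ord_recr /=.
  by rewrite -il.
Qed.

Lemma jointly_measurable_steps (l : seq step) : jointly_measurable (step_process l).
Proof.
apply: measurable_sum => x; apply: measurable_funM.
  apply: jointly_measurable_cst.
  exact (filtration_measurable W_bm (@st_meas _ _ _ _ _ _ x)).
by apply: jointly_measurable_time; exact: measurable_indic.
Qed.

Lemma step_process_before t (l : seq step) r w : before t l ->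
  ~~ (0 <= r < t) -> step_process l r w = 0.
Proof.
elim: l => [|x l ih] /=; first by rewrite /step_process big_nil.
move=> /andP[xt lt] rt; rewrite /step_process big_cons [X in _ + X](ih lt rt) addr0.
rewrite indicE; case: (boolP (_ \in _)) => [|_]; last by rewrite mulr0.
rewrite inE /= in_itv /= => /andP[ar rb]; move: rt.
have /andP[a0 _] := st_ab x.
by rewrite (le_trans a0 ar) (lt_le_trans rb xt).
Qed.

(** An epsilon form of the Ito integral in which the approximants are lists of steps. Approximants
    at two different times can thus be subtracted, cut and concatenated freely. *)
Definition ito_approximable (t : R) (H : R -> T -> R) (J : T -> R) : Prop :=
  measurable_fun setT J /\ forall e : R, 0 < e -> exists l : seq step,
   [/\ before t l,
       (sq_norm P (fun r w => ((H r w - step_process l r w) * \1_(`[0%R, t]%classic) r)%R) <= e%:E)%E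
     & (\int[P]_w ((J w - step_integral k l w) ^+ 2)%:E <= e%:E)%E].

Lemma ito_integral_approximable t (H0 H : R -> T -> R) (J : T -> R) (N : set T) :
  measurable N -> P N = 0%E -> jointly_measurable H ->
  (forall w, ~ N w -> forall r, 0 <= r -> H0 r w = H r w) ->
  is_ito_integral P F (fun s w => W s w k 0) H0 t J -> ito_approximable t H J.
Proof.
move=> mN PN mH HH0 [mJ [phi [el_phi cvgH cvgJ]]]; split => // e e0.
have near_le (u : (\bar R)^nat) : u m @[m --> \oo] --> 0%E -> \forall m \near \oo, (u m <= e%:E)%E.
  move=> /fine_cvgP[ufin] /cvgr_le /(_ e e0) ule.
  near=> m; rewrite -(@fineK _ (u m)); last by near: m.
  by rewrite lee_fin; near: m.
have [m [h1 h2]] : exists m,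
   (\int[P]_w \int[mu]_(s in `[0%R, t]) ((H0 s w - elementary_process (phi m) s w) ^+ 2)%:E <= e%:E)%E /\
   (\int[P]_w ((J w - elementary_integral (fun s w => W s w k 0) (phi m) w) ^+ 2)%:E <= e%:E)%E.
  near \oo => m; exists m; split; near: m; exact: near_le.
have [l [bl pl il]] := steps_of_elementary (el_phi m).
exists l; split; [exact: bl| |by rewrite il].
rewrite -(sq_norm_onE P (fun r w => H r w - step_process l r w) (measurable_itv _)).
apply: (le_trans _ h1).
have mHl : jointly_measurable (fun r w => H r w - step_process l r w).
  by apply: jointly_measurableB => //; exact: jointly_measurable_steps.
apply: (le_integral_off_null _ _ _ mN PN).
- by move=> w; apply: integral_ge0 => r _; rewrite lee_fin sqr_ge0.
- by move=> w; apply: integral_ge0 => r _; rewrite lee_fin sqr_ge0.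
- exact: measurable_sq_norm_section.
- move=> w Nw; rewrite le_eqVlt; apply/orP; left; apply/eqP.
  apply: eq_integral => r; rewrite inE /= in_itv /= => /andP[r0 _].
  by rewrite -pl HH0.
Unshelve. all: by end_near. Qed.

Lemma ito_approximable_L2 t H J : ito_approximable t H J -> L2 P J.
Proof.
move=> [mJ /(_ 1 ltr01)[l [_ _ h]]].
have hI := step_integral_L2 W_bm k l.
have hJI : L2 P (fun w => J w - step_integral k l w).
  have mJI : measurable_fun setT (fun w => J w - step_integral k l w).
    by apply: measurable_funB => //; case: hI.
  split => //; apply: int1_ge0 => [|w|]; [exact: measurable_funX|exact: sqr_ge0|].
  by rewrite (le_lt_trans h) // ltry.
rewrite (_ : J = fun w => (J w - step_integral k l w) + step_integral k l w).
  exact: L2D.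
by apply/funext => w; rewrite subrK.
Qed.

Lemma Ex_le_ereal (f : T -> R) (e : R) : int1 P f ->
  (\int[P]_w (f w)%:E <= e%:E)%E -> Ex P f <= e.
Proof. by move=> hf; rewrite Ex_fin // lee_fin. Qed.

Lemma step_process_cat l1 l2 r w :
  step_process (l1 ++ l2 : seq step) r w = step_process l1 r w + step_process l2 r w.
Proof. by rewrite /step_process big_cat. Qed.

Lemma step_integral_cat l1 l2 w : step_integral k (l1 ++ l2 : seq step) w =
  step_integral k l1 w + step_integral k l2 w.
Proof. by rewrite /step_integral big_cat. Qed.

Lemma step_process_cons x (l : seq step) r w : step_process (x :: l) r w =
  st_v x w * \1_(`[st_a x, st_b x[%classic) r + step_process l r w.
Proof. by rewrite /step_process big_cons. Qed.

Lemma step_integral_cons x (l : seq step) w : step_integral k (x :: l) w =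
  st_v x w * dW (st_a x) (st_b x) w + step_integral k l w.
Proof. by rewrite /step_integral big_cons. Qed.

Lemma steps_opp (l : seq step) : exists l' : seq step,
  (forall r w, step_process l' r w = - step_process l r w) /\
  (forall w, step_integral k l' w = - step_integral k l w).
Proof.
elim: l => [|x l [l' [pl il]]].
  by exists [::]; split => *; rewrite /step_process /step_integral !big_nil oppr0.
have mN : measurable_wrt (F (st_a x)) (fun w => - st_v x w).
  move/measurable_wrtE: (@st_meas _ _ _ _ _ _ x) => h; apply/measurable_wrtE.
  exact: measurableT_comp.
have bN : exists c, forall w, `|- st_v x w| <= c.
  by have [c hc] := st_bdd x; exists c => w; rewrite normrN.
exists (Step (st_ab x) mN bN :: l'); split => [r w|w].
  by rewrite !step_process_cons /= pl opprD mulNr.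
by rewrite !step_integral_cons /= il opprD mulNr.
Qed.

Let I3 (a b c : R) : (a - b + c) ^+ 2 <= 3 * (a ^+ 2 + b ^+ 2 + c ^+ 2).
Proof. by have := sqr_ge0 (a + b); have := sqr_ge0 (a - c); have := sqr_ge0 (b + c); nra. Qed.

Let Ex_sq3 (f g h : T -> R) (x y z : R) : L2 P f -> L2 P g -> L2 P h ->
  Ex P (fun w => f w ^+ 2) <= x -> Ex P (fun w => g w ^+ 2) <= y ->
  Ex P (fun w => h w ^+ 2) <= z ->
  Ex P (fun w => (f w - g w + h w) ^+ 2) <= 3 * (x + y + z).
Proof.
move=> hf hg hh ex ey ez.
apply: (@le_trans _ _ (3 * (Ex P (fun w => f w ^+ 2) + Ex P (fun w => g w ^+ 2) +
   Ex P (fun w => h w ^+ 2)))); last by rewrite ler_wpM2l // !lerD.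
have i1 := hf.2; have i2 := hg.2; have i3 := hh.2.
rewrite -(ExD i1 i2) -(ExD (int1D i1 i2) i3) -ExZ; last exact: int1D (int1D i1 i2) i3.
apply: Ex_le; first exact: (L2D (L2B hf hg) hh).2.
  by apply: int1Z; exact: int1D (int1D i1 i2) i3.
by move=> w; exact: I3.
Qed.

Let approx_diff t H J (l : seq step) e : ito_approximable t H J ->
  (\int[P]_w ((J w - step_integral k l w) ^+ 2)%:E <= e%:E)%E ->
  L2 P (fun w => J w - step_integral k l w) /\
  Ex P (fun w => (J w - step_integral k l w) ^+ 2) <= e.
Proof.
move=> hJ h; have hL : L2 P (fun w => J w - step_integral k l w).
  by apply: L2B; [exact: ito_approximable_L2 hJ|exact: step_integral_L2].
by split => //; apply: Ex_le_ereal h; exact: hL.2.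
Qed.

Lemma Ex_step_integral_le (l : seq step) f1 f2 f3 x y z :
  jointly_measurable f1 -> jointly_measurable f2 -> jointly_measurable f3 ->
  (forall r w, step_process l r w ^+ 2 <=
     2 * f1 r w ^+ 2 + 2 * f2 r w ^+ 2 + 2 * f3 r w ^+ 2) ->
  (sq_norm P f1 <= x%:E)%E -> (sq_norm P f2 <= y%:E)%E -> (sq_norm P f3 <= z%:E)%E ->
  Ex P (fun w => step_integral k l w ^+ 2) <= 2 * (x + y + z).
Proof.
move=> m1 m2 m3 h h1 h2 h3; rewrite -lee_fin -(step_process_isometry W_bm).
apply: (le_trans (sq_norm_le3 P (jointly_measurable_steps l) m1 m2 m3 h)).
rewrite !mulrDr !EFinD !EFinM; apply: leeD; first apply: leeD;
  by apply: lee_wpmul2l => //; rewrite lee_fin.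
Qed.

Let jm_indic f (D : set R) : measurable D -> jointly_measurable f ->
  jointly_measurable (fun r (w : T) => f r w * \1_D r).
Proof.
move=> mD mf; apply: measurable_funM => //; apply: jointly_measurable_time.
exact: measurable_indic.
Qed.

Section ito_increment.
Variables (s t : R) (H : R -> T -> R) (Js Jt : T -> R).
Hypotheses (s0 : 0 <= s) (st : s <= t) (mH : jointly_measurable H).
Hypotheses (hs : ito_approximable s H Js) (ht : ito_approximable t H Jt).

(** The list [th] represents the approximant at time t, minus the one at time s, minus [eta] on [s,
    t[. Its process is close to 0 before s and to H - eta afterwards, so the isometry bounds its
    integral by [K] up to the approximation errors. *)
Lemma ito_increment_sq eta K : measurable_wrt (F s) eta ->
  (exists c, forall w, `|eta w| <= c) ->
  (sq_norm P (fun r w => ((H r w - eta w) * \1_(`[s, t]%classic) r)%R) <= K%:E)%E ->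
  Ex P (fun w => (Jt w - Js w - eta w * dW s t w) ^+ 2) <= 6 * K.
Proof.
move=> meta beta hK; apply/ler_addgt0Pr => e0 e0_gt0.
(* The final bound is 3 (e + e + 2 (e + e + K)) = 18 e + 6 K. *)
pose e := e0 / 18; have e_gt0 : 0 < e by rewrite divr_gt0.
have [l1 [b1 p1 i1]] := ht.2 e e_gt0.
have [l2 [b2 p2 i2]] := hs.2 e e_gt0.
have [l2' [p2' i2']] := steps_opp l2.
have sst : 0 <= s <= t by rewrite s0.
have [l3' [p3' i3']] := steps_opp [:: Step sst meta beta].
have [L1 E1] := approx_diff ht i1; have [L2' E2] := approx_diff hs i2.
pose th := l1 ++ (l2' ++ l3').
have ithE w : step_integral k th w = step_integral k l1 w - step_integral k l2 w - eta w * dW s t w.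
  rewrite !step_integral_cat i2' i3' {3}/step_integral big_seq1 /=; ring.
have meta' := filtration_measurable W_bm meta.
have Eth : Ex P (fun w => step_integral k th w ^+ 2) <= 2 * (e + e + K).
  apply: (Ex_step_integral_le _ _ _ _ p1 p2 hK).
  - by apply: jm_indic => //; apply: jointly_measurableB => //; exact: jointly_measurable_steps.
  - by apply: jm_indic => //; apply: jointly_measurableB => //; exact: jointly_measurable_steps.
  - by apply: jm_indic => //; apply: jointly_measurableB => //; exact: jointly_measurable_cst.
  move=> r w; rewrite !step_process_cat p2' p3' {3}/step_process big_seq1 /=.
  rewrite !indicE !mem_setE !in_itv /=.
  set h := H r w; set q1 := step_process l1 r w; set q2 := step_process l2 r w.
  (* Three ranges of time: off [0, t[ all processes vanish; before s two approximants of the same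
     [H] are subtracted; from s on the approximant [l2] has stopped and [eta] is active. *)
  have [r0|r0] := boolP (0 <= r < t); last first.
    have -> : q1 = 0 by exact: (step_process_before _ b1 r0).
    have -> : q2 = 0.
      apply: (step_process_before _ b2); apply: contra r0 => /andP[-> rs].
      exact: lt_le_trans st.
    have -> : (s <= r < t) = false.
      apply: contraNF r0 => /andP[sr ->]; rewrite andbT; exact: le_trans sr.
    rewrite mulr0 !oppr0 !addr0 expr0n /=.
    by rewrite !addr_ge0 // mulr_ge0 // sqr_ge0.
  have /andP[r_ge0 rt] := r0.
  rewrite r_ge0 rt (ltW rt) /= !mulr1.
  have [rs|sr] := ltP r s.
    rewrite (ltW rs) /= !mulr0 mulr1 oppr0 addr0.
    by have := sqr_ge0 ((h - q1) + (h - q2)); nra.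
  have -> : q2 = 0 by apply: (step_process_before _ b2); rewrite r_ge0 ltNge sr.
  rewrite /= !mulr1 oppr0 add0r.
  set z := (h + 0) * _.
  by have := sqr_ge0 ((h - q1) + (h - eta w)); have := sqr_ge0 z; nra.
rewrite (_ : (fun w => _) = fun w => ((Jt w - step_integral k l1 w) -
    (Js w - step_integral k l2 w) + step_integral k th w) ^+ 2); last first.
  by apply/funext => w; rewrite ithE; congr (_ ^+ 2); ring.
apply: (le_trans (Ex_sq3 L1 L2' (step_integral_L2 W_bm k th) E1 E2 Eth)).
by rewrite /e; lra.
Qed.

(** Each step that straddles s is cut there; its value is measurable at its start, hence also at
    s. *)
Let split_steps (l : seq step) : exists la lb : seq step,
  [/\ forall r w, step_process la r w = step_process l r w * \1_(`]-oo, s[%classic) r,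
      forall w, step_integral k l w = step_integral k la w + step_integral k lb w
    & all (fun x : step => s <= st_a x) lb].
Proof.
elim: l => [|x l [la [lb [pa ia hb]]]].
  by exists [::], [::]; split => // *; rewrite /step_process /step_integral !big_nil ?mul0r ?addr0.
have /andP[a0 ab] := st_ab x.
have [bs|sb] := leP (st_b x) s.
  exists (x :: la), lb; split => // [r w|w].
    rewrite !step_process_cons pa mulrDl.
    congr (_ + _); rewrite -mulrA; congr (_ * _); rewrite !indicE !mem_setE !in_itv /=.
    case: (leP (st_a x) r) => //= _; last by rewrite mul0r.
    case: (ltP r (st_b x)) => rb; last by rewrite mul0r.
    by rewrite (lt_le_trans rb bs) mulr1.
  by rewrite !step_integral_cons ia addrA.
have [sa|as_] := leP s (st_a x).
  exists la, (x :: lb); split; [move=> r w|move=> w|by rewrite /= sa].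
    rewrite pa !step_process_cons mulrDl.
    rewrite [X in _ = X + _](_ : _ = 0) ?add0r // -mulrA !indicE !mem_setE !in_itv /=.
    case: (leP (st_a x) r) => /= ar; last by rewrite mul0r mulr0.
    by rewrite (ltNge r s) (le_trans sa ar) /= !mulr0.
  by rewrite !step_integral_cons ia addrCA.
have ab1 : 0 <= st_a x <= s by rewrite a0 ltW.
have ab2 : 0 <= s <= st_b x by rewrite s0 ltW.
have mv2 : measurable_wrt (F s) (st_v x).
  by apply: measurable_wrt_sub (@st_meas _ _ _ _ _ _ x); exact: (filtration_mono (ltW as_)).
exists (Step ab1 (@st_meas _ _ _ _ _ _ x) (st_bdd x) :: la), (Step ab2 mv2 (st_bdd x) :: lb).
split; [move=> r w|move=> w|by rewrite /= lexx].
  rewrite !step_process_cons pa mulrDl /=.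
  congr (_ + _); rewrite -mulrA; congr (_ * _); rewrite !indicE !mem_setE !in_itv /=.
  case: (leP (st_a x) r) => //= _; last by rewrite mul0r.
  by case: (ltP r s) => rs; rewrite ?mulr0 // (lt_trans rs sb) mulr1.
rewrite !step_integral_cons /= ia /incr; ring.
Qed.

Let Ex_step_integral_after (xi : T -> R) c (lb : seq step) :
  measurable_wrt (F s) xi -> (forall w, `|xi w| <= c) ->
  all (fun x : step => s <= st_a x) lb ->
  Ex P (fun w => xi w * step_integral k lb w) = 0.
Proof.
move=> mxi bxi; have mxi' := filtration_measurable W_bm mxi.
elim: lb => [|x lb ih] /=.
  rewrite (_ : (fun w => _) = fun=> 0); first by rewrite Ex_cst.
  by apply/funext => w; rewrite /step_integral big_nil mulr0.
move=> /andP[sa /ih e]; have /andP[a0 ab] := st_ab x.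
rewrite (_ : (fun w => _) = fun w => (xi w * st_v x w) * dW (st_a x) (st_b x) w +
    xi w * step_integral k lb w); last first.
  by apply/funext => w; rewrite /step_integral big_cons mulrDr mulrA.
have [c2 hc2] := st_bdd x.
have mxv : measurable_wrt (F (st_a x)) (fun w => xi w * st_v x w).
  apply: measurable_wrtM; last exact: st_meas.
  by apply: measurable_wrt_sub mxi; exact: filtration_mono.
have ixv : int1 P (fun w => xi w * st_v x w).
  apply: (@int1_bdd _ _ _ _ _ (c * c2)); first exact (filtration_measurable W_bm mxv).
  by move=> w; rewrite normrM ler_pM.
have [i1 e1] := Ex_filtration_dW W_bm k a0 ab mxv ixv.
rewrite ExD ?e1 ?e ?addr0 //.
by apply: L2_int1; apply: (L2M_bdd mxi' bxi); exact: step_integral_L2.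
Qed.

(** The part of the approximant of [Jt] after s is orthogonal to [xi]. Its part before s
    approximates the same integrand as the approximant of [Js], so by the isometry their difference
    is small in mean square. *)
Lemma ito_increment_Ex xi c : measurable_wrt (F s) xi -> (forall w, `|xi w| <= c) ->
  Ex P (fun w => xi w * (Jt w - Js w)) = 0.
Proof.
move=> mxi bxi; have mxi' := filtration_measurable W_bm mxi.
apply/eqP; rewrite -normr_le0; apply/ler_addgt0Pr => e0 e0_gt0; rewrite add0r.
(* With weight u, error e = u^2 and second moment at most 18 e, the bound u c^2 + 18 e / u equals u
   D, which is e0. *)
pose D : R := c ^+ 2 + 18.
have D_gt0 : 0 < D by rewrite /D; have := sqr_ge0 c; lra.
pose u := e0 / D; have u_gt0 : 0 < u by rewrite divr_gt0.
pose e := u ^+ 2; have e_gt0 : 0 < e by rewrite exprn_gt0.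
have [l1 [b1 p1 i1]] := ht.2 e e_gt0.
have [l2 [b2 p2 i2]] := hs.2 e e_gt0.
have [l2' [p2' i2']] := steps_opp l2.
have [la [lb [pa iab hb]]] := split_steps l1.
have [L1 E1] := approx_diff ht i1; have [L2' E2] := approx_diff hs i2.
pose th := la ++ l2'.
have Eth : Ex P (fun w => step_integral k th w ^+ 2) <= 2 * (e + e + 0).
  apply: (@Ex_step_integral_le _ _ _ (fun _ _ => 0) _ _ _ _ _ _ _ p1 p2).
  - by apply: jm_indic => //; apply: jointly_measurableB => //; exact: jointly_measurable_steps.
  - by apply: jm_indic => //; apply: jointly_measurableB => //; exact: jointly_measurable_steps.
  - exact: measurable_cst.
  - move=> r w; rewrite step_process_cat p2' pa !indicE !mem_setE !in_itv /=.
    set h := H r w; set q1 := step_process l1 r w; set q2 := step_process l2 r w.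
    have [r0|r0] := boolP (0 <= r < s); last first.
      have -> : q2 = 0 by exact: (step_process_before _ b2 r0).
      have -> : q1 * (r < s)%R%:R = 0.
        have [r_ge0|r_lt0] := leP 0 r.
          by move: r0; rewrite r_ge0 /= => /negbTE ->; rewrite mulr0.
        rewrite /q1 (step_process_before _ b1) ?mul0r //.
        by rewrite leNgt r_lt0.
      rewrite oppr0 addr0 !expr0n /= mulr0 addr0.
      by rewrite !addr_ge0 // mulr_ge0 // sqr_ge0.
    have /andP[r_ge0 rs] := r0.
    rewrite r_ge0 rs (ltW rs) (ltW (lt_le_trans rs st)) /= !mulr1 expr0n mulr0 addr0.
    by have := sqr_ge0 ((h - q1) + (h - q2)); nra.
  - rewrite /sq_norm integral0_eq // => w _; rewrite integral0_eq // => r _.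
    by rewrite expr0n.
pose q w := (Jt w - step_integral k l1 w) - (Js w - step_integral k l2 w) + step_integral k th w.
have Lq : L2 P q by apply: L2D; [exact: L2B|exact: step_integral_L2].
have Eq : Ex P (fun w => q w ^+ 2) <= 18 * e.
  by apply: (le_trans (Ex_sq3 L1 L2' (step_integral_L2 W_bm k th) E1 E2 Eth)); lra.
rewrite (_ : (fun w => _) = fun w => xi w * q w + xi w * step_integral k lb w); last first.
  apply/funext => w; rewrite /q step_integral_cat i2' iab; ring.
have Lxi : L2 P xi := L2_bdd P mxi' bxi.
rewrite ExD; first last.
- by apply: L2_mul => //; exact: step_integral_L2.
- exact: L2_mul.
rewrite (Ex_step_integral_after mxi bxi hb) addr0.
apply: (le_trans (Ex_abs (L2_mul Lxi Lq))); apply: (le_trans (Ex_mul_le u_gt0 Lxi Lq)).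
have Exi : Ex P (fun w => xi w ^+ 2) <= c ^+ 2.
  rewrite -[leRHS](Ex_cst P); apply: Ex_le; [exact: Lxi.2|exact: int1_cst|].
  move=> w; rewrite -(real_normK (num_real (xi w))) ler_pXn2r // ?nnegrE //.
  exact: le_trans (bxi w).
apply: (@le_trans _ _ (u * c ^+ 2 + u^-1 * (18 * e))).
  by apply: lerD; rewrite ler_wpM2l // ltW // invr_gt0.
rewrite /e (_ : _ + _ = u * D); last by rewrite /D; field; rewrite gt_eqF.
by rewrite /u divfK // gt_eqF.
Qed.

End ito_increment.

End ito_integral.

(** * Functions on the simplex and regular versions of the solution *)

Section simplex_functions.
Context {R : realType} {n : nat}.
Implicit Types (f g : 'cV[R]_n -> R) (x y : 'cV[R]_n).

Definition dist1 x y : R := \sum_i `|x i 0 - y i 0|.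

Definition lipschitz_bound (K : R) f : Prop :=
  [/\ 0 <= K, forall x, in_simplex x -> `|f x| <= K
    & forall x y, in_simplex x -> in_simplex y -> `|f x - f y| <= K * dist1 x y].

(** Quantifying over all measurable spaces lets one statement serve for events, for pairs of event
    and time, and for the sigma-algebras of the filtration. *)
Definition simplex_measurable f : Prop :=
  forall d (S : measurableType d) (Z : S -> 'cV[R]_n),
  (forall w, in_simplex (Z w)) -> (forall i, measurable_fun setT (fun w => Z w i 0)) ->
  measurable_fun setT (fun w => f (Z w)).

(** A class stable under sums and products that contains the coordinates, hence all coefficients of
    the equation. *)
Definition nice f : Prop := (exists K, lipschitz_bound K f) /\ simplex_measurable f.

Lemma dist1_ge0 x y : 0 <= dist1 x y.
Proof. by apply: sumr_ge0. Qed.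

Lemma in_simplex_le1 x i : in_simplex x -> `|x i 0| <= 1.
Proof. by move=> [/(_ i) /andP[x0 x1] _]; rewrite ger0_norm. Qed.

Lemma nice_cst c : nice (fun=> c).
Proof.
split; last by move=> *; exact: measurable_cst.
exists `|c|; split => // x y _ _; first by rewrite subrr normr0 mulr_ge0 ?dist1_ge0.
Qed.

Lemma nice_coord i : nice (fun x => x i 0).
Proof.
split; last by move=> d S Z _; exact.
exists 1; split => // [x|x y _ _]; first exact: in_simplex_le1.
by rewrite mul1r /dist1 (bigD1 i) //= lerDl sumr_ge0.
Qed.

Lemma niceD f g : nice f -> nice g -> nice (fun x => f x + g x).
Proof.
move=> [[K [K0 fK fL]] mf] [[L [L0 gK gL]] mg]; split; last first.
  by move=> d S Z sZ mZ; apply: measurable_funD; [exact: mf|exact: mg].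
exists (K + L); split; first exact: addr_ge0.
  by move=> x sx; rewrite (le_trans (ler_normD _ _)) // lerD ?fK ?gK.
move=> x y sx sy; rewrite opprD addrACA mulrDl (le_trans (ler_normD _ _)) //.
by rewrite lerD ?fL ?gL.
Qed.

Lemma niceM f g : nice f -> nice g -> nice (fun x => f x * g x).
Proof.
move=> [[K [K0 fK fL]] mf] [[L [L0 gK gL]] mg]; split; last first.
  by move=> d S Z sZ mZ; apply: measurable_funM; [exact: mf|exact: mg].
have KL0 : 0 <= K * L by exact: mulr_ge0.
exists (K * L + K * L); split; first exact: addr_ge0.
  move=> x sx; rewrite normrM (@le_trans _ _ (K * L)) ?lerDl //.
  by rewrite ler_pM ?fK ?gK.
move=> x y sx sy.
rewrite (_ : _ - _ = (f x - f y) * g x + f y * (g x - g y)); last by ring.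
rewrite (le_trans (ler_normD _ _)) // !normrM mulrDl lerD //.
  by rewrite mulrAC ler_pM ?fL ?gK.
by rewrite -mulrA ler_pM ?fK ?gL.
Qed.

Lemma niceN f : nice f -> nice (fun x => - f x).
Proof.
move=> /(niceM (nice_cst (-1))).
by rewrite (_ : (fun x => -1 * f x) = (fun x => - f x)) //; apply/funext => x; rewrite mulN1r.
Qed.

Lemma niceB f g : nice f -> nice g -> nice (fun x => f x - g x).
Proof. by move=> hf hg; apply: niceD => //; exact: niceN. Qed.

Lemma nice_sum (I : Type) (r : seq I) (p : pred I) (f : I -> 'cV[R]_n -> R) :
  (forall i, nice (f i)) -> nice (fun x => \sum_(i <- r | p i) f i x).
Proof.
move=> hf; elim: r => [|i r ih].
  rewrite (_ : (fun x => _) = fun=> 0); first exact: nice_cst.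
  by apply/funext => w; rewrite big_nil.
rewrite (_ : (fun x => _) = fun x => (if p i then f i x else 0) + \sum_(i <- r | p i) f i x).
  apply: niceD => //; case: (p i); [exact: hf|exact: nice_cst].
by apply/funext => x; rewrite big_cons; case: (p i); rewrite ?add0r.
Qed.

Lemma nice_mulmx a b c (M : 'cV[R]_n -> 'M[R]_(a, b)) (N : 'cV[R]_n -> 'M[R]_(b, c)) i j :
  (forall i j, nice (fun x => M x i j)) -> (forall i j, nice (fun x => N x i j)) ->
  nice (fun x => (M x *m N x) i j).
Proof.
move=> hM hN; rewrite (_ : (fun x => _) = fun x => \sum_k M x i k * N x k j).
  by apply: nice_sum => k; exact: niceM.
by apply/funext => x; rewrite mxE.
Qed.

Lemma nice_inv i (dl : R) : 0 < dl -> nice (fun x => (x i 0 + dl)^-1).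
Proof.
move=> dl0; split; last first.
  move=> d S Z sZ mZ.
  rewrite (_ : (fun w => _) = fun w => expR (- ln (Z w i 0 + dl))); last first.
    apply/funext => w; have /andP[z0 _] := (sZ w).1 i.
    by rewrite expRN lnK // posrE ltr_wpDl.
  apply: measurableT_comp; first exact: measurable_expR.
  apply: measurableT_comp; first exact: oppr_measurable.
  apply: measurableT_comp; first exact: measurable_ln.
  by apply: measurable_funD.
have pos x : in_simplex x -> dl <= x i 0 + dl.
  by move=> [/(_ i) /andP[x0 _] _]; rewrite lerDr.
have inv_le x : in_simplex x -> 0 <= (x i 0 + dl)^-1 <= dl^-1.
  move=> /pos h; rewrite invr_ge0 (le_trans (ltW dl0) h) /=.
  by rewrite lef_pV2 // posrE // (lt_le_trans dl0).
exists (dl^-1 + dl^-1 ^+ 2).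
have i0 : 0 <= dl^-1 by rewrite invr_ge0 ltW.
split; first by rewrite addr_ge0 // sqr_ge0.
  move=> x /inv_le /andP[h0 h1]; rewrite ger0_norm //.
  by rewrite (le_trans h1) // lerDl sqr_ge0.
move=> x y sx sy.
have /andP[a0 a1] := inv_le x sx; have /andP[b0 b1] := inv_le y sy.
have nx : x i 0 + dl != 0 by rewrite gt_eqF // (lt_le_trans dl0) // pos.
have ny : y i 0 + dl != 0 by rewrite gt_eqF // (lt_le_trans dl0) // pos.
rewrite (_ : _ - _ = (x i 0 + dl)^-1 * (y i 0 + dl)^-1 * (y i 0 - x i 0)); last first.
  by field; rewrite nx ny.
have dxy : `|y i 0 - x i 0| <= dist1 x y.
  by rewrite distrC /dist1 (bigD1 i) //= lerDl sumr_ge0.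
rewrite !normrM (ger0_norm a0) (ger0_norm b0) ler_pM ?mulr_ge0 //.
rewrite -[leLHS]add0r lerD // expr2 ler_pM //.
Qed.

Lemma nice_ln_measurable i (dl : R) : simplex_measurable (fun x => ln (x i 0 + dl)).
Proof.
move=> d S Z sZ mZ; apply: measurableT_comp; first exact: measurable_ln.
exact: measurable_funD.
Qed.

Lemma nice_replicator_op i j : nice (fun x => replicator_op x i j).
Proof.
rewrite /replicator_op.
rewrite (_ : (fun x => _) = fun x => x j 0 *+ (i == j) - x i 0 * x j 0); last first.
  by apply/funext => x; rewrite !mxE big_ord1 !mxE; case: eqP => [->|].
apply: niceB; last by apply: niceM; exact: nice_coord.
by case: (i == j); [exact: nice_coord|exact: nice_cst].
Qed.

Lemma nice_drift A sigma i : nice (fun x => replicator_drift A sigma x i 0).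
Proof.
apply: nice_mulmx => [j k|j k]; last by rewrite ord1; exact: nice_coord.
apply: nice_mulmx => [j' k'|j' k']; [exact: nice_replicator_op|exact: nice_cst].
Qed.

Lemma nice_diffusion sigma i j : nice (fun x => replicator_diffusion sigma x i j).
Proof.
by apply: nice_mulmx => [j' k'|j' k']; [exact: nice_replicator_op|exact: nice_cst].
Qed.

End simplex_functions.

Section continuous_processes.
Context {d : measure_display} {T : measurableType d} {R : realType}.

(** Time is rounded down to a multiple of 1 / (m + 1). The preimages under the rounded process are
    countable unions of rectangles, and continuity gives pointwise convergence. *)
Lemma jointly_measurable_continuous (f : R -> T -> R) :
  (forall w, continuous (fun t => f t w)) -> (forall t, measurable_fun setT (f t)) ->
  jointly_measurable f.
Proof.
move=> cf mf.
pose h m (x : T * R) := f ((Num.floor (x.2 * m.+1%:R))%:~R / m.+1%:R) x.1.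
apply: (measurable_fun_cvg (h := h)) => //.
  move=> m _ B mB; rewrite setTI.
  have m0 : 0 < m.+1%:R :> R by rewrite ltr0n.
  rewrite (_ : _ @^-1` B = \bigcup_(z : int)
     ((f (z%:~R / m.+1%:R) @^-1` B) `*`
      `[z%:~R / m.+1%:R, (z + 1)%:~R / m.+1%:R[%classic)); last first.
    have fl (r : R) (z : int) : (z%:~R / m.+1%:R <= r < (z + 1)%:~R / m.+1%:R) <->
        Num.floor (r * m.+1%:R) = z.
      rewrite ler_pdivrMr // ltr_pdivlMr //; split; first by move/floor_def.
      by move=> <-; rewrite floor_itv.
    apply/seteqP; split => [[w r] hB|[w r] [z _ [/= hB]]].
      exists (Num.floor (r * m.+1%:R)) => //; split => //=.
      by rewrite in_itv /=; apply/fl.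
    by rewrite in_itv /= => /fl hz; rewrite /h /= hz.
  apply: countable_bigcupT_measurable; first exact: countableP.
  move=> z; apply: measurableX; last exact: measurable_itv.
  by rewrite -[_ @^-1` _]setTI; exact: mf.
move=> [w r] _; rewrite /h /=.
apply: (cvg_comp _ (fun t => f t w) _ (cf w r)).
have hup : r - harmonic m @[m --> \oo] --> r.
  by rewrite -[X in _ --> X]subr0; apply: cvgB; [exact: cvg_cst|exact: cvg_harmonic].
apply: (squeeze_cvgr _ hup (cvg_cst r)); near=> m.
have m0 : 0 < m.+1%:R :> R by rewrite ltr0n.
have := floor_itv (r * m.+1%:R) => /andP[h1 h2].
rewrite ler_pdivrMr // h1 andbT ler_pdivlMr // mulrBl /harmonic /= mulVf ?gt_eqF //.
by move: h2; rewrite intrD => /ltW; rewrite lerBlDr.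
Unshelve. all: by end_near. Qed.

End continuous_processes.

(** * Removal of the exceptional null events *)

Section regular_version.
Context {d : measure_display} {T : measurableType d} {R : realType}.
Variable P : probability T R.
Variables (n : nat) (A : 'M[R]_n) (sigma : 'I_n -> R) (x0 : 'cV[R]_n).
Variable W : R -> T -> 'cV[R]_n.
Local Notation F := (brownian_filtration P W).
Local Notation mu := (@lebesgue_measure R).

(* A solution for which no exceptional null set is left in the path properties,
   extended to negative times by its initial value. *)
Record regular_solution (Y : R -> T -> 'cV[R]_n) : Prop := {
  rs_simplex : forall t w, in_simplex (Y t w);
  rs_continuous : forall w i, continuous (fun t => Y t w i 0);
  rs_adapted : forall t i, 0 <= t -> measurable_wrt (F t) (fun w => Y t w i 0);
  rs_measurable : forall t i, measurable_fun setT (fun w => Y t w i 0);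
  rs_init : forall w, Y 0 w = x0;
  rs_sde : forall t, 0 <= t -> exists2 J : 'I_n -> 'I_n -> T -> R,
    forall i j, ito_approximable P W j t
      (fun s w => replicator_diffusion sigma (Y s w) i j) (J i j)
  & {ae P, forall w, forall i, Y t w i 0 = x0 i 0
      + \int[mu]_(s in `[0%R, t]) replicator_drift A sigma (Y s w) i 0
      + \sum_j J i j w} }.

Hypothesis W_bm : standard_brownian_motion P W.

(** Bounds and measurability are wanted for every sample point, so the paths are replaced on one
    null event; the equation itself remains almost sure, like the stochastic integrals in it. *)
Lemma regular_version (X : R -> T -> 'cV[R]_n) : in_simplex x0 ->
  stochastic_replicator P A sigma x0 W X ->
  exists Y, regular_solution Y /\
    {ae P, forall w, forall t, 0 <= t -> Y t w = X t w}.
Proof.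
move=> x0s [adX cX sX iX sdeX].
have [N1 [mN1 PN1 h1]] := ae_null_set cX.
have [N2 [mN2 PN2 h2]] := ae_null_set sX.
have [N3 [mN3 PN3 h3]] := ae_null_set iX.
pose N := N1 `|` N2 `|` N3.
have mN : measurable N by apply: measurableU => //; exact: measurableU.
have PN : P N = 0%E by rewrite !measureU0 //; exact: measurableU.
have outN w : ~ N w -> [/\ ~ N1 w, ~ N2 w & ~ N3 w].
  by move=> h; split => h'; apply: h; [left; left|left; right|right].
(* The modification stays adapted because the augmented filtration contains the null event [N] at
   every time. Reflecting nothing and freezing negative times at 0 keeps the paths continuous on the
   whole line. *)
pose Y t w := if w \in N then x0 else X (Num.max t 0) w.
have YE w t : ~ N w -> 0 <= t -> Y t w = X t w.
  by move=> Nw t0; rewrite /Y memNset // max_l.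
have YN t w : N w -> Y t w = x0 by move=> Nw; rewrite /Y mem_set.
have FN t : F t N by apply: sub_gen_smallest; right.
have adY t i : 0 <= t -> measurable_wrt (F t) (fun w => Y t w i 0).
  move=> t0 B mB.
  rewrite (_ : _ @^-1` B = ((fun w => X t w i 0) @^-1` B `\` N) `|`
     (if x0 i 0 \in B then N else set0)); last first.
    apply/seteqP; split => w /=.
      have [Nw|Nw] := pselect (N w).
        by rewrite YN // => Bx; right; rewrite mem_set.
      by rewrite YE // => Bx; left.
    case=> [[hB Nw]|]; first by rewrite YE.
    by case: ifPn => // /set_mem Bx Nw; rewrite YN.
  apply: (@measurableU _ (g_sigma_algebraType _)).
    by apply: (@measurableD _ (g_sigma_algebraType _)); [exact: adX|exact: FN].
  by case: ifP => _; [exact: FN|exact: (@measurable0 _ (g_sigma_algebraType _))].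
have Yneg t w : t <= 0 -> Y t w = Y 0 w.
  by move=> t0; rewrite /Y maxxx (max_r t0).
have mY t i : measurable_fun setT (fun w => Y t w i 0).
  have [t0|t0] := leP 0 t; first exact (filtration_measurable W_bm (adY t i t0)).
  rewrite (_ : (fun w => _) = fun w => Y 0 w i 0).
    exact (filtration_measurable W_bm (adY 0 i (lexx _))).
  by apply/funext => w; rewrite (Yneg _ _ (ltW t0)).
have cY w i : continuous (fun t => Y t w i 0).
  have [Nw|Nw] := pselect (N w).
    rewrite (_ : (fun t => _) = fun=> x0 i 0); first by move=> t; exact: cvg_cst.
    by apply/funext => t; rewrite YN.
  have [Nw1 _ _] := outN w Nw.
  have := h1 w Nw1 i => /subspace_continuousP hc t.
  have m0 (u : R) : [set` `[0, +oo[] (Num.max u 0) by rewrite /= in_itv /= andbT le_max lexx orbT.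
  have -> : (fun t => Y t w i 0) = (fun t => X t w i 0) \o (fun u => Num.max u 0).
    by apply/funext => u; rewrite /Y memNset.
  apply: cvg_comp; last exact: hc (m0 t).
  move=> U hU.
  have cmax : {for t, continuous ((fun u : R => u) \max (fun=> 0 : R))}.
    by apply: continuous_max; [exact: cvg_id|exact: cvg_cst].
  have h : nbhs t [set u | [set` `[0, +oo[] (Num.max u 0) -> U (Num.max u 0)] := cmax _ hU.
  by apply: (@filterS _ (nbhs t) _ _ _ _ h) => u; apply; exact: m0.
exists Y; split; last first.
  exists N; split => // w /= hw; apply: contrapT => Nw; apply: hw => t t0.
  exact: YE.
split => //.
- move=> t w; have [Nw|Nw] := pselect (N w); first by rewrite YN.
  by rewrite /Y memNset //; have [_ Nw2 _] := outN w Nw; apply: h2 => //; rewrite le_max lexx orbT.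
- move=> w; have [Nw|Nw] := pselect (N w); first by rewrite YN.
  by rewrite YE //; have [_ _ Nw3] := outN w Nw; exact: h3.
move=> t t0; have [J hJ eJ] := sdeX t t0; exists J.
  move=> i j; apply: (ito_integral_approximable W_bm mN PN _ _ (hJ i j)).
    have [_ mdiff] := nice_diffusion sigma i j.
    apply: (mdiff _ _ (fun x : T * R => Y x.2 x.1)).
      move=> [w r] /=.
      have [Nw|Nw] := pselect (N w); first by rewrite YN.
      by rewrite /Y memNset //; have [_ Nw2 _] := outN w Nw; apply: h2 => //; rewrite le_max lexx orbT.
    move=> k; apply: (@jointly_measurable_continuous _ _ _ (fun r w => Y r w k 0)).
      by move=> w; exact: cY.
    by move=> r; exact: mY.
  by move=> w Nw r r0; rewrite YE.
have [N' [mN' PN' hN']] := ae_null_set eJ.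
exists (N `|` N'); split; [exact: measurableU|by rewrite measureU0|].
move=> w /= hw; apply: contrapT => /not_orP[Nw Nw']; apply: hw => i.
rewrite YE // hN' //; congr (_ + _ + _).
apply: eq_Rintegral => r; rewrite inE /= in_itv /= => /andP[r0 _].
by rewrite YE.
Qed.

Lemma rs_jointly_measurable Y f : regular_solution Y -> nice f ->
  jointly_measurable (fun r w => f (Y r w)).
Proof.
move=> rsY [_ mf]; apply: (mf _ _ (fun x : T * R => Y x.2 x.1)).
  by move=> x; case: rsY.
move=> k; apply: (@jointly_measurable_continuous _ _ _ (fun r w => Y r w k 0)).
  by move=> w; case: rsY.
by move=> r; case: rsY.
Qed.

Lemma rs_filtration Y f t : regular_solution Y -> simplex_measurable f -> 0 <= t ->
  measurable_wrt (F t) (fun w => f (Y t w)).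
Proof.
move=> rsY mf t0; apply/measurable_wrtE; apply: (mf _ (g_sigma_algebraType _) (Y t)).
  by case: rsY.
by move=> i; apply/measurable_wrtE; case: rsY => _ _ h _ _ _; exact: h.
Qed.

End regular_version.

(** * Increments of the solution *)

Section time_integrals.
Context {R : realType}.
Local Notation mu := (@lebesgue_measure R).

Definition timeint (a b : R) (u : R -> R) : R := \int[mu]_(r in `[a, b]) u r.

Implicit Types u v : R -> R.

Let mu_itv (a b : R) : a <= b -> mu `[a, b]%classic = (b - a)%:E.
Proof.
move=> ab; rewrite lebesgue_measure_itv /= lte_fin -EFinB.
by case: ltgtP ab => // -> _; rewrite subrr.
Qed.

Lemma bounded_integrable_itv K u a b : measurable_fun setT u ->
  (forall r, `|u r| <= K) -> mu.-integrable `[a, b] (EFin \o u).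
Proof.
move=> mu_ bu; apply: measurable_bounded_integrable.
- exact: measurable_itv.
- by have [ab|ba] := leP a b; [rewrite [ltLHS]mu_itv ?ltry|rewrite set_itv_ge ?measure0 // bnd_simp -ltNge].
- exact: measurable_funTS.
- exists K; split; first by rewrite num_real.
  by move=> x Kx r _; exact: le_trans (bu r) (ltW Kx).
Qed.

Lemma timeint_cst a b c : a <= b -> timeint a b (fun=> c) = c * (b - a).
Proof. by move=> ab; rewrite /timeint Rintegral_cst //= mu_itv. Qed.

Section bounded.
Variables (K : R) (u : R -> R).
Hypotheses (mu_ : measurable_fun setT u) (bu : forall r, `|u r| <= K).

Lemma timeint_split a b c : a <= b -> b <= c ->
  timeint a c u = timeint a b u + timeint b c u.
Proof.
move=> ab bc; have iu := bounded_integrable_itv a c mu_ bu.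
have := @Rintegral_itvB _ u (BLeft a) (BRight c) b iu.
rewrite !bnd_simp => /(_ ab bc) h.
rewrite /timeint -(@Rintegral_itv_obnd_cbnd _ b (BRight c) u) -?h; first by rewrite addrC subrK.
apply: integrableS iu => //; apply: subset_itvr; rewrite bnd_simp //.
Qed.

Lemma timeint_le a b : a <= b -> `|timeint a b u| <= K * (b - a).
Proof.
move=> ab; rewrite -timeint_cst //.
have iu := bounded_integrable_itv a b mu_ bu.
apply: (le_trans (le_normr_Rintegral _ iu)) => //.
apply: le_Rintegral => //.
- exact: (integrable_norm iu).
- apply: (@bounded_integrable_itv `|K|) => //; exact: measurable_cst.
Qed.

(** Cauchy-Schwarz in the form that the integral of (u - m)^2 is nonnegative, with m the mean of u
    over [a, b]. *)
Lemma timeint_sq_le a b : a <= b ->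
  timeint a b u ^+ 2 <= (b - a) * timeint a b (fun r => u r ^+ 2).
Proof.
rewrite le_eqVlt => /orP[/eqP ->|ab].
  by rewrite subrr mul0r /timeint set_itv1 Rintegral_set1 expr0n.
have ba0 : 0 < b - a by rewrite subr_gt0.
have iu := bounded_integrable_itv a b mu_ bu.
have iu2 : mu.-integrable `[a, b] (EFin \o (fun r => u r ^+ 2)).
  apply: (@bounded_integrable_itv (K ^+ 2)); first exact: measurable_funX.
  by move=> r; rewrite normrX ler_pXn2r ?nnegrE // (le_trans _ (bu r)).
pose m := timeint a b u / (b - a).
have icst c : mu.-integrable `[a, b] (EFin \o (fun=> c)).
  by apply: (@bounded_integrable_itv `|c|) => //; exact: measurable_cst.
have i2 : mu.-integrable `[a, b] (EFin \o (fun r => 2 * m * u r)).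
  have := @integrableZl _ _ _ mu _ (measurable_itv _) (2 * m) _ iu.
  by apply: eq_integrable.
have h : 0 <= timeint a b (fun r => u r ^+ 2 - 2 * m * u r + m ^+ 2).
  apply: Rintegral_ge0 => r _; have := sqr_ge0 (u r - m); nra.
move: h; rewrite /timeint RintegralD //; last first.
  have := @integrableB _ _ _ mu _ (measurable_itv _) _ _ iu2 i2.
  by apply: eq_integrable.
rewrite RintegralB // RintegralZl // -/(timeint _ _ _) -/(timeint _ _ _) -/(timeint _ _ _).
rewrite timeint_cst ?(ltW ab) //.
have e : timeint a b u = m * (b - a) by rewrite /m divfK // gt_eqF.
rewrite e => h.
rewrite (_ : (m * (b - a)) ^+ 2 = (b - a) * (m ^+ 2 * (b - a))); last by ring.
rewrite ler_pM2l //; lra.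
Qed.

End bounded.

Lemma timeintB K u v a b : measurable_fun setT u -> measurable_fun setT v ->
  (forall r, `|u r| <= K) -> (forall r, `|v r| <= K) ->
  timeint a b (fun r => u r - v r) = timeint a b u - timeint a b v.
Proof.
move=> m1 m2 b1 b2; apply: RintegralB => //; exact: (@bounded_integrable_itv K).
Qed.

End time_integrals.

Section random_time_integrals.
Context {d : measure_display} {T : measurableType d} {R : realType}.
Variable P : probability T R.
Local Notation mu := (@lebesgue_measure R).

Lemma jointly_measurable_section (u : R -> T -> R) w : jointly_measurable u ->
  measurable_fun setT (u ^~ w).
Proof. by move=> mu_; exact: (measurableT_comp mu_ (pair1_measurable w)). Qed.

Lemma measurable_timeint K (u : R -> T -> R) a b : jointly_measurable u ->
  (forall r w, `|u r w| <= K) -> a <= b ->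
  measurable_fun setT (fun w => timeint a b (u ^~ w)).
Proof.
move=> mu_ bu ab.
(* Adding [K] makes the integrand nonnegative, so that the measurability part of Tonelli's theorem
   applies; the added K (b - a) is subtracted again. *)
pose v r w := (u r w + K) * \1_(`[a, b]%classic) r.
have v0 r w : 0 <= v r w.
  by rewrite mulr_ge0 // -lerBlDr sub0r; have := bu r w; rewrite ler_norml => /andP[].
have mv : jointly_measurable v.
  apply: measurable_funM; first exact: measurable_funD.
  by apply: jointly_measurable_time; exact: measurable_indic.
have h : measurable_fun setT (fun w => \int[mu]_r (v r w)%:E)%E.
  apply: (measurable_fun_fubini_tonelli_F (m2 := mu) (fun x : T * R => (v x.2 x.1)%:E)).
    exact/measurable_EFinP.
  by move=> x; rewrite lee_fin.
rewrite (_ : (fun w => _) = fun w => fine (\int[mu]_r (v r w)%:E)%E - K * (b - a)).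
  apply: measurable_funB; last exact: measurable_cst.
  exact: (measurableT_comp (fine_measurable measurableT) h).
apply/funext => w; rewrite -(timeint_cst K ab).
have mw := jointly_measurable_section w mu_.
rewrite (_ : fine _ = timeint a b (fun r => u r w + K)).
  rewrite /timeint RintegralD ?addrK //; first exact: (@bounded_integrable_itv _ K).
  by apply: (@bounded_integrable_itv _ `|K|) => //; exact: measurable_cst.
rewrite /timeint /Rintegral integral_mkcond; congr fine; apply: eq_integral => r _.
by rewrite patchE /v indicE; case: (r \in _); rewrite ?mulr1 ?mulr0.
Qed.

Lemma sq_norm_bound K (u : R -> T -> R) a b : jointly_measurable u -> a <= b ->
  (forall r, a <= r <= b -> int1 P (fun w => u r w ^+ 2) /\ Ex P (fun w => u r w ^+ 2) <= K) ->
  (sq_norm P (fun r w => (u r w * \1_(`[a, b]%classic) r)%R) <= (K * (b - a))%:E)%E.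
Proof.
move=> mu_ ab h.
have mv : jointly_measurable (fun r w => u r w * \1_(`[a, b]%classic) r).
  by apply: measurable_funM => //; apply: jointly_measurable_time; exact: measurable_indic.
rewrite sq_norm_prod // fubini_tonelli2; last 2 first.
- exact: (jointly_measurable_sq mv).
- by move=> x; rewrite lee_fin sqr_ge0.
have mab : mu `[a, b]%classic = (b - a)%:E.
  rewrite lebesgue_measure_itv /= lte_fin -EFinB.
  by case: ltgtP ab => // -> _; rewrite subrr.
apply: (@le_trans _ _ (\int[mu]_(r in `[a, b]) K%:E)%E); last first.
  by rewrite integral_cst // [X in (_ * X)%E]mab EFinM.
rewrite [leRHS]integral_mkcond; apply: ge0_le_integral => //.
- by move=> r _; apply: integral_ge0 => w _; rewrite lee_fin sqr_ge0.
- apply: (measurable_fun_fubini_tonelli_G (m1 := P)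
    (fun x : T * R => ((u x.2 x.1 * \1_(`[a, b]%classic) x.2) ^+ 2)%:E)).
    exact: jointly_measurable_sq mv.
  by move=> x; rewrite lee_fin sqr_ge0.
- by apply/(measurable_restrictT _ _).1 => //; exact: measurable_cst.
move=> r _; rewrite patchE /fubini_G /= indicE; case: ifPn => [|_].
  rewrite inE /= in_itv /= => /h [i1 e1]; under eq_integral do rewrite mulr1.
  by rewrite Ex_fin // lee_fin.
by rewrite integral0_eq // => w _; rewrite mulr0 expr0n.
Qed.

Lemma Ex_timeint_sq K (u : R -> T -> R) a b c : jointly_measurable u ->
  (forall r w, `|u r w| <= K) -> a <= b ->
  (sq_norm P (fun r w => (u r w * \1_(`[a, b]%classic) r)%R) <= c%:E)%E ->
  L2 P (fun w => timeint a b (u ^~ w)) /\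
  Ex P (fun w => timeint a b (u ^~ w) ^+ 2) <= (b - a) * c.
Proof.
move=> mu_ bu ab hc.
have mI := measurable_timeint mu_ bu ab.
have hL : L2 P (fun w => timeint a b (u ^~ w)).
  apply: (L2_bdd P mI (c := K * (b - a))) => w.
  apply: timeint_le => //; exact: jointly_measurable_section.
split => //.
have mu2 : jointly_measurable (fun r w => u r w ^+ 2) by exact: measurable_funX.
have bu2 r w : `|u r w ^+ 2| <= K ^+ 2.
  by rewrite normrX ler_pXn2r ?nnegrE // (le_trans _ (bu r w)).
have mI2 := measurable_timeint mu2 bu2 ab.
have i2 : int1 P (fun w => timeint a b (fun r => u r w ^+ 2)).
  apply: (int1_bdd P mI2 (c := K ^+ 2 * (b - a))) => w.
  apply: timeint_le => //; exact: (jointly_measurable_section w mu2).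
apply: (@le_trans _ _ (Ex P (fun w => (b - a) * timeint a b (fun r => u r w ^+ 2)))).
  apply: Ex_le; [exact: hL.2|exact: int1Z|].
  move=> w; apply: (timeint_sq_le (K := K)) => //; exact: jointly_measurable_section.
rewrite ExZ // ler_wpM2l ?subr_ge0 // -lee_fin -Ex_fin //; apply: le_trans hc.
rewrite le_eqVlt; apply/orP; left; apply/eqP; apply: eq_integral => w _.
have iw : mu.-integrable `[a, b] (EFin \o (fun r => u r w ^+ 2)).
  apply: (@bounded_integrable_itv _ (K ^+ 2)) => //; exact: (jointly_measurable_section w mu2).
rewrite /timeint /Rintegral fineK; last exact: integrable_fin_num.
rewrite integral_mkcond; apply: eq_integral => r _.
by rewrite patchE indicE; case: (r \in _); rewrite ?mulr1 // mulr0 expr0n.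
Qed.

End random_time_integrals.

Section solution_increments.
Context {d : measure_display} {T : measurableType d} {R : realType}.
Variable P : probability T R.
Variables (n : nat) (A : 'M[R]_n) (sigma : 'I_n -> R) (x0 : 'cV[R]_n).
Variable W : R -> T -> 'cV[R]_n.
Hypothesis W_bm : standard_brownian_motion P W.
Variable Y : R -> T -> 'cV[R]_n.
Hypothesis rsY : regular_solution P A sigma x0 W Y.
Local Notation F := (brownian_filtration P W).
Local Notation b i x := (replicator_drift A sigma x i 0).
Local Notation C i j x := (replicator_diffusion sigma x i j).

Lemma lipschitz_bound_le K L (f : 'cV[R]_n -> R) : K <= L ->
  lipschitz_bound K f -> lipschitz_bound L f.
Proof.
move=> KL [K0 h1 h2]; split; first exact: le_trans KL.
  by move=> x sx; exact: le_trans (h1 x sx) KL.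
move=> x y sx sy; apply: (le_trans (h2 x y sx sy)).
by rewrite ler_wpM2r // dist1_ge0.
Qed.

Lemma common_bound (I : finType) (f : I -> 'cV[R]_n -> R) :
  (forall i, nice (f i)) -> exists K, 0 <= K /\ forall i, lipschitz_bound K (f i).
Proof.
move=> hf; have /choice[K hK] : forall i, exists K, lipschitz_bound K (f i).
  by move=> i; case: (hf i).
have K0 i : 0 <= K i by case: (hK i).
exists (\sum_i K i); split; first exact: sumr_ge0.
move=> i; apply: lipschitz_bound_le (hK i).
by rewrite (bigD1 i) //= lerDl sumr_ge0.
Qed.

Let sY t w : in_simplex (Y t w). Proof. by case: rsY. Qed.

Let mYf f t : nice f -> measurable_fun setT (fun w => f (Y t w)).
Proof. by move=> [_ mf]; apply: mf => //; case: rsY => _ _ _ h _ _ i; exact: h. Qed.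

Let bYf f K t w : lipschitz_bound K f -> `|f (Y t w)| <= K.
Proof. by move=> [_ h _]; exact: h. Qed.

Lemma sde_increment s t : 0 <= s -> s <= t ->
  exists Js Jt : 'I_n -> 'I_n -> T -> R,
  [/\ forall i j, ito_approximable P W j s (fun r w => C i j (Y r w)) (Js i j),
      forall i j, ito_approximable P W j t (fun r w => C i j (Y r w)) (Jt i j)
    & {ae P, forall w, forall i, Y t w i 0 - Y s w i 0 =
        timeint s t (fun r => b i (Y r w)) + \sum_j (Jt i j w - Js i j w)}].
Proof.
move=> s0 st; case: rsY => _ _ _ _ _ sde.
have [Js hJs es] := sde s s0; have [Jt hJt et] := sde t (le_trans s0 st).
exists Js, Jt; split => //.
apply: filterS2 es et => w es et i.
have [K [K0 hK]] := common_bound (nice_drift A sigma).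
have mu_ : measurable_fun setT (fun r => b i (Y r w)).
  apply: (@jointly_measurable_section _ _ _ (fun r w => b i (Y r w))).
  exact: (rs_jointly_measurable rsY (nice_drift A sigma i)).
rewrite es et -!/(timeint 0 _ _) (@timeint_split _ K _ mu_ _ 0 s t) //; last first.
  by move=> r; apply: bYf (hK i).
rewrite big_split /= sumrN; ring.
Qed.

Let L2Y t i : L2 P (fun w => Y t w i 0).
Proof.
apply: (@L2_bdd _ _ _ _ _ 1); first exact: mYf (nice_coord i).
by move=> w; exact: in_simplex_le1.
Qed.

Let Ex_ito_increment (K : R) s t (i j : 'I_n) (Js Jt : T -> R) : 0 <= s -> s <= t ->
  lipschitz_bound K (fun x => C i j x) ->
  ito_approximable P W j s (fun r w => C i j (Y r w)) Js ->
  ito_approximable P W j t (fun r w => C i j (Y r w)) Jt ->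
  L2 P (fun w => Jt w - Js w) /\
  Ex P (fun w => (Jt w - Js w) ^+ 2) <= 6 * (K ^+ 2 * (t - s)).
Proof.
move=> s0 st hK hs ht.
have L : L2 P (fun w => Jt w - Js w).
  by apply: L2B; [exact: (ito_approximable_L2 W_bm ht)|exact: (ito_approximable_L2 W_bm hs)].
split => //.
have m0 : measurable_wrt (F s) (fun=> 0 : R) by apply/measurable_wrtE; exact: measurable_cst.
have jmC : jointly_measurable (fun r w => C i j (Y r w)).
  exact: (rs_jointly_measurable rsY (nice_diffusion sigma i j)).
have := @ito_increment_sq _ _ _ _ _ _ W_bm j s t _ _ _ s0 st jmC hs ht (fun=> 0) (K ^+ 2 * (t - s)) m0.
rewrite (_ : (fun w => (Jt w - Js w - 0 * _) ^+ 2) = (fun w => (Jt w - Js w) ^+ 2)); last first.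
  by apply/funext => w; rewrite mul0r subr0.
apply; first by exists 0 => w; rewrite normr0.
have := @sq_norm_bound _ _ _ P (K ^+ 2) (fun r w => C i j (Y r w) - 0) s t.
apply => //.
  by apply: jointly_measurableB => //; exact: measurable_cst.
move=> r _; have bC w : `|C i j (Y r w) - 0| <= K by rewrite subr0; exact: (bYf r w hK).
have LC : L2 P (fun w => C i j (Y r w) - 0).
  apply: L2_bdd bC; apply: measurable_funB => //; exact: (mYf r (nice_diffusion sigma i j)).
split; first exact: LC.2.
rewrite -[leRHS](Ex_cst P); apply: Ex_le; [exact: LC.2|exact: int1_cst|].
move=> w; rewrite -(real_normK (num_real (C i j (Y r w) - 0))) ler_pXn2r // ?nnegrE //.
exact: le_trans (bC w).
Qed.

(** The stochastic part is the increment estimate with [eta] = 0. The restriction t <= s + 1 absorbs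
    the drift contribution (t - s)^2 into t - s. *)
Lemma crude_increment : exists K, 0 <= K /\ forall s t i, 0 <= s -> s <= t -> t <= s + 1 ->
  Ex P (fun w => (Y t w i 0 - Y s w i 0) ^+ 2) <= K * (t - s).
Proof.
have [Kb [Kb0 hKb]] := common_bound (nice_drift A sigma).
have [Kc [Kc0 hKc]] := common_bound (fun ij : 'I_n * 'I_n => nice_diffusion sigma ij.1 ij.2).
exists (2 * (Kb ^+ 2 + n%:R * (n%:R * (6 * Kc ^+ 2)))); split.
  by rewrite !(mulr_ge0, addr_ge0, sqr_ge0).
move=> s t i s0 st t1.
have [Js [Jt [hJs hJt e]]] := sde_increment s0 st.
have hLJ j := Ex_ito_increment s0 st (hKc (i, j)) (hJs i j) (hJt i j).
pose B w := timeint s t (fun r => b i (Y r w)).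
pose S w := \sum_j (Jt i j w - Js i j w).
have jmb : jointly_measurable (fun r w => b i (Y r w)).
  exact: (rs_jointly_measurable rsY (nice_drift A sigma i)).
have mB : measurable_fun setT B.
  by apply: (measurable_timeint jmb) st => r w; exact: (bYf r w (hKb i)).
have bB w : `|B w| <= Kb * (t - s).
  apply: timeint_le => // [|r]; first exact: (jointly_measurable_section w jmb).
  exact: (bYf r w (hKb i)).
have LB : L2 P B := L2_bdd P mB bB.
have LS : L2 P S by apply: L2_sum => j; case: (hLJ j).
have LD : L2 P (fun w => Y t w i 0 - Y s w i 0) by exact: L2B.
rewrite (@Ex_ae _ _ _ P _ (fun w => (B w + S w) ^+ 2)); last 3 first.
- by apply: measurable_funX; case: LD.
- by apply: measurable_funX; case: (L2D LB LS).
- by apply: filterS e => w ->.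
apply: (le_trans (Ex_sqD LB LS)).
have ts0 : 0 <= t - s by rewrite subr_ge0.
have ts1 : t - s <= 1 by rewrite lerBlDl.
have EB : Ex P (fun w => B w ^+ 2) <= Kb ^+ 2 * (t - s).
  apply: (@le_trans _ _ (Ex P (fun=> Kb ^+ 2 * (t - s)))); last by rewrite Ex_cst.
  apply: Ex_le; [exact: LB.2|exact: int1_cst|] => w.
  rewrite -(real_normK (num_real (B w))).
  apply: (@le_trans _ _ ((Kb * (t - s)) ^+ 2)).
    by rewrite ler_pXn2r // ?nnegrE // (le_trans _ (bB w)).
  rewrite exprMn ler_wpM2l ?sqr_ge0 // expr2 ler_piMr //.
have ES : Ex P (fun w => S w ^+ 2) <= n%:R * (n%:R * (6 * Kc ^+ 2) * (t - s)).
  apply: (le_trans (Ex_sq_sum (fun j => (hLJ j).1))); rewrite ler_wpM2l //.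
  apply: (@le_trans _ _ (\sum_(j < n) 6 * (Kc ^+ 2 * (t - s)))).
    by apply: ler_sum => j _; exact: (hLJ j).2.
  by rewrite sumr_const card_ord -[leLHS]mulr_natl !mulrA.
rewrite -[leRHS]mulrA ler_wpM2l // [leRHS]mulrDl lerD //.
by rewrite -mulrA.
Qed.

Lemma nice_increment f : nice f -> exists K, 0 <= K /\
  forall s t, 0 <= s -> s <= t -> t <= s + 1 ->
  Ex P (fun w => (f (Y t w) - f (Y s w)) ^+ 2) <= K * (t - s).
Proof.
move=> nf; have [[L [L0 bf lf]] mf] := nf; have [K [K0 hK]] := crude_increment.
exists (L ^+ 2 * (n%:R * (n%:R * K))); split.
  by rewrite !(mulr_ge0, sqr_ge0).
move=> s t s0 st t1.
have LY i : L2 P (fun w => `|Y t w i 0 - Y s w i 0|).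
  have [m i2] := L2B (L2Y t i) (L2Y s i).
  apply: (L2_le _ (conj m i2)) => [|w]; last by rewrite normr_id.
  exact: measurableT_comp.
apply: (@le_trans _ _ (Ex P (fun w => L ^+ 2 * (\sum_i `|Y t w i 0 - Y s w i 0|) ^+ 2))).
  apply: Ex_le.
  - have h : L2 P (fun w => f (Y t w) - f (Y s w)); last exact: h.2.
    by apply: L2B; apply: (@L2_bdd _ _ _ _ _ L) => [|w]; first [exact: mYf|exact: bf].
  - by apply: int1Z; exact: (L2_sum _ _ LY).2.
  move=> w; rewrite -exprMn -(real_normK (num_real (f _ - _))).
  by rewrite ler_pXn2r // ?nnegrE // ?lf // mulr_ge0 // sumr_ge0.
rewrite ExZ; last exact: (L2_sum _ _ LY).2.
rewrite -[leRHS]mulrA ler_wpM2l ?sqr_ge0 //.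
apply: (le_trans (Ex_sq_sum LY)); rewrite -[leRHS]mulrA ler_wpM2l //.
apply: (@le_trans _ _ (\sum_(i < n) K * (t - s))).
  apply: ler_sum => i _.
  rewrite (_ : (fun w => _) = fun w => (Y t w i 0 - Y s w i 0) ^+ 2); first exact: hK.
  by apply/funext => w; rewrite real_normK ?num_real.
by rewrite sumr_const card_ord -[leLHS]mulr_natl mulrA.
Qed.

(** The mean-square increment from s to r is of order r - s; integrating over r gains one more power
    of t - s. *)
Lemma nice_sq_norm f : nice f -> exists K, 0 <= K /\
  forall s t, 0 <= s -> s <= t -> t <= s + 1 ->
  (sq_norm P (fun r w => ((f (Y r w) - f (Y s w)) * \1_(`[s, t]%classic) r)%R)
     <= (K * (t - s) ^+ 2)%:E)%E.
Proof.
move=> nf; have [K [K0 hK]] := nice_increment nf.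
exists K; split => // s t s0 st t1.
rewrite expr2 mulrA.
apply: (sq_norm_bound (u := fun r w => f (Y r w) - f (Y s w))) => //.
  apply: jointly_measurableB; first exact: (rs_jointly_measurable rsY nf).
  by apply: jointly_measurable_cst; exact: mYf.
move=> r /andP[sr rt]; have [[L [L0 bf lf]] mf] := nf.
have LL : L2 P (fun w => f (Y r w) - f (Y s w)).
  by apply: L2B; apply: (@L2_bdd _ _ _ _ _ L) => [|w]; first [exact: mYf|exact: bf].
split; first exact: LL.2.
apply: (le_trans (hK s r s0 sr (le_trans rt t1))).
by rewrite ler_wpM2l // lerB.
Qed.

End solution_increments.

(** * Euler steps with coefficients frozen at the left endpoint *)

Section increment_expansion.
Context {d : measure_display} {T : measurableType d} {R : realType}.
Variable P : probability T R.
Variables (n : nat) (A : 'M[R]_n) (sigma : 'I_n -> R) (x0 : 'cV[R]_n).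
Variable W : R -> T -> 'cV[R]_n.
Hypothesis W_bm : standard_brownian_motion P W.
Variable Y : R -> T -> 'cV[R]_n.
Hypothesis rsY : regular_solution P A sigma x0 W Y.
Variable l : 'I_n.
Local Notation F := (brownian_filtration P W).
Local Notation b x := (replicator_drift A sigma x l 0).
Local Notation C j x := (replicator_diffusion sigma x l j).

(** The l-th diagonal entry of C C^T, that is, the rate of quadratic variation of the l-th
    coordinate. *)
Definition variance_rate (x : 'cV[R]_n) : R := \sum_j C j x ^+ 2.

Lemma nice_variance_rate : nice variance_rate.
Proof.
apply: nice_sum => j; apply: (niceM (f := fun x => C j x) (g := fun x => C j x));
  exact: nice_diffusion.
Qed.

Definition main_term s t w : R := \sum_j C j (Y s w) * incr W j s t w.

Definition remainder s t w : R :=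
  (Y t w l 0 - Y s w l 0) - b (Y s w) * (t - s) - main_term s t w.

Lemma sqr_sum_le m (a : 'I_m -> R) : (\sum_i a i) ^+ 2 <= m%:R * \sum_i a i ^+ 2.
Proof.
have La i : L2 P (fun=> a i) by apply: (@L2_bdd _ _ _ _ _ `|a i|) => //; exact: measurable_cst.
have := Ex_sq_sum La; rewrite Ex_cst; under [X in _ <= _ * X -> _]eq_bigr do rewrite Ex_cst.
by [].
Qed.

Let sY t w : in_simplex (Y t w). Proof. by case: rsY. Qed.

Let mYf f t : nice f -> measurable_fun setT (fun w => f (Y t w)).
Proof. by move=> [_ mf]; apply: mf => //; case: rsY => _ _ _ h _ _ i; exact: h. Qed.

Let fYf f t : 0 <= t -> nice f -> measurable_wrt (F t) (fun w => f (Y t w)).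
Proof. by move=> t0 [_ mf]; exact: (rs_filtration rsY mf t0). Qed.

Section main_term_moments.
Variables (s t : R).
Hypotheses (s0 : 0 <= s) (st : s < t).

Let bC K j w : lipschitz_bound K (fun x => C j x) -> `|C j (Y s w)| <= K.
Proof. by move=> [_ h _]; exact: h. Qed.

Let LC j : L2 P (fun w => C j (Y s w) * incr W j s t w).
Proof.
have [[K hK] _] := nice_diffusion sigma l j.
apply: (L2M_bdd (c := K)); first exact: (mYf s (nice_diffusion sigma l j)).
  by move=> w; exact: bC.
exact: L2_dW.
Qed.

Lemma main_term_L2 : L2 P (main_term s t).
Proof. exact: L2_sum. Qed.

Lemma Ex_main_term xi c : measurable_wrt (F s) xi -> (forall w, `|xi w| <= c) ->
  Ex P (fun w => xi w * main_term s t w) = 0.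
Proof.
move=> mxi bxi.
rewrite (_ : (fun w => _) = fun w => \sum_j (xi w * C j (Y s w)) * incr W j s t w); last first.
  by apply/funext => w; rewrite mulr_sumr; apply: eq_bigr => j _; rewrite mulrA.
have h j : int1 P (fun w => xi w * C j (Y s w) * incr W j s t w) /\
    Ex P (fun w => xi w * C j (Y s w) * incr W j s t w) = 0.
  have [[K hK] _] := nice_diffusion sigma l j.
  have mxC : measurable_wrt (F s) (fun w => xi w * C j (Y s w)).
    by apply: measurable_wrtM => //; exact: (fYf s0 (nice_diffusion sigma l j)).
  apply: Ex_filtration_dW => //; first exact: ltW.
  apply: (@int1_bdd _ _ _ _ _ (c * K)); first exact (filtration_measurable W_bm mxC).
  by move=> w; rewrite normrM ler_pM // bC.
rewrite Ex_sum; last by move=> j; case: (h j).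
by apply: big1 => j _; case: (h j).
Qed.

(** After expanding the square, products of increments of different components have mean 0 against
    the past, and each squared increment contributes t - s. *)
Lemma Ex_main_term2 xi c : measurable_wrt (F s) xi -> (forall w, `|xi w| <= c) ->
  Ex P (fun w => xi w * main_term s t w ^+ 2) =
  (t - s) * Ex P (fun w => xi w * variance_rate (Y s w)).
Proof.
move=> mxi bxi.
have mxC j k : measurable_wrt (F s) (fun w => xi w * C j (Y s w) * C k (Y s w)).
  apply: measurable_wrtM; last exact: (fYf s0 (nice_diffusion sigma l k)).
  by apply: measurable_wrtM => //; exact: (fYf s0 (nice_diffusion sigma l j)).
have bxC j k : exists c', forall w, `|xi w * C j (Y s w) * C k (Y s w)| <= c'.
  have [[K hK] _] := nice_diffusion sigma l j.
  have [[L hL] _] := nice_diffusion sigma l k.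
  exists (c * K * L) => w; rewrite !normrM ler_pM ?mulr_ge0 // ?bC //.
  by rewrite ler_pM // bC.
have ixC j k : int1 P (fun w => xi w * C j (Y s w) * C k (Y s w)).
  have [c' hc'] := bxC j k.
  by apply: (int1_bdd P _ hc'); exact (filtration_measurable W_bm (mxC j k)).
pose E j k w := (xi w * C j (Y s w) * C k (Y s w)) * (incr W j s t w * incr W k s t w).
have hE j k : int1 P (E j k) /\ Ex P (E j k) =
    if j == k then Ex P (fun w => xi w * C j (Y s w) * C k (Y s w)) * (t - s) else 0.
  case: eqVneq => [->|jk].
    rewrite (_ : E k k = fun w => (xi w * C k (Y s w) * C k (Y s w)) * incr W k s t w ^+ 2).
      exact: Ex_filtration_dW2 (ltW st) (mxC k k) (ixC k k).
    by apply/funext => w; rewrite /E expr2.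
  have [c' hc'] := bxC j k.
  exact: (Ex_filtration_dW_cross W_bm jk s0 (ltW st) (mxC j k) hc').
rewrite (_ : (fun w => _) = fun w => \sum_j \sum_k E j k w); last first.
  apply/funext => w; rewrite expr2 big_distrlr mulr_sumr; apply: eq_bigr => j _.
  by rewrite mulr_sumr; apply: eq_bigr => k _; rewrite /E /=; ring.
rewrite Ex_sum; last by move=> j; apply: int1_sum => k; case: (hE j k).
transitivity (\sum_j Ex P (fun w => xi w * C j (Y s w) * C j (Y s w)) * (t - s)).
  apply: eq_bigr => j _; rewrite Ex_sum; last by move=> k; case: (hE j k).
  rewrite (bigD1 j) //= big1 ?addr0; first by case: (hE j j) => _ ->; rewrite eqxx.
  by move=> k kj; case: (hE j k) => _ ->; rewrite eq_sym (negbTE kj).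
rewrite -mulr_suml mulrC; congr (_ * _).
rewrite -Ex_sum //; congr Ex; apply/funext => w.
by rewrite /variance_rate mulr_sumr; apply: eq_bigr => j _; rewrite -mulrA expr2.
Qed.

Lemma main_term_sq_L2 : L2 P (fun w => main_term s t w ^+ 2).
Proof.
have [mM _] := main_term_L2.
have hj j : L2 P (fun w => (C j (Y s w) * incr W j s t w) ^+ 2).
  have [[K hK] _] := nice_diffusion sigma l j.
  rewrite (_ : (fun w => _) = fun w => C j (Y s w) ^+ 2 * incr W j s t w ^+ 2); last first.
    by apply/funext => w; rewrite exprMn.
  apply: (L2M_bdd (c := K ^+ 2)); last exact: L2_dW2.
    apply: measurable_funX; exact: (mYf s (nice_diffusion sigma l j)).
  move=> w; rewrite normrX ler_pXn2r ?nnegrE // ?bC //.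
  by rewrite (le_trans _ (bC w hK)).
apply: (L2_le _ (L2Z n%:R (L2_sum (index_enum 'I_n) xpredT hj))).
  exact: measurable_funX.
move=> w; rewrite ger0_norm ?sqr_ge0 // ger0_norm; first exact: sqr_sum_le.
by rewrite mulr_ge0 // sumr_ge0 // => j _; exact: sqr_ge0.
Qed.

(** The powers of n come from applying Cauchy-Schwarz twice to the sum over components; the 3 is the
    fourth moment of a standard normal variable. *)
Lemma Ex_main_term4 K : (forall j, lipschitz_bound K (fun x => C j x)) ->
  Ex P (fun w => (main_term s t w ^+ 2) ^+ 2) <=
  n%:R ^+ 2 * (n%:R * (n%:R * (K ^+ 4 * 3))) * (t - s) ^+ 2.
Proof.
move=> hK.
have K0 (j : 'I_n) : 0 <= K by case: (hK j).
have hj j : L2 P (fun w => (C j (Y s w) * incr W j s t w) ^+ 2).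
  rewrite (_ : (fun w => _) = fun w => C j (Y s w) ^+ 2 * incr W j s t w ^+ 2); last first.
    by apply/funext => w; rewrite exprMn.
  apply: (L2M_bdd (c := K ^+ 2)); last exact: L2_dW2.
    apply: measurable_funX; exact: (mYf s (nice_diffusion sigma l j)).
  move=> w; rewrite normrX ler_pXn2r ?nnegrE // ?bC //.
  exact: K0 j.
have LS := L2_sum (index_enum 'I_n) xpredT hj.
apply: (@le_trans _ _ (Ex P (fun w => n%:R ^+ 2 * (\sum_j (C j (Y s w) * incr W j s t w) ^+ 2) ^+ 2))).
  apply: Ex_le; [exact: main_term_sq_L2.2|exact: int1Z LS.2|].
  move=> w; have h := sqr_sum_le (fun j => C j (Y s w) * incr W j s t w).
  rewrite -exprMn ler_pXn2r //; first by rewrite nnegrE sqr_ge0.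
  by rewrite nnegrE mulr_ge0 // sumr_ge0 // => j _; exact: sqr_ge0.
rewrite ExZ; last exact: LS.2.
rewrite -[leRHS]mulrA ler_wpM2l ?sqr_ge0 //; apply: (le_trans (Ex_sq_sum hj)).
rewrite -[leRHS]mulrA ler_wpM2l //.
apply: (@le_trans _ _ (\sum_(j < n) K ^+ 4 * 3 * (t - s) ^+ 2)); last first.
  by rewrite sumr_const card_ord -[leLHS]mulr_natl mulrA.
apply: ler_sum => j _.
have i4 : int1 P (fun w => incr W j s t w ^+ 4).
  rewrite (_ : (fun w => _) = fun w => (incr W j s t w ^+ 2) ^+ 2).
    by case: (L2_dW2 W_bm j s0 st).
  by apply/funext => w; rewrite -exprM.
apply: (@le_trans _ _ (Ex P (fun w => K ^+ 4 * incr W j s t w ^+ 4))).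
  apply: Ex_le; [exact: (hj j).2|exact: int1Z|] => w.
  rewrite -exprM exprMn ler_wpM2r ?(exprM _ 2 2) ?sqr_ge0 //.
  rewrite ler_pXn2r ?nnegrE ?sqr_ge0 //.
  rewrite -(real_normK (num_real (C j _))) ler_pXn2r ?nnegrE ?bC //; exact: K0 j.
rewrite ExZ // -mulrA ler_wpM2l; first by [].
  by rewrite (exprM _ 2 2) sqr_ge0.
exact: Ex_dW4.
Qed.

End main_term_moments.

Let bounded_L2 f K t : nice f -> lipschitz_bound K f -> L2 P (fun w => f (Y t w)).
Proof.
by move=> nf [_ h _]; apply: (@L2_bdd _ _ _ _ _ K) => [|w]; [exact: mYf|exact: h].
Qed.

Let L2coord t : L2 P (fun w => Y t w l 0).
Proof.
apply: (@L2_bdd _ _ _ _ _ 1) => [|w]; first exact: (mYf t (nice_coord l)).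
exact: in_simplex_le1.
Qed.

(** The remainder is [r1] + [r2], the fluctuations of the drift and of the diffusion coefficient.
    [r2] dominates in size, with second moment of order (t - s)^2, but it is orthogonal to the past.
    Against [xi] only [r1] remains, whose second moment is of order (t - s)^3. *)
Lemma remainder_bounds : exists K, 0 <= K /\ forall s t, 0 <= s -> s < t -> t <= s + 1 ->
  [/\ L2 P (remainder s t), Ex P (fun w => remainder s t w ^+ 2) <= K * (t - s) ^+ 2
    & forall xi c th, measurable_wrt (F s) xi -> (forall w, `|xi w| <= c) -> 0 < th ->
      `|Ex P (fun w => xi w * remainder s t w)| <= th * c ^+ 2 + th^-1 * (K * (t - s) ^+ 3)].
Proof.
have nb := nice_drift A sigma l; have nC j := nice_diffusion sigma l j.
have [Kb [Kb0 hKb]] := nice_sq_norm W_bm rsY nb.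
have /choice[Kc hKc] := fun j => nice_sq_norm W_bm rsY (nC j).
pose Kr := \sum_j 6 * Kc j.
have Kr0 : 0 <= Kr by apply: sumr_ge0 => j _; rewrite mulr_ge0 //; case: (hKc j).
exists (2 * (Kb + n%:R * Kr)); split; first by rewrite !(mulr_ge0, addr_ge0).
move=> s t s0 st t1; have st' := ltW st.
have [Js [Jt [hJs hJt e]]] := sde_increment rsY s0 st'.
have [[Lb hLb] _] := nb.
pose u r w := b (Y r w) - b (Y s w).
have jmu : jointly_measurable u.
  apply: jointly_measurableB; first exact: (rs_jointly_measurable rsY nb).
  by apply: jointly_measurable_cst; exact: (mYf s nb).
have bu r w : `|u r w| <= Lb + Lb.
  by case: hLb => _ h _; rewrite (le_trans (ler_normB _ _)) // lerD ?h.
pose r1 w := timeint s t (u ^~ w).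
have [L1 E1] : L2 P r1 /\ Ex P (fun w => r1 w ^+ 2) <= (t - s) * (Kb * (t - s) ^+ 2).
  by apply: (Ex_timeint_sq jmu bu st'); exact: hKb.
pose q j w := Jt l j w - Js l j w - C j (Y s w) * incr W j s t w.
have mC j : measurable_wrt (F s) (fun w => C j (Y s w)) by exact: (fYf s0 (nC j)).
have bC j : exists c, forall w, `|C j (Y s w)| <= c.
  by have [[K [_ h _]] _] := nC j; exists K => w; exact: h.
have jmC j : jointly_measurable (fun r w => C j (Y r w)).
  exact: (rs_jointly_measurable rsY (nC j)).
have LCW j : L2 P (fun w => C j (Y s w) * incr W j s t w).
  have [c hc] := bC j; apply: (L2M_bdd _ hc); last exact: L2_dW.
  exact: (mYf s (nC j)).
have LJ j : L2 P (fun w => Jt l j w - Js l j w).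
  by apply: L2B; [exact: (ito_approximable_L2 W_bm (hJt l j))|exact: (ito_approximable_L2 W_bm (hJs l j))].
have Lq j : L2 P (q j) by exact: L2B.
have Eq j : Ex P (fun w => q j w ^+ 2) <= 6 * (Kc j * (t - s) ^+ 2).
  apply: (ito_increment_sq W_bm s0 st' (jmC j) (hJs l j) (hJt l j) (mC j) (bC j)).
  by apply: (hKc j).2.
pose r2 w := \sum_j q j w.
have Lr2 : L2 P r2 by exact: L2_sum.
have Er2 : Ex P (fun w => r2 w ^+ 2) <= n%:R * Kr * (t - s) ^+ 2.
  apply: (le_trans (Ex_sq_sum Lq)); rewrite -mulrA ler_wpM2l // /Kr mulr_suml.
  by apply: ler_sum => j _; rewrite -mulrA.
have Lrem : L2 P (remainder s t).
  apply: L2B; last exact: main_term_L2.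
  apply: L2B; last first.
    have := L2Z (t - s) (bounded_L2 s nb hLb).
    by under [X in L2 P X -> _]eq_fun do rewrite mulrC.
  by apply: L2B; exact: L2coord.
have erem : {ae P, forall w, remainder s t w = r1 w + r2 w}.
  apply: filterS e => w /(_ l) ew; rewrite /remainder ew /r1 /u.
  have mb : measurable_fun setT (fun r => b (Y r w)).
    exact: (jointly_measurable_section w (rs_jointly_measurable rsY nb)).
  rewrite (@timeintB _ Lb _ (fun=> b (Y s w)) s t mb); first last.
  - by move=> r; case: hLb => _ h _; exact: h.
  - by move=> r; case: hLb => _ h _; exact: h.
  - exact: measurable_cst.
  rewrite timeint_cst // /r2 /q /main_term !sumrB; ring.
have st1 : (t - s) ^+ 3 <= (t - s) ^+ 2.
  rewrite exprS ler_piMl ?sqr_ge0 //; by rewrite lerBlDl.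
split => //.
  rewrite (@Ex_ae _ _ _ P _ (fun w => (r1 w + r2 w) ^+ 2)); last 3 first.
  - by apply: measurable_funX; case: Lrem.
  - by apply: measurable_funX; case: (L2D L1 Lr2).
  - by apply: filterS erem => w ->.
  apply: (le_trans (Ex_sqD L1 Lr2)); rewrite -mulrA ler_wpM2l // mulrDl lerD //.
  apply: (le_trans E1); rewrite mulrCA -exprS ler_wpM2l //.
move=> xi c th mxi bxi th0.
have mxi' := filtration_measurable W_bm mxi.
have Lxi : L2 P xi := L2_bdd P mxi' bxi.
rewrite (@Ex_ae _ _ _ P _ (fun w => xi w * r1 w + xi w * r2 w)); last 3 first.
- by apply: measurable_funM => //; case: Lrem.
- by apply: measurable_funD; apply: measurable_funM => //; [case: L1|case: Lr2].
- by apply: filterS erem => w ->; rewrite mulrDr.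
(* Each summand is an Ito increment minus a past variable times a Brownian increment, and both have
   mean 0 against [xi]. *)
have Exr2 : Ex P (fun w => xi w * r2 w) = 0.
  rewrite (_ : (fun w => _) = fun w => \sum_j xi w * q j w); last first.
    by apply/funext => w; rewrite mulr_sumr.
  rewrite Ex_sum; last by move=> j; exact: L2_mul.
  apply: big1 => j _.
  rewrite (_ : (fun w => _) = fun w => xi w * (Jt l j w - Js l j w) -
     (xi w * C j (Y s w)) * incr W j s t w); last first.
    by apply/funext => w; rewrite /q; ring.
  have [c' hc'] := bC j.
  have mxC : measurable_wrt (F s) (fun w => xi w * C j (Y s w)) by exact: measurable_wrtM.
  have ixC : int1 P (fun w => xi w * C j (Y s w)).
    apply: (@int1_bdd _ _ _ _ _ (c * c')); first exact (filtration_measurable W_bm mxC).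
    by move=> w; rewrite normrM ler_pM.
  have [i2 e2] := Ex_filtration_dW W_bm j s0 st' mxC ixC.
  rewrite ExB //; last exact: L2_mul.
  by rewrite e2 subr0 (ito_increment_Ex W_bm s0 st' (jmC j) (hJs l j) (hJt l j) mxi bxi).
rewrite ExD; [|exact: L2_mul|exact: L2_mul].
rewrite Exr2 addr0; apply: (le_trans (Ex_abs (L2_mul Lxi L1))).
apply: (le_trans (Ex_mul_le th0 Lxi L1)); apply: lerD.
  rewrite ler_wpM2l ?(ltW th0) // -[leRHS](Ex_cst P).
  apply: Ex_le; [exact: Lxi.2|exact: int1_cst|] => w.
  rewrite -(real_normK (num_real (xi w))) ler_pXn2r ?nnegrE //.
  exact: le_trans (bxi w).
rewrite ler_wpM2l ?invr_ge0 ?(ltW th0) //; apply: (le_trans E1).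
rewrite mulrCA -exprS ler_wpM2r ?exprn_ge0 ?subr_ge0 //.
rewrite mulrDr -[leLHS]addr0 lerD ?mulr_ge0 //.
by rewrite ler_peMl // ler1n.
Qed.

End increment_expansion.

Section one_step_moments.
Context {d : measure_display} {T : measurableType d} {R : realType}.
Variable P : probability T R.
Variables (n : nat) (A : 'M[R]_n) (sigma : 'I_n -> R) (x0 : 'cV[R]_n).
Variable W : R -> T -> 'cV[R]_n.
Hypothesis W_bm : standard_brownian_motion P W.
Variable Y : R -> T -> 'cV[R]_n.
Hypothesis rsY : regular_solution P A sigma x0 W Y.
Variable l : 'I_n.
Local Notation F := (brownian_filtration P W).
Local Notation b x := (replicator_drift A sigma x l 0).
Local Notation V x := (variance_rate sigma l x).
Local Notation M := (main_term sigma W Y l).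
Local Notation rho := (remainder A sigma W Y l).

Let sY t w : in_simplex (Y t w). Proof. by case: rsY. Qed.

Let mYf f t : nice f -> measurable_fun setT (fun w => f (Y t w)).
Proof. by move=> [_ mf]; apply: mf => //; case: rsY => _ _ _ h _ _ i; exact: h. Qed.

Let fYf f t : 0 <= t -> nice f -> measurable_wrt (F t) (fun w => f (Y t w)).
Proof. by move=> t0 [_ mf]; exact: (rs_filtration rsY mf t0). Qed.

Let L2f f t : nice f -> L2 P (fun w => f (Y t w)).
Proof.
move=> nf; have [[K [_ h _]] _] := nf.
by apply: (@L2_bdd _ _ _ _ _ K) => [|w]; [exact: mYf|exact: h].
Qed.

Let dY s t w := Y t w l 0 - Y s w l 0.

Let dY_le1 s t w : `|dY s t w| <= 1.
Proof.
have [/(_ l) /andP[a0 a1] _] := sY s w; have [/(_ l) /andP[c0 c1] _] := sY t w.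
by rewrite ler_norml /dY; apply/andP; split; lra.
Qed.

Let mdY s t : measurable_fun setT (dY s t).
Proof. by apply: measurable_funB; exact: (mYf _ (nice_coord l)). Qed.

(** The step length is h^2, and every error that must disappear after summing t / h^2 steps is of
    order h^3. *)
Lemma increment_moments : exists K, 0 <= K /\ forall s h, 0 <= s -> 0 < h -> h <= 1 ->
  let t := s + h ^+ 2 in
  [/\ Ex P (fun w => `|dY s t w| ^+ 3) <= K * h ^+ 3,
      int1 P (fun w => `|dY s t w ^+ 2 - M s t w ^+ 2|) /\
      Ex P (fun w => `|dY s t w ^+ 2 - M s t w ^+ 2|) <= K * h ^+ 3,
      L2 P (rho s t) /\ Ex P (fun w => rho s t w ^+ 2) <= K * h ^+ 3
    & forall xi c, measurable_wrt (F s) xi -> (forall w, `|xi w| <= c) ->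
      `|Ex P (fun w => xi w * rho s t w)| <= (c ^+ 2 + K) * h ^+ 3].
Proof.
have [Kd [Kd0 hKd]] := crude_increment W_bm rsY.
have [Kr [Kr0 hKr]] := remainder_bounds W_bm rsY l.
have [Kc [Kc0 hKc]] := common_bound (fun j => nice_diffusion sigma l j).
have nb := nice_drift A sigma l; have [[Kb [Kb0 hKb _]] _] := nb.
have nV := nice_variance_rate sigma l; have [[Kv [Kv0 hKv _]] _] := nV.
pose K4 := n%:R ^+ 2 * (n%:R * (n%:R * (Kc ^+ 4 * 3))) : R.
have K40 : 0 <= K4 by rewrite !(mulr_ge0, exprn_ge0).
pose Kt := 2 * (Kb ^+ 2 + Kr).
have Kt0 : 0 <= Kt by rewrite mulr_ge0 // addr_ge0 // sqr_ge0.
pose K := 2 * Kd + 2 * K4 + 2 * Kt + Kv + Kr.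
have K0 : 0 <= K by rewrite /K; lra.
exists K; split => // s h s0 h0 h1 t.
have ts : t - s = h ^+ 2 by rewrite /t addrAC subrr add0r.
have st : s < t by rewrite /t ltrDl exprn_gt0.
have h2 : h ^+ 2 <= 1 by rewrite expr_le1 // ltW.
have t1 : t <= s + 1 by rewrite /t lerD2l.
have h3_0 : 0 <= h ^+ 3 by rewrite exprn_ge0 // ltW.
have h43 : h ^+ 4 <= h ^+ 3 by rewrite [leLHS]exprS ler_piMl.
have [Lr Er Exr] := hKr s t s0 st t1.
rewrite ts in Er Exr; rewrite -exprM in Er.
have LM := main_term_L2 W_bm rsY l s0 st.
have LM2 := main_term_sq_L2 W_bm rsY l s0 st.
(* The drift together with the remainder: its second moment is of order h^4, against h^2 for the
   main term. *)
pose tau w := dY s t w - M s t w.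
have LdY : L2 P (dY s t) by apply: L2B; exact: (L2f _ (nice_coord l)).
have Ltau : L2 P tau by exact: L2B.
have Etau : Ex P (fun w => tau w ^+ 2) <= Kt * h ^+ 4.
  have Lb : L2 P (fun w => b (Y s w) * h ^+ 2).
    have := L2Z (h ^+ 2) (L2f s nb).
    by under [X in L2 P X -> _]eq_fun do rewrite mulrC.
  rewrite (_ : (fun w => _) = fun w => (b (Y s w) * h ^+ 2 + rho s t w) ^+ 2); last first.
    by apply/funext => w; rewrite /tau /remainder ts /dY; congr (_ ^+ 2); ring.
  apply: (le_trans (Ex_sqD Lb Lr)); rewrite /Kt -[leRHS]mulrA ler_wpM2l // mulrDl lerD //.
  rewrite -[leRHS](Ex_cst P); apply: Ex_le; [exact: Lb.2|exact: int1_cst|] => w.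
  rewrite exprMn -exprM ler_wpM2r ?exprn_ge0 ?(ltW h0) //.
  rewrite -(real_normK (num_real (b _))) ler_pXn2r ?nnegrE //; exact: hKb.
have EM : Ex P (fun w => M s t w ^+ 2) <= Kv * h ^+ 2.
  have m1 : measurable_wrt (F s) (fun=> 1 : R) by apply/measurable_wrtE; exact: measurable_cst.
  have b1 (w : T) : `|1| <= 1 :> R by rewrite normr1.
  have := Ex_main_term2 W_bm rsY l s0 st m1 b1.
  under eq_fun do rewrite mul1r; under [X in _ = _ * Ex P X -> _]eq_fun do rewrite mul1r.
  move=> ->; rewrite ts mulrC ler_wpM2r ?exprn_ge0 ?(ltW h0) //.
  rewrite -[leRHS](Ex_cst P); apply: Ex_le; [exact: L2_int1 (L2f s nV)|exact: int1_cst|] => w.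
  by apply: (le_trans (ler_norm _)); exact: hKv.
have EM4 : Ex P (fun w => (M s t w ^+ 2) ^+ 2) <= K4 * h ^+ 4.
  by have := Ex_main_term4 W_bm rsY s0 st hKc; rewrite ts -exprM.
have EdY : Ex P (fun w => dY s t w ^+ 2) <= Kd * h ^+ 2 by rewrite -ts; apply: hKd => //; exact: ltW.
have hne : h != 0 by rewrite gt_eqF.
split.
(* One factor |dY| is kept and the other two are bounded by 2 M^2 + 2 tau^2. The weight h balances
   |dY| M^2, and |dY| <= 1 disposes of |dY| tau^2. *)
- apply: (@le_trans _ _ (Ex P (fun w => h * dY s t w ^+ 2 + h^-1 * (M s t w ^+ 2) ^+ 2 + 2 * tau w ^+ 2))).
    apply: Ex_le.
    + apply: (int1_bdd P _ (c := 1)).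
        by apply: measurable_funX; exact: measurableT_comp.
      by move=> w; rewrite normrX normr_id expr_le1.
    + by apply: int1D; [apply: int1D; apply: int1Z|apply: int1Z]; [exact: LdY.2|exact: LM2.2|exact: Ltau.2].
    move=> w; set x := `|dY s t w|; set m := M s t w.
    have x0_ : 0 <= x by exact: normr_ge0.
    have x1 : x <= 1 by exact: dY_le1.
    have e : dY s t w = m + tau w by rewrite /tau addrC subrK.
    have x2 : x ^+ 2 <= 2 * m ^+ 2 + 2 * tau w ^+ 2.
      by rewrite real_normK ?num_real // e; exact: sqrD_le2.
    have am : 2 * (x * m ^+ 2) <= h * x ^+ 2 + h^-1 * (m ^+ 2) ^+ 2.
      exact: weighted_AGM.
    rewrite -(real_normK (num_real (dY s t w))) -/x.
    have : x * x ^+ 2 <= x * (2 * m ^+ 2) + 2 * tau w ^+ 2.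
      have t0 := sqr_ge0 (tau w).
      have : x * x ^+ 2 <= x * (2 * m ^+ 2 + 2 * tau w ^+ 2) by rewrite ler_wpM2l.
      have : x * (2 * tau w ^+ 2) <= 2 * tau w ^+ 2 by rewrite ler_piMl // mulr_ge0.
      lra.
    rewrite -exprS; lra.
  rewrite !ExD ?ExZ; try by [exact: LdY.2|exact: LM2.2|exact: Ltau.2|exact: int1Z LdY.2|exact: int1Z LM2.2|exact: int1Z Ltau.2|apply: int1D; [exact: int1Z LdY.2|exact: int1Z LM2.2]].
  apply: (@le_trans _ _ (h * (Kd * h ^+ 2) + h^-1 * (K4 * h ^+ 4) + 2 * (Kt * h ^+ 4))).
    apply: lerD; [apply: lerD|]; rewrite ler_wpM2l //; by rewrite ?invr_ge0 ltW.
  rewrite (_ : h^-1 * (K4 * h ^+ 4) = K4 * h ^+ 3); last by field.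
  rewrite (_ : h * (Kd * h ^+ 2) = Kd * h ^+ 3); last by ring.
  have : Kt * h ^+ 4 <= Kt * h ^+ 3 by rewrite ler_wpM2l.
  have := mulr_ge0 Kd0 h3_0; have := mulr_ge0 K40 h3_0; have := mulr_ge0 Kv0 h3_0.
  have := mulr_ge0 Kr0 h3_0; rewrite /K; lra.
- have id2 : int1 P (fun w => `|dY s t w ^+ 2 - M s t w ^+ 2|).
    by apply: int1_abs; apply: int1B; [exact: LdY.2|exact: LM.2].
  split => //.
  (* The difference of squares is tau^2 + 2 M tau; with weight h both h E M^2 and E tau^2 / h are of
     order h^3. *)
  apply: (@le_trans _ _ (Ex P (fun w => h * M s t w ^+ 2 + (1 + h^-1) * tau w ^+ 2))).
    apply: Ex_le => //.
      by apply: int1D; apply: int1Z; [exact: LM.2|exact: Ltau.2].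
    move=> w; set m := M s t w.
    have e : dY s t w = m + tau w by rewrite /tau addrC subrK.
    rewrite e (_ : _ - _ = tau w ^+ 2 + 2 * (m * tau w)); last by ring.
    rewrite (le_trans (ler_normD _ _)) // ger0_norm ?sqr_ge0 // normrM (ger0_norm (ler0n _ 2)).
    have am : 2 * `|m * tau w| <= h * m ^+ 2 + h^-1 * tau w ^+ 2.
      rewrite -(real_normK (num_real m)) -(real_normK (num_real (tau w))) normrM.
      exact: weighted_AGM.
    by rewrite mulrDl mul1r; lra.
  rewrite ExD; [|exact: int1Z LM.2|exact: int1Z Ltau.2].
  rewrite (ExZ h LM.2) (ExZ (1 + h^-1) Ltau.2).
  apply: (@le_trans _ _ (h * (Kv * h ^+ 2) + (1 + h^-1) * (Kt * h ^+ 4))).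
    apply: lerD; first by apply: ler_wpM2l => //; exact: ltW.
    by apply: ler_wpM2l => //; rewrite addr_ge0 // invr_ge0 ltW.
  rewrite (_ : (1 + h^-1) * (Kt * h ^+ 4) = Kt * h ^+ 4 + Kt * h ^+ 3); last by field.
  rewrite (_ : h * (Kv * h ^+ 2) = Kv * h ^+ 3); last by ring.
  have : Kt * h ^+ 4 <= Kt * h ^+ 3 by rewrite ler_wpM2l.
  have := mulr_ge0 Kd0 h3_0; have := mulr_ge0 K40 h3_0; have := mulr_ge0 Kv0 h3_0.
  have := mulr_ge0 Kr0 h3_0; rewrite /K; lra.
- split => //; apply: (le_trans Er).
  have : Kr * h ^+ 4 <= Kr * h ^+ 3 by rewrite ler_wpM2l.
  have := mulr_ge0 Kd0 h3_0; have := mulr_ge0 K40 h3_0; have := mulr_ge0 Kv0 h3_0.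
  have := mulr_ge0 Kt0 h3_0; rewrite /K; lra.
move=> xi c mxi bxi; have h3p : 0 < h ^+ 3 by rewrite exprn_gt0.
(* The weight th = h^3 turns K h^6 / th into K h^3. *)
apply: (le_trans (Exr xi c (h ^+ 3) mxi bxi h3p)); rewrite mulrDl mulrC lerD //.
rewrite -exprM (_ : (h ^+ 3)^-1 * (Kr * h ^+ (2 * 3)) = Kr * h ^+ 3); last by field.
rewrite ler_wpM2r //; rewrite /K; lra.
Qed.

End one_step_moments.

(** * Ito's formula in mean square *)

Section ito_increments_of_functions.
Context {d : measure_display} {T : measurableType d} {R : realType}.
Variable P : probability T R.
Variables (n : nat) (A : 'M[R]_n) (sigma : 'I_n -> R) (x0 : 'cV[R]_n).
Variable W : R -> T -> 'cV[R]_n.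
Hypothesis W_bm : standard_brownian_motion P W.
Variable Y : R -> T -> 'cV[R]_n.
Hypothesis rsY : regular_solution P A sigma x0 W Y.
Variable l : 'I_n.
Local Notation F := (brownian_filtration P W).
Local Notation b x := (replicator_drift A sigma x l 0).
Local Notation V x := (variance_rate sigma l x).
Local Notation M := (main_term sigma W Y l).
Local Notation rho := (remainder A sigma W Y l).
Local Notation dY s t w := (Y t w l 0 - Y s w l 0).

(** [phi1] and [phi2] stand for the first two derivatives of [phi]; the Taylor estimate below is the
    only link between the three functions. *)
Variables phi phi1 phi2 : R -> R.
Hypothesis nphi1 : nice (fun x : 'cV[R]_n => phi1 (x l 0)).
Hypothesis nphi2 : nice (fun x : 'cV[R]_n => phi2 (x l 0)).
Hypothesis mphi : simplex_measurable (fun x : 'cV[R]_n => phi (x l 0)).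
Hypothesis bphi : exists B, forall x : 'cV[R]_n, in_simplex x -> `|phi (x l 0)| <= B.
Hypothesis taylor : exists L, 0 <= L /\ forall x y, 0 <= x <= 1 -> 0 <= y <= 1 ->
  `|phi y - phi x - phi1 x * (y - x) - 2^-1 * phi2 x * (y - x) ^+ 2| <= L * `|y - x| ^+ 3.

(** The generator of the diffusion applied to x |-> phi (x_l). *)
Definition ito_generator (x : 'cV[R]_n) : R :=
  phi1 (x l 0) * b x + 2^-1 * phi2 (x l 0) * V x.

Lemma nice_ito_generator : nice ito_generator.
Proof.
apply: niceD; first by apply: niceM => //; exact: nice_drift.
apply: niceM; last exact: nice_variance_rate.
by apply: niceM => //; exact: nice_cst.
Qed.

Definition ito_defect s t w : R :=
  phi (Y t w l 0) - phi (Y s w l 0) - ito_generator (Y s w) * (t - s).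

Let sY t w : in_simplex (Y t w). Proof. by case: rsY. Qed.

Let Y01 t w : 0 <= Y t w l 0 <= 1. Proof. by case: (sY t w) => /(_ l). Qed.

Let mYf f t : simplex_measurable f -> measurable_fun setT (fun w => f (Y t w)).
Proof. by move=> mf; apply: mf => //; case: rsY => _ _ _ h _ _ i; exact: h. Qed.

Let L2f f t : nice f -> L2 P (fun w => f (Y t w)).
Proof.
move=> [[K [_ h _]] mf].
by apply: (@L2_bdd _ _ _ _ _ K) => [|w]; [exact: mYf|exact: h].
Qed.

Let Lphi t : L2 P (fun w => phi (Y t w l 0)).
Proof.
have [B hB] := bphi.
by apply: (@L2_bdd _ _ _ _ _ B) => [|w]; [exact: mYf mphi|exact: hB].
Qed.

Lemma ito_defect_measurable s t : 0 <= s -> s <= t ->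
  measurable_wrt (F t) (ito_defect s t).
Proof.
move=> s0 st; have t0 := le_trans s0 st.
apply: measurable_wrtB.
  apply: measurable_wrtB; first exact: (rs_filtration rsY mphi t0).
  by apply: (measurable_wrt_sub (filtration_mono st)); exact: (rs_filtration rsY mphi s0).
apply: measurable_wrtM; last by apply/measurable_wrtE; exact: measurable_cst.
apply: (measurable_wrt_sub (filtration_mono st)).
exact: (rs_filtration rsY nice_ito_generator.2 s0).
Qed.

Lemma ito_defect_L2 s t : L2 P (ito_defect s t).
Proof.
apply: L2B; first exact: L2B.
have := L2Z (t - s) (L2f s nice_ito_generator).
by under [X in L2 P X -> _]eq_fun do rewrite mulrC.
Qed.

Let rem s t w := phi (Y t w l 0) - phi (Y s w l 0) - phi1 (Y s w l 0) * dY s t w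
  - 2^-1 * phi2 (Y s w l 0) * dY s t w ^+ 2.

Let dY_le1 s t w : `|dY s t w| <= 1.
Proof.
have /andP[a0 a1] := Y01 s w; have /andP[c0 c1] := Y01 t w.
by rewrite ler_norml; apply/andP; split; lra.
Qed.

Let mdY s t : measurable_fun setT (fun w => dY s t w).
Proof. by apply: measurable_funB; exact: (mYf _ (nice_coord l).2). Qed.

Let LdY s t : L2 P (fun w => dY s t w).
Proof. exact: (L2_bdd P (mdY s t) (dY_le1 s t)). Qed.

Let idY3 s t : int1 P (fun w => `|dY s t w| ^+ 3).
Proof.
apply: (int1_bdd P _ (c := 1)).
  by apply: measurable_funX; apply: measurableT_comp => //; exact: mdY.
by move=> w; rewrite normrX normr_id expr_le1.
Qed.

Let Lrem s t : L2 P (rem s t).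
Proof.
apply: L2B; first apply: L2B; first exact: L2B.
  have [[K [_ h _]] mf] := nphi1.
  by apply: (L2M_bdd (mYf s mf) (c := K)) => // w; exact: h.
have [[K [_ h _]] mf] := nphi2.
have Ld2 : L2 P (fun w => dY s t w ^+ 2).
  apply: (@L2_bdd _ _ _ _ _ 1); first by apply: measurable_funX; exact: mdY.
  by move=> w; rewrite normrX expr_le1.
have := L2Z 2^-1 (L2M_bdd (mYf s mf) (fun w => h _ (sY s w)) Ld2).
by under [X in L2 P X -> _]eq_fun do rewrite mulrA.
Qed.

(** In the second-order Taylor expansion, the main term and the compensated square M^2 - h^2 V have
    mean exactly 0 against the past. What is left is controlled by the one-step moments of order
    h^3. *)
Lemma ito_defect_mean c : 0 <= c -> exists K, 0 <= K /\ forall s h xi, 0 <= s -> 0 < h ->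
  h <= 1 -> measurable_wrt (F s) xi -> (forall w, `|xi w| <= c) ->
  `|Ex P (fun w => xi w * ito_defect s (s + h ^+ 2) w)| <= K * h ^+ 3.
Proof.
move=> c0; have [K [K0 hK]] := increment_moments W_bm rsY l.
have [L [L0 hL]] := taylor.
have [[c1 [c10 hc1 _]] mf1] := nphi1; have [[c2 [c20 hc2 _]] mf2] := nphi2.
exists ((c * c1) ^+ 2 + K + 2^-1 * (c * c2 * K) + c * (L * K)); split.
  by rewrite !(mulr_ge0, addr_ge0, sqr_ge0, invr_ge0).
move=> s h xi s0 h0 h1 mxi bxi.
have [E3 [iE2 E2] [Lr Er] Exr] := hK s h s0 h0 h1.
set t := s + h ^+ 2 in E3 iE2 E2 Lr Er Exr *.
have ts : t - s = h ^+ 2 by rewrite /t addrAC subrr add0r.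
have st : s < t by rewrite /t ltrDl exprn_gt0.
have mxi' := filtration_measurable W_bm mxi.
have LM := main_term_L2 W_bm rsY l s0 st.
pose x1 w := xi w * phi1 (Y s w l 0).
pose x2 w := xi w * phi2 (Y s w l 0).
have mx1 : measurable_wrt (F s) x1 by apply: measurable_wrtM => //; exact: (rs_filtration rsY mf1 s0).
have mx2 : measurable_wrt (F s) x2 by apply: measurable_wrtM => //; exact: (rs_filtration rsY mf2 s0).
have bx1 w : `|x1 w| <= c * c1 by rewrite normrM ler_pM // hc1.
have bx2 w : `|x2 w| <= c * c2 by rewrite normrM ler_pM // hc2.
have mx1' := filtration_measurable W_bm mx1.
have mx2' := filtration_measurable W_bm mx2.
have i1 : int1 P (fun w => x1 w * M s t w) by apply: L2_int1; exact: (L2M_bdd mx1' bx1).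
have i2 : int1 P (fun w => x1 w * rho s t w) by apply: L2_int1; exact: (L2M_bdd mx1' bx1).
have iD2 : int1 P (fun w => dY s t w ^+ 2 - M s t w ^+ 2).
  by apply: int1B; [exact: (LdY s t).2|exact: LM.2].
have ib (y : T -> R) (z : T -> R) (cc : R) : measurable_fun setT y ->
    (forall w, `|y w| <= cc) -> int1 P z -> int1 P (fun w => y w * z w).
  move=> my by_ iz; apply: (int1_le _ (int1Z cc (int1_abs iz))).
    by apply: measurable_funM => //; exact: int1_meas iz.
  by move=> w; rewrite normrM ler_wpM2r.
have i3 : int1 P (fun w => x2 w * (dY s t w ^+ 2 - M s t w ^+ 2)) := ib _ _ _ mx2' bx2 iD2.
have i4 : int1 P (fun w => x2 w * M s t w ^+ 2) := ib _ _ _ mx2' bx2 LM.2.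
have i5 : int1 P (fun w => x2 w * V (Y s w)).
  by apply: (ib _ _ _ mx2' bx2); apply: L2_int1; exact: (L2f s (nice_variance_rate sigma l)).
have i6 : int1 P (fun w => xi w * rem s t w).
  by apply: (ib _ _ _ mxi' bxi); exact: L2_int1.
(* Five terms: Brownian part, Euler remainder, replacement of dY^2 by M^2, replacement of M^2 by h^2
   V, and Taylor remainder. *)
rewrite (_ : (fun w => _) = fun w => x1 w * M s t w + x1 w * rho s t w
   + 2^-1 * (x2 w * (dY s t w ^+ 2 - M s t w ^+ 2))
   + 2^-1 * (x2 w * M s t w ^+ 2 - h ^+ 2 * (x2 w * V (Y s w))) + xi w * rem s t w); last first.
  apply/funext => w; rewrite /x1 /x2 /rem /remainder /ito_defect /ito_generator ts; ring.
have j2 := int1Z 2^-1 i3.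
have j3 := int1Z 2^-1 (int1B i4 (int1Z (h ^+ 2) i5)).
rewrite (ExD (int1D (int1D (int1D i1 i2) j2) j3) i6) (ExD (int1D (int1D i1 i2) j2) j3).
rewrite (ExD (int1D i1 i2) j2) (ExD i1 i2).
rewrite (ExZ 2^-1 i3) (ExZ 2^-1 (int1B i4 (int1Z (h ^+ 2) i5))) (ExB i4 (int1Z (h ^+ 2) i5)).
rewrite (ExZ (h ^+ 2) i5) (Ex_main_term W_bm rsY l s0 st mx1 bx1) add0r.
rewrite (Ex_main_term2 W_bm rsY l s0 st mx2 bx2) ts subrr mulr0 addr0.
rewrite !mulrDl; apply: (le_trans (ler_normD _ _)); apply: lerD.
  apply: (le_trans (ler_normD _ _)); apply: lerD; first by rewrite -mulrDl; exact: Exr.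
  rewrite normrM ger0_norm ?invr_ge0 // -[leRHS]mulrA ler_wpM2l ?invr_ge0 //.
  apply: (@le_trans _ _ (Ex P (fun w => c * c2 * `|dY s t w ^+ 2 - M s t w ^+ 2|))).
    apply: Ex_abs_le => //; first exact: int1Z.
    by move=> w; rewrite normrM ler_wpM2r.
  by rewrite ExZ // -[leRHS]mulrA ler_wpM2l // mulr_ge0.
apply: (@le_trans _ _ (Ex P (fun w => c * L * `|dY s t w| ^+ 3))).
  apply: Ex_abs_le => //; first by apply: int1Z; exact: idY3.
  move=> w; rewrite normrM -mulrA ler_pM //; exact: hL.
rewrite (ExZ (c * L) (idY3 s t)).
by rewrite -!mulrA ler_wpM2l // ler_wpM2l.
Qed.

(** Only phi1 M is of order h in mean square. The hypothesis bounds the product of phi1^2 and the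
    variance rate, not each factor, so that [kappa] can stay fixed when phi1 becomes large near the
    boundary; the constant [K] may depend on phi. *)
Lemma ito_defect_sq kappa :
  (forall x : 'cV[R]_n, in_simplex x -> phi1 (x l 0) ^+ 2 * V x <= kappa) ->
  exists K, 0 <= K /\ forall s h, 0 <= s -> 0 < h -> h <= 1 ->
  Ex P (fun w => ito_defect s (s + h ^+ 2) w ^+ 2) <= 2 * kappa * h ^+ 2 + K * h ^+ 3.
Proof.
move=> hkappa; have [K [K0 hK]] := increment_moments W_bm rsY l.
have [L [L0 hL]] := taylor.
have [[c1 [c10 hc1 _]] mf1] := nphi1; have [[c2 [c20 hc2 _]] mf2] := nphi2.
have [[c3 [c30 hc3 _]] mf3] := nice_variance_rate sigma l.
exists (6 * (c1 ^+ 2 * K + c2 ^+ 2 * (K + c3 ^+ 2) + L ^+ 2 * K)); split.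
  by rewrite !(mulr_ge0, addr_ge0, sqr_ge0).
move=> s h s0 h0 h1.
have [E3 _ [Lr Er] _] := hK s h s0 h0 h1.
set t := s + h ^+ 2 in E3 Lr Er *.
have ts : t - s = h ^+ 2 by rewrite /t addrAC subrr add0r.
have st : s < t by rewrite /t ltrDl exprn_gt0.
have LM := main_term_L2 W_bm rsY l s0 st.
have m1 : measurable_wrt (F s) (fun w => phi1 (Y s w l 0) ^+ 2).
  rewrite (_ : (fun w => _) = fun w => phi1 (Y s w l 0) * phi1 (Y s w l 0)).
    by apply: measurable_wrtM; exact: (rs_filtration rsY mf1 s0).
  by apply/funext => w; rewrite expr2.
have b1 w : `|phi1 (Y s w l 0) ^+ 2| <= c1 ^+ 2.
  by rewrite normrX ler_pXn2r ?nnegrE // hc1.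
have i1 : int1 P (fun w => phi1 (Y s w l 0) ^+ 2 * M s t w ^+ 2).
  apply: (int1_le _ (int1Z (c1 ^+ 2) LM.2)).
    apply: measurable_funM; first exact (filtration_measurable W_bm m1).
    by apply: measurable_funX; case: LM.
  by move=> w; rewrite normrM (ger0_norm (sqr_ge0 (M s t w))) ler_wpM2r ?sqr_ge0.
have E1 : Ex P (fun w => phi1 (Y s w l 0) ^+ 2 * M s t w ^+ 2) <= kappa * h ^+ 2.
  rewrite (Ex_main_term2 W_bm rsY l s0 st m1 b1) ts mulrC ler_wpM2r ?sqr_ge0 //.
  rewrite -[leRHS](Ex_cst P); apply: Ex_le; last by move=> w; exact: hkappa.
    apply: (int1_bdd P _ (c := c1 ^+ 2 * c3)).
      apply: measurable_funM; first exact (filtration_measurable W_bm m1).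
      exact: mYf mf3.
    by move=> w; rewrite normrM ler_pM // hc3.
  exact: int1_cst.
have h43 : h ^+ 4 <= h ^+ 3.
  by rewrite [leLHS]exprS ler_piMl // exprn_ge0 // ltW.
pose B w := c1 ^+ 2 * rho s t w ^+ 2 + (c2 ^+ 2 + L ^+ 2) * `|dY s t w| ^+ 3
            + c2 ^+ 2 * c3 ^+ 2 * h ^+ 4.
have iB12 : int1 P (fun w => c1 ^+ 2 * rho s t w ^+ 2 + (c2 ^+ 2 + L ^+ 2) * `|dY s t w| ^+ 3).
  by apply: int1D; apply: int1Z; [exact: Lr.2|exact: idY3].
have iB : int1 P B by apply: int1D => //; exact: int1_cst.
apply: (@le_trans _ _ (Ex P (fun w => 2 * (phi1 (Y s w l 0) ^+ 2 * M s t w ^+ 2) + 6 * B w))).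
  apply: Ex_le; first exact: (ito_defect_L2 s t).2.
    by apply: int1D; exact: int1Z.
  move=> w; rewrite /B.
  have := hc1 _ (sY s w); have := hc2 _ (sY s w); have := hc3 _ (sY s w).
  have := hL _ _ (Y01 s w) (Y01 t w); rewrite -/(rem s t w).
  have e : ito_defect s t w = phi1 (Y s w l 0) * M s t w + (phi1 (Y s w l 0) * rho s t w
     + 2^-1 * phi2 (Y s w l 0) * (dY s t w ^+ 2 - V (Y s w) * h ^+ 2) + rem s t w).
    by rewrite /rem /remainder /ito_defect /ito_generator ts; ring.
  rewrite e.
  set p1 := phi1 _; set p2 := phi2 _; set v := V _; set m := M _ _ _.
  set r := rho _ _ _; set q := rem _ _ _.
  (* Since |dY| <= 1, the fourth and sixth powers are dominated by the third absolute moment. *)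
  have dd : (dY s t w ^+ 2) ^+ 2 <= `|dY s t w| ^+ 3.
    rewrite -exprM -[X in X <= _](ger0_norm (exprn_even_ge0 _ _)) // normrX.
    by rewrite [leLHS]exprS ler_piMl // exprn_ge0.
  have d6 : (`|dY s t w| ^+ 3) ^+ 2 <= `|dY s t w| ^+ 3.
    by rewrite expr2 ler_piMl ?exprn_ge0 // exprn_ile1.
  set x := `|dY s t w| ^+ 3 in dd d6 *.
  set y := dY s t w ^+ 2 in dd *.
  move=> hq hv hp2 hp1.
  have sq_le (a c : R) : `|a| <= c -> a ^+ 2 <= c ^+ 2.
    move=> ac; rewrite -(real_normK (num_real a)) ler_pXn2r ?nnegrE //.
    exact: le_trans ac.
  have {}hq : q ^+ 2 <= L ^+ 2 * x.
    by apply: (le_trans (sq_le _ _ hq)); rewrite exprMn ler_wpM2l ?sqr_ge0.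
  have r1 : (p1 * r) ^+ 2 <= c1 ^+ 2 * r ^+ 2.
    by rewrite exprMn ler_wpM2r ?sqr_ge0 // sq_le.
  have r2 : (2^-1 * p2 * (y - v * h ^+ 2)) ^+ 2 <= c2 ^+ 2 * x + c2 ^+ 2 * c3 ^+ 2 * h ^+ 4.
    have vh : (v * h ^+ 2) ^+ 2 <= c3 ^+ 2 * h ^+ 4.
      by rewrite exprMn -exprM ler_wpM2r ?sq_le // exprn_ge0 // ltW.
    have yv : (y - v * h ^+ 2) ^+ 2 <= 2 * (x + c3 ^+ 2 * h ^+ 4).
      by apply: (le_trans (sqrB_le2 _ _)); rewrite [leRHS]mulrDr lerD // ler_wpM2l.
    have -> : c2 ^+ 2 * x + c2 ^+ 2 * c3 ^+ 2 * h ^+ 4 = c2 ^+ 2 * (x + c3 ^+ 2 * h ^+ 4).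
      by rewrite mulrDr mulrA.
    rewrite -[2^-1 * p2 * _]mulrA !exprMn.
    apply: (@le_trans _ _ (2^-1 ^+ 2 * (c2 ^+ 2 * (2 * (x + c3 ^+ 2 * h ^+ 4))))).
      by rewrite ler_wpM2l ?sqr_ge0 // ler_pM ?sqr_ge0 // sq_le.
    have : 0 <= c2 ^+ 2 * (x + c3 ^+ 2 * h ^+ 4).
      by rewrite mulr_ge0 ?sqr_ge0 // (le_trans _ (_ : (v * h ^+ 2) ^+ 2 <= _)) ?sqr_ge0 // (le_trans vh) // lerDr exprn_ge0.
    set z := c2 ^+ 2 * (x + _).
    rewrite (_ : 2^-1 ^+ 2 * _ = 2^-1 * z); last by rewrite /z; field.
    lra.
  set u1 := p1 * r in r1 *; set u2 := 2^-1 * _ * _ in r2 *.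
  have s1 : (p1 * m + (u1 + u2 + q)) ^+ 2 <= 2 * (p1 * m) ^+ 2 + 2 * (u1 + u2 + q) ^+ 2.
    exact: sqrD_le2.
  have s2 : (u1 + u2 + q) ^+ 2 <= 3 * (u1 ^+ 2 + u2 ^+ 2 + q ^+ 2).
    exact: sqrD_le3.
  rewrite exprMn in s1.
  rewrite (mulrDl (c2 ^+ 2)).
  by move: s1 s2 r1 r2 hq; lra.
rewrite (ExD (int1Z 2 i1) (int1Z 6 iB)) (ExZ 2 i1) (ExZ 6 iB).
rewrite (ExD iB12 (int1_cst P _)) Ex_cst (ExD (int1Z _ Lr.2) (int1Z _ (idY3 s t))).
rewrite (ExZ _ Lr.2) (ExZ _ (idY3 s t)).
have k1 : c1 ^+ 2 * Ex P (fun w => rho s t w ^+ 2) <= c1 ^+ 2 * (K * h ^+ 3).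
  by rewrite ler_wpM2l ?sqr_ge0.
have k2 : (c2 ^+ 2 + L ^+ 2) * Ex P (fun w => `|dY s t w| ^+ 3) <= (c2 ^+ 2 + L ^+ 2) * (K * h ^+ 3).
  by rewrite ler_wpM2l // addr_ge0 // sqr_ge0.
have k3 : c2 ^+ 2 * c3 ^+ 2 * h ^+ 4 <= c2 ^+ 2 * c3 ^+ 2 * h ^+ 3.
  by rewrite ler_wpM2l // mulr_ge0 // sqr_ge0.
by move: E1 k1 k2 k3; lra.
Qed.

End ito_increments_of_functions.

(** * Summation of the one-step defects over a partition *)

Section ito_formula.
Context {d : measure_display} {T : measurableType d} {R : realType}.
Variable P : probability T R.
Variables (n : nat) (A : 'M[R]_n) (sigma : 'I_n -> R) (x0 : 'cV[R]_n).
Variable W : R -> T -> 'cV[R]_n.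
Hypothesis W_bm : standard_brownian_motion P W.
Variable Y : R -> T -> 'cV[R]_n.
Hypothesis rsY : regular_solution P A sigma x0 W Y.
Variable l : 'I_n.
Local Notation F := (brownian_filtration P W).

Variables phi phi1 phi2 : R -> R.
Hypothesis nphi1 : nice (fun x : 'cV[R]_n => phi1 (x l 0)).
Hypothesis nphi2 : nice (fun x : 'cV[R]_n => phi2 (x l 0)).
Hypothesis mphi : simplex_measurable (fun x : 'cV[R]_n => phi (x l 0)).
Hypothesis bphi : exists B, forall x : 'cV[R]_n, in_simplex x -> `|phi (x l 0)| <= B.
Hypothesis taylor : exists L, 0 <= L /\ forall x y, 0 <= x <= 1 -> 0 <= y <= 1 ->
  `|phi y - phi x - phi1 x * (y - x) - 2^-1 * phi2 x * (y - x) ^+ 2| <= L * `|y - x| ^+ 3.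

Local Notation g := (ito_generator A sigma l phi1 phi2).
Let ng : nice g. Proof. exact: nice_ito_generator. Qed.
Let sY t w : in_simplex (Y t w). Proof. by case: rsY. Qed.

Let riemann_error s t w := timeint s t (fun r => g (Y r w) - g (Y s w)).

Let riemann_error_sq : exists K, 0 <= K /\ forall s h, 0 <= s -> 0 < h -> h <= 1 ->
  L2 P (riemann_error s (s + h ^+ 2)) /\
  Ex P (fun w => riemann_error s (s + h ^+ 2) w ^+ 2) <= K * h ^+ 6.
Proof.
have [K [K0 hK]] := nice_sq_norm W_bm rsY ng.
have [[L [L0 bg _]] mg] := ng.
exists K; split => // s h s0 h0 h1.
have sh : s <= s + h ^+ 2 by rewrite lerDl sqr_ge0.
have h21 : h ^+ 2 <= 1 by rewrite exprn_ile1 // ltW.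
have hS := hK s (s + h ^+ 2) s0 sh; rewrite lerD2l in hS.
have es : s + h ^+ 2 - s = h ^+ 2 by rewrite (addrC s) addrK.
have {}hS := hS h21; rewrite es in hS.
have jm : jointly_measurable (fun r w => g (Y r w) - g (Y s w)).
  apply: measurable_funB; first exact: (rs_jointly_measurable rsY ng).
  apply: (measurableT_comp (f := fun w => g (Y s w))) => //.
  by apply: mg => // i; case: rsY => _ _ _ mY _ _; exact: mY.
have bd r w : `|g (Y r w) - g (Y s w)| <= L + L.
  by apply: (le_trans (ler_normB _ _)); apply: lerD; exact: bg.
have [L2e E] := Ex_timeint_sq jm bd sh hS.
split; first exact: L2e.
by apply: (le_trans E); rewrite es mulrCA -exprM -exprD.
Qed.

(** The error is the sum of the defects minus the Riemann-sum error of the generator. The defects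
    give 2 kappa t, the Riemann error tends to 0, and separating the two costs another factor 2. *)
Lemma ito_formula_sq kappa t : 0 < t ->
  (forall x : 'cV[R]_n, in_simplex x -> phi1 (x l 0) ^+ 2 * variance_rate sigma l x <= kappa) ->
  L2 P (fun w => phi (Y t w l 0) - phi (x0 l 0) - timeint 0 t (fun r => g (Y r w))) /\
  Ex P (fun w => (phi (Y t w l 0) - phi (x0 l 0) - timeint 0 t (fun r => g (Y r w))) ^+ 2)
    <= 4 * kappa * t.
Proof.
move=> t0 hkappa.
have [K1 [K10 hK1]] := ito_defect_sq W_bm rsY nphi1 nphi2 mphi bphi taylor hkappa.
have [B hB] := bphi; have [[L [L0 bg _]] mg] := ng.
have B0 : 0 <= B by apply: le_trans (hB _ (sY 0 point)); exact: normr_ge0.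
(* A bound on all partial sums of defects, valid for every partition; it is needed to apply the mean
   estimate to the partial sums themselves. *)
pose c := B + B + L * t.
have c0 : 0 <= c by rewrite !addr_ge0 // mulr_ge0 // ltW.
have [K2 [K20 hK2]] := ito_defect_mean W_bm rsY nphi1 nphi2 mphi bphi taylor c0.
have [K3 [K30 hK3]] := riemann_error_sq.
pose Z w := phi (Y t w l 0) - phi (x0 l 0) - timeint 0 t (fun r => g (Y r w)).
have key h N : 0 < h -> h <= 1 -> N%:R * h ^+ 2 = t ->
  L2 P Z /\ Ex P (fun w => Z w ^+ 2) <=
    4 * kappa * t + (2 * (K1 + 2 * K2) * t + 2 * (K3 * t ^+ 2)) * h.
  move=> h0 h1 Nh.
  pose tau k : R := k%:R * h ^+ 2.
  have tau0 k : 0 <= tau k by rewrite mulr_ge0 // sqr_ge0.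
  have tauS k : tau k.+1 = tau k + h ^+ 2 by rewrite /tau -natr1 mulrDl mul1r.
  have tauN : tau N = t by [].
  have tau_mono i j : (i <= j)%N -> tau i <= tau j.
    by move=> ij; rewrite ler_wpM2r ?sqr_ge0 // ler_nat.
  pose D k := ito_defect A sigma Y l phi phi1 phi2 (tau k) (tau k.+1).
  pose S k w := \sum_(i < k) D i w.
  pose Q k w := \sum_(i < k) riemann_error (tau i) (tau i.+1) w.
  have LD k : L2 P (D k) by exact: (ito_defect_L2 rsY nphi1 nphi2 mphi bphi).
  have LS k : L2 P (S k) by exact: L2_sum.
  (* The increments of phi telescope, which makes the partial sum bounded however fine the partition
     is. *)
  have SE k w : S k w = phi (Y (tau k) w l 0) - phi (x0 l 0)
      - \sum_(i < k) g (Y (tau i) w) * h ^+ 2.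
    elim: k => [|k ih].
      by rewrite /S !big_ord0 subr0 /tau mul0r; case: rsY => _ _ _ _ -> _; rewrite subrr.
    rewrite /S big_ord_recr /= -/(S k w) ih big_ord_recr /= /D /ito_defect tauS.
    rewrite (addrC (tau k)) addrK; ring.
  have bS k w : (k <= N)%N -> `|S k w| <= c.
    move=> kN; rewrite SE; apply: (le_trans (ler_normB _ _)); apply: lerD.
      apply: (le_trans (ler_normB _ _)); apply: lerD; first exact: hB.
      by have := hB _ (sY 0 w); case: rsY => _ _ _ _ -> _.
    apply: (@le_trans _ _ (\sum_(i < k) L * h ^+ 2)).
      apply: (le_trans (ler_norm_sum _ _ _)); apply: ler_sum => i _.
      by rewrite normrM (ger0_norm (sqr_ge0 h)) ler_wpM2r ?sqr_ge0 // bg.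
    rewrite sumr_const card_ord -[_ *+ k]mulr_natl mulrCA ler_wpM2l // -tauN.
    exact: tau_mono.
  have mS k : measurable_wrt (F (tau k)) (S k).
    elim: k => [|k ih].
      rewrite (_ : S 0%N = fun=> 0); first by apply/measurable_wrtE; exact: measurable_cst.
      by apply/funext => w; rewrite /S big_ord0.
    rewrite (_ : S k.+1 = fun w => S k w - - D k w); last first.
      by apply/funext => w; rewrite /S big_ord_recr /= opprK.
    apply: measurable_wrtB.
      by apply: (measurable_wrt_sub (filtration_mono (tau_mono k k.+1 (leqnSn k)))).
    rewrite (_ : (fun w => - D k w) = fun w => 0 - D k w); last by apply/funext => w; rewrite sub0r.
    apply: measurable_wrtB; first by apply/measurable_wrtE; exact: measurable_cst.
    by apply: (ito_defect_measurable rsY nphi1 nphi2 mphi) => //; exact: tau_mono.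
  have ES k : (k <= N)%N ->
      Ex P (fun w => S k w ^+ 2) <= k%:R * (2 * kappa * h ^+ 2 + (K1 + 2 * K2) * h ^+ 3).
    elim: k => [_|k ih kN].
      by rewrite mul0r (_ : (fun w => _) = fun=> 0) ?Ex_cst //; apply/funext => w; rewrite /S big_ord0 expr0n.
    have {}ih := ih (ltnW kN).
    have iSD := L2_mul (LS k) (LD k).
    (* In the cross term the partial sum is known at time [tau k] and the next defect has small
       conditional mean, so each step adds only 2 kappa h^2 plus terms of order h^3. *)
    rewrite (_ : (fun w => _) = fun w => S k w ^+ 2 + 2 * (S k w * D k w) + D k w ^+ 2); last first.
      by apply/funext => w; rewrite /S big_ord_recr /=; ring.
    rewrite (ExD (int1D (LS k).2 (int1Z 2 iSD)) (LD k).2) (ExD (LS k).2 (int1Z 2 iSD)) (ExZ 2 iSD).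
    have e1 := hK2 (tau k) h (S k) (tau0 k) h0 h1 (mS k) (fun w => bS k w (ltnW kN)).
    have e2 := hK1 (tau k) h (tau0 k) h0 h1.
    rewrite -tauS -/(D k) in e1 e2.
    have {}e1 := le_trans (ler_norm _) e1.
    rewrite -natr1; move: ih e1 e2; lra.
  have LR k : L2 P (riemann_error (tau k) (tau k.+1)).
    by rewrite tauS; case: (hK3 (tau k) h (tau0 k) h0 h1).
  have ER k : Ex P (fun w => riemann_error (tau k) (tau k.+1) w ^+ 2) <= K3 * h ^+ 6.
    by rewrite tauS; case: (hK3 (tau k) h (tau0 k) h0 h1).
  have LQ : L2 P (Q N) by exact: L2_sum.
  have EQ : Ex P (fun w => Q N w ^+ 2) <= K3 * t ^+ 2 * h ^+ 2.
    apply: (le_trans (Ex_sq_sum _)) => //.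
    apply: (@le_trans _ _ (N%:R * \sum_(i < N) K3 * h ^+ 6)).
      by rewrite ler_wpM2l //; apply: ler_sum.
    rewrite sumr_const card_ord -[_ *+ N]mulr_natl -Nh le_eqVlt; apply/orP; left; apply/eqP; ring.
  have QE w k : timeint 0 (tau k) (fun r => g (Y r w)) =
      Q k w + \sum_(i < k) g (Y (tau i) w) * h ^+ 2.
    have mgY := jointly_measurable_section w (rs_jointly_measurable rsY ng).
    have bgY r : `|g (Y r w)| <= L by exact: bg.
    elim: k => [|k ih].
      by rewrite /Q !big_ord0 /tau mul0r addr0 /timeint set_itv1 Rintegral_set1.
    rewrite (timeint_split mgY bgY (tau0 k) (tau_mono k k.+1 (leqnSn k))) ih.
    rewrite /Q !big_ord_recr /= /riemann_error.
    rewrite (timeintB (K := L) _ _ mgY (measurable_cst _) bgY (fun=> bgY (tau k))).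
    rewrite timeint_cst ?tau_mono // tauS (addrC (tau k)) addrK; ring.
  have ZE w : Z w = S N w - Q N w.
    by rewrite SE tauN /Z -[in timeint _ _]tauN QE; ring.
  have LZ : L2 P Z by rewrite (_ : Z = fun w => S N w - Q N w); [exact: L2B|exact/funext].
  split => //.
  under eq_fun do rewrite ZE.
  have := Ex_sqD (LS N) (L2N LQ).
  under [X in _ <= _ * (_ + Ex P X) -> _]eq_fun do rewrite sqrrN.
  have := ES N (leqnn N).
  have e3 : N%:R * (2 * kappa * h ^+ 2 + (K1 + 2 * K2) * h ^+ 3) =
     2 * kappa * t + (K1 + 2 * K2) * t * h by rewrite -Nh; ring.
  have e4 : K3 * t ^+ 2 * h ^+ 2 <= K3 * t ^+ 2 * h.
    apply: ler_wpM2l; first by rewrite mulr_ge0 // sqr_ge0.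
    by rewrite exprS expr1 ler_piMl // ltW.
  rewrite e3; move: EQ e4; set e := Ex P _; set e' := Ex P (fun w => S N w ^+ 2); lra.
pose C := 2 * (K1 + 2 * K2) * t + 2 * (K3 * t ^+ 2).
have C0 : 0 <= C by rewrite !(addr_ge0, mulr_ge0, sqr_ge0) // ltW.
(* The number of steps N exceeds t / de^2, and h is the square root of t / N. *)
have mesh de : 0 < de -> exists N h, [/\ 0 < h, h <= de & N%:R * h ^+ 2 = t].
  move=> de0; exists (Num.bound (t / de ^+ 2)), (Num.sqrt (t / (Num.bound (t / de ^+ 2))%:R)).
  have := archi_boundP (divr_ge0 (ltW t0) (sqr_ge0 de)).
  set N := Num.bound _ => tN.
  split; first by rewrite sqrtr_gt0 divr_gt0.
    rewrite -(ger0_norm (ltW de0)) -sqrtr_sqr ler_sqrt ?sqr_ge0 //.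
    rewrite ler_pdivrMr // mulrC -ler_pdivrMr ?exprn_gt0 //; exact: ltW.
  by rewrite sqr_sqrtr ?divr_ge0 // ?ltW // mulrC divfK // gt_eqF.
have [N [h [h0 h1 Nh]]] := mesh 1 ltr01.
have [LZ _] := key h N h0 h1 Nh; split => //.
apply/ler_addgt0Pr => e e0.
have de0 : 0 < Num.min 1 (e / (C + 1)) by rewrite lt_min ltr01 divr_gt0 // ltr_wpDl.
have [N' [h' [h0' h1' Nh']]] := mesh _ de0.
move: h1'; rewrite le_min => /andP[h1' he].
have [_ h_] := key h' N' h0' h1' Nh'.
apply: (le_trans h_); rewrite -/C lerD2l.
have C1 : 0 < C + 1 by rewrite ltr_wpDl.
rewrite ler_pdivlMr // in he.
by apply: le_trans he; rewrite mulrDr mulr1 mulrC lerDl ltW.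
Qed.

End ito_formula.

(** * The logarithm of a coordinate *)

Section log_taylor.
Context {R : realType}.
Implicit Types a z m : R.

(** The derivative of the Taylor remainder f in its variable is exactly (y - a)^2 / (a^2 y), so a
    single use of the mean value theorem gives the cubic bound with constant m^-3. *)
Lemma ln_taylor2 m a z : 0 < m -> m <= a -> m <= z ->
  `|ln z - ln a - a^-1 * (z - a) - 2^-1 * (- a^-1 ^+ 2) * (z - a) ^+ 2|
    <= m^-1 ^+ 3 * `|z - a| ^+ 3.
Proof.
move=> m0 ma mz; have a0 : 0 < a by exact: lt_le_trans ma.
pose f (y : R) : R := ln y - ln a - a^-1 * (y - a) - 2^-1 * (- a^-1 ^+ 2) * (y - a) ^+ 2.
pose f' (y : R) : R := (y - a) ^+ 2 * a^-1 ^+ 2 * y^-1.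
have df (y : R) : 0 < y -> is_derive y 1 f (f' y).
  move=> y0; have dln := is_derive1_ln y0.
  rewrite /f; apply: is_derive_eq.
  rewrite /f' !subr0 /GRing.scale /= !mulr1.
  by field; rewrite !gt_eqF.
have fa : f a = 0 by rewrite /f !subrr expr0n /= !mulr0 !subr0.
have bf' (y : R) : m <= y -> `|y - a| <= `|z - a| -> `|f' y| <= m^-1 ^+ 3 * `|z - a| ^+ 2.
  move=> my yz; have y0 : 0 < y by exact: lt_le_trans my.
  have im : a^-1 <= m^-1 by rewrite lef_pV2 ?posrE.
  have iy : y^-1 <= m^-1 by rewrite lef_pV2 ?posrE.
  have ia0 : 0 <= a^-1 by rewrite invr_ge0 ltW.
  have iy0 : 0 <= y^-1 by rewrite invr_ge0 ltW.
  have im0 : 0 <= m^-1 by rewrite invr_ge0 ltW.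
  rewrite /f' 2!normrM normrX [`|a^-1 ^+ 2|]ger0_norm ?sqr_ge0 // (ger0_norm iy0).
  rewrite -mulrA mulrC [m^-1 ^+ 3]exprSr ler_pM ?mulr_ge0 ?sqr_ge0 //.
    by rewrite ler_pM ?sqr_ge0 // ler_pXn2r ?nnegrE.
  by rewrite ler_pXn2r ?nnegrE.
have mvt u v : m <= u -> u <= v ->
    exists2 c, c \in `[u, v]%R & f v - f u = f' c * (v - u).
  move=> mu uv; have pos y : u <= y -> 0 < y by move=> uy; apply: lt_le_trans uy; exact: lt_le_trans mu.
  apply: MVT_segment => //.
    by move=> y; rewrite in_itv /= => /andP[/ltW uy _]; exact: df (pos y uy).
  apply: derivable_within_continuous => y; rewrite in_itv /= => /andP[uy _].
  by have dfy := df y (pos y uy); exact: (@ex_derive _ _ _ _ _ _ _ dfy).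
rewrite -[X in `|X| <= _]/(f z) [`|z - a| ^+ 3]exprSr mulrA.
have [az|/ltW za] := leP a z.
  have [c] := mvt a z ma az; rewrite in_itv /= fa subr0 => /andP[ac cz] ->.
  rewrite [`|f' c * _|]normrM; apply: ler_wpM2r => //; apply: bf'; first exact: le_trans ac.
  by rewrite !ger0_norm ?subr_ge0 // lerD2r.
have [c] := mvt z a mz za; rewrite in_itv /= fa sub0r => /andP[zc ca] e.
rewrite -normrN e [`|f' c * _|]normrM (distrC a z); apply: ler_wpM2r => //; apply: bf'; first exact: le_trans zc.
by rewrite !ler0_norm ?subr_le0 // lerN2 lerD2r.
Qed.

End log_taylor.

Section replicator_log_coordinates.
Context {R : realType} (n : nat) (A : 'M[R]_n) (sigma : 'I_n -> R) (l : 'I_n).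
Implicit Type x : 'cV[R]_n.
Local Notation B := (A - diag_mx (\row_i sigma i ^+ 2)).

(** The drift and the variance rate of the l-th coordinate contain the factors x_l and x_l^2; this
    is the first cofactor and [relative_variance] the second. *)
Definition relative_fitness x : R := (B *m x) l 0 - \sum_k x k 0 * (B *m x) k 0.

Definition relative_variance x : R := \sum_j (((l == j)%:R - x j 0) * sigma j) ^+ 2.

Definition log_growth x : R := relative_fitness x - 2^-1 * relative_variance x.

Let op_factor x k : replicator_op x l k = x l 0 * ((l == k)%:R - x k 0).
Proof.
rewrite !mxE big_ord1 !mxE mulrBr; congr (_ - _).
by case: eqP => [->|_]; rewrite ?mulr1 ?mulr0.
Qed.

Lemma replicator_drift_factor x : replicator_drift A sigma x l 0 = x l 0 * relative_fitness x.
Proof.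
rewrite /replicator_drift -mulmxA mxE.
under eq_bigr do rewrite op_factor -mulrA.
rewrite -mulr_sumr; congr (_ * _).
under eq_bigr do rewrite mulrBl.
rewrite sumrB; congr (_ - _).
rewrite (bigD1 l) //= eqxx mul1r big1 ?addr0 // => i /negPf il.
by rewrite eq_sym il mul0r.
Qed.

Lemma variance_rate_factor x : variance_rate sigma l x = x l 0 ^+ 2 * relative_variance x.
Proof.
rewrite /variance_rate /relative_variance mulr_sumr; apply: eq_bigr => j _.
rewrite -exprMn; congr (_ ^+ 2).
rewrite mxE (bigD1 j) //= big1 => [|k /negPf kj]; last by rewrite !mxE kj mulr0n mulr0.
by rewrite addr0 op_factor !mxE eqxx mulr1n mulrA.
Qed.

Lemma nice_relative_fitness : nice relative_fitness.
Proof.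
have nB k : nice (fun x => (B *m x) k 0).
  by apply: nice_mulmx => i j; [exact: nice_cst|rewrite ord1; exact: nice_coord].
by apply: niceB => //; apply: nice_sum => k; apply: niceM => //; exact: nice_coord.
Qed.

Lemma nice_relative_variance : nice relative_variance.
Proof.
apply: nice_sum => j.
pose u x := ((l == j)%:R - x j 0) * sigma j.
have nu : nice u by apply: niceM; [apply: niceB; [exact: nice_cst|exact: nice_coord]|exact: nice_cst].
by apply: (niceM (f := u) (g := u)).
Qed.

Lemma nice_log_growth : nice log_growth.
Proof.
apply: niceB; first exact: nice_relative_fitness.
by apply: niceM; [exact: nice_cst|exact: nice_relative_variance].
Qed.

Local Notation At := (modified_payoff A sigma).

(* Written as a homogeneous quadratic form, so that its time averages only
   involve those of the products x_i x_j. *)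
Lemma log_growthE x : in_simplex x ->
  log_growth x = \sum_i \sum_j At l i * (x i 0 * x j 0)
    - (\sum_i \sum_j At i j * (x i 0 * x j 0)
       + 2^-1 * \sum_j sigma j ^+ 2 * (\sum_i x j 0 * x i 0 - x j 0 * x j 0)).
Proof.
move=> [_ x1]; rewrite /log_growth /relative_fitness /relative_variance.
have Bx k : (B *m x) k 0 = \sum_j A k j * x j 0 - sigma k ^+ 2 * x k 0.
  rewrite mulmxBl !mxE; congr (_ - _).
  rewrite (bigD1 k) //= big1 => [|j /negPf kj]; last by rewrite !mxE eq_sym kj mulr0n mul0r.
  by rewrite addr0 !mxE eqxx mulr1n.
have e1 k : \sum_i x k 0 * x i 0 = x k 0 by rewrite -mulr_sumr x1 mulr1.
have e2 : \sum_i \sum_j At l i * (x i 0 * x j 0) = \sum_i A l i * x i 0 - 2^-1 * sigma l ^+ 2.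
  under eq_bigr do rewrite -mulr_sumr e1 mxE mulrBl.
  by rewrite sumrB -mulr_sumr x1 mulr1.
have e3 : \sum_i \sum_j At i j * (x i 0 * x j 0) =
    \sum_i \sum_j x i 0 * (A i j * x j 0) - 2^-1 * \sum_j sigma j ^+ 2 * x j 0.
  rewrite mulr_sumr -sumrB; apply: eq_bigr => i _.
  rewrite -[X in _ - 2^-1 * (_ * X)]e1 !mulr_sumr -sumrB.
  by apply: eq_bigr => j _; rewrite mxE; ring.
have e4 : \sum_j (((l == j)%:R - x j 0) * sigma j) ^+ 2 =
    sigma l ^+ 2 - 2 * (sigma l ^+ 2 * x l 0) + \sum_j sigma j ^+ 2 * (x j 0 * x j 0).
  rewrite (bigD1 l) //= [in RHS](bigD1 l) //= eqxx mulr1n addrA; congr (_ + _); first by ring.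
  by apply: eq_bigr => j /negPf jl; rewrite eq_sym jl sub0r mulNr sqrrN exprMn; ring.
have e5 : \sum_k x k 0 * (B *m x) k 0 =
    \sum_i \sum_j x i 0 * (A i j * x j 0) - \sum_j sigma j ^+ 2 * (x j 0 * x j 0).
  by rewrite -sumrB; apply: eq_bigr => i _; rewrite Bx -mulr_sumr; ring.
have e6 : \sum_j sigma j ^+ 2 * (\sum_i x j 0 * x i 0 - x j 0 * x j 0) =
    \sum_j sigma j ^+ 2 * x j 0 - \sum_j sigma j ^+ 2 * (x j 0 * x j 0).
  by rewrite -sumrB; apply: eq_bigr => j _; rewrite e1 mulrBr.
by rewrite e2 e3 e4 e5 e6 Bx; field.
Qed.

End replicator_log_coordinates.

Section log_equation.
Context {d : measure_display} {T : measurableType d} {R : realType}.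
Variable P : probability T R.
Variables (n : nat) (A : 'M[R]_n) (sigma : 'I_n -> R) (x0 : 'cV[R]_n).
Variable W : R -> T -> 'cV[R]_n.
Hypothesis W_bm : standard_brownian_motion P W.
Variable Y : R -> T -> 'cV[R]_n.
Hypothesis rsY : regular_solution P A sigma x0 W Y.
Variable l : 'I_n.
Hypothesis x0l : 0 < x0 l 0.
Local Notation mu := (@lebesgue_measure R).

Implicit Type x : 'cV[R]_n.

Let sY t w : in_simplex (Y t w). Proof. by case: rsY. Qed.

Let Yl01 t w : 0 <= Y t w l 0 <= 1. Proof. by case: (sY t w) => /(_ l). Qed.

Let mYl t : measurable_fun setT (fun w => Y t w l 0). Proof. by case: rsY. Qed.

(* The generator of t |-> ln (Y_t l + dl). *)
Definition regularized_growth (dl : R) : 'cV[R]_n -> R :=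
  ito_generator A sigma l (fun u => (u + dl)^-1) (fun u => - (u + dl)^-1 ^+ 2).

Let phi1_nice dl : 0 < dl -> nice (fun x : 'cV[R]_n => (x l 0 + dl)^-1).
Proof. by move=> dl0; exact: nice_inv. Qed.

Let phi2_nice dl : 0 < dl -> nice (fun x : 'cV[R]_n => - (x l 0 + dl)^-1 ^+ 2).
Proof.
move=> dl0; apply: niceN.
by apply: (niceM (f := fun x => (x l 0 + dl)^-1) (g := fun x => (x l 0 + dl)^-1)); exact: nice_inv.
Qed.

Let ng dl : 0 < dl -> nice (regularized_growth dl).
Proof. by move=> dl0; apply: nice_ito_generator; [exact: phi1_nice|exact: phi2_nice]. Qed.

Lemma regularized_growthE dl x : let q := x l 0 / (x l 0 + dl) in
  regularized_growth dl x = q * relative_fitness A sigma l x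
    - 2^-1 * (q ^+ 2 * relative_variance sigma l x).
Proof.
rewrite /= /regularized_growth /ito_generator replicator_drift_factor variance_rate_factor.
by ring.
Qed.

Let quotient_le1 dl x : 0 < dl -> in_simplex x -> 0 <= x l 0 / (x l 0 + dl) <= 1.
Proof.
move=> dl0 [/(_ l) /andP[xl0 _] _]; have xd : 0 < x l 0 + dl by rewrite ltr_wpDl.
by rewrite divr_ge0 ?(ltW xd) //= ler_pdivrMr // mul1r lerDl ltW.
Qed.

(** The regularization enters only through the quotient x_l / (x_l + dl), which lies in [0, 1], so
    one bound serves for all [dl]. *)
Let growth_bound : exists G, [/\ 0 <= G, forall dl x, 0 < dl -> in_simplex x ->
  `|regularized_growth dl x| <= G & forall x, in_simplex x -> `|log_growth A sigma l x| <= G].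
Proof.
have [[K1 [K10 b1 _]] _] := nice_relative_fitness A sigma l.
have [[K2 [K20 b2 _]] _] := nice_relative_variance sigma l.
exists (K1 + K2); split; first exact: addr_ge0.
  move=> dl x dl0 sx; rewrite regularized_growthE.
  have /andP[q0 q1] := quotient_le1 dl0 sx; set q := _ / _ in q0 q1 *.
  apply: (le_trans (ler_normB _ _)); apply: lerD.
    by rewrite normrM -[leRHS]mul1r ler_pM ?b1 // ger0_norm.
  rewrite normrM normrM -[leRHS]mul1r ler_pM ?mulr_ge0 //.
    by rewrite ger0_norm // invf_le1 // ler1n.
  by rewrite -[leRHS]mul1r ler_pM ?b2 // normrX expr_le1 // ger0_norm.
move=> x sx; apply: (le_trans (ler_normB _ _)); apply: lerD; first exact: b1.
rewrite normrM -[leRHS]mul1r ler_pM ?b2 //.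
by rewrite ger0_norm // invf_le1 // ler1n.
Qed.

Let regularized_error dl t w := ln (Y t w l 0 + dl) - ln (x0 l 0 + dl)
  - timeint 0 t (fun r => regularized_growth dl (Y r w)).

(** Here [kappa] is independent of [dl]: phi1^2 times the variance rate is the squared quotient
    times the bounded relative variance. *)
Let regularized_error_sq : exists kappa, 0 <= kappa /\ forall dl t, 0 < dl -> 0 < t ->
  L2 P (regularized_error dl t) /\
  Ex P (fun w => regularized_error dl t w ^+ 2) <= kappa * t.
Proof.
have [[K [K0 bK _]] _] := nice_relative_variance sigma l.
exists (4 * K); split; first exact: mulr_ge0.
move=> dl t dl0 t0; rewrite /regularized_error /regularized_growth.
apply: (ito_formula_sq W_bm rsY (phi := fun u => ln (u + dl))) => //.
- exact: phi1_nice.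
- exact: phi2_nice.
- exact: nice_ln_measurable.
- exists (`|ln dl| + `|ln (1 + dl)|) => x [/(_ l) /andP[xl0 xl1] _].
  have d1 : 0 < 1 + dl by rewrite ltr_wpDl.
  have xd : 0 < x l 0 + dl by rewrite ltr_wpDl.
  have h1 : ln dl <= ln (x l 0 + dl) by rewrite ler_ln ?posrE // lerDr.
  have h2 : ln (x l 0 + dl) <= ln (1 + dl) by rewrite ler_ln ?posrE // lerD2r.
  have := ler_norm (ln (1 + dl)); have := lerNnormlW (lexx `|ln dl|).
  have := normr_ge0 (ln dl); have := normr_ge0 (ln (1 + dl)).
  by rewrite ler_norml; move: h1 h2; lra.
- exists (dl^-1 ^+ 3); split; first by rewrite exprn_ge0 // invr_ge0 ltW.
  move=> x y /andP[xl0 _] /andP[yl0 _].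
  have h1 : dl <= x + dl by rewrite lerDr.
  have h2 : dl <= y + dl by rewrite lerDr.
  have := ln_taylor2 dl0 h1 h2.
  by rewrite (_ : y + dl - (x + dl) = y - x); last ring.
- move=> x sx; rewrite variance_rate_factor mulrA -exprMn [_^-1 * _]mulrC.
  have /andP[q0 q1] := quotient_le1 dl0 sx.
  apply: (le_trans (ler_norm _)); rewrite normrM -[leRHS]mul1r ler_pM ?bK //.
  by rewrite normrX expr_le1 // ger0_norm.
Qed.

(** If the coordinate vanished with probability p > 0, then for very small [dl] the logarithm would
    make the regularized error at most -c on that event. This gives c^2 p <= kappa t, for
    arbitrarily large c. *)
Lemma solution_gt0 t : 0 <= t -> {ae P, forall w, 0 < Y t w l 0}.
Proof.
rewrite le_eqVlt => /orP[/eqP <-|t0].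
  by apply: aeW => w; case: rsY => _ _ _ _ -> _.
pose E := (fun w => Y t w l 0) @^-1` [set 0].
have mE : measurable E by rewrite -[E]setTI; apply: mYl => //.
suff PE : P E = 0%E.
  exists E; split => // w /= /negP; rewrite -leNgt => h.
  by apply: le_anti; rewrite h; case/andP: (Yl01 t w).
have [kappa [kappa0 hk]] := regularized_error_sq.
have [G [G0 hG _]] := growth_bound.
have mI : measurable_fun setT (\1_E : T -> R) by exact: measurable_indic.
have iI : int1 P (\1_E : T -> R).
  apply: (int1_bdd P mI (c := 1)) => w; rewrite indicE; case: (w \in E); rewrite ?normr1 ?normr0 ?ler01 //.
have EI : (Ex P (\1_E : T -> R))%:E = P E by rewrite -Ex_fin // integral_indic // setIT.
have p0 : 0 <= Ex P (\1_E : T -> R) by rewrite -lee_fin EI.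
rewrite -EI; congr EFin; apply/eqP; rewrite eq_le p0 andbT leNgt; apply/negP => p_gt0.
set p := Ex P _ in p0 p_gt0.
(* This c makes c^2 p exceed kappa t by 1; [dl] is then chosen so that ln dl beats the initial
   value, the growth bound G t, and c. *)
have [c [c0 cp]] : exists c, 0 <= c /\ c ^+ 2 * p = kappa * t + 1.
  exists (Num.sqrt ((kappa * t + 1) / p)); split; first exact: sqrtr_ge0.
  by rewrite sqr_sqrtr ?divfK ?gt_eqF // divr_ge0 // addr_ge0 // mulr_ge0 // ltW.
pose dl := expR (ln (x0 l 0) - G * t - c).
have dl0 : 0 < dl by exact: expR_gt0.
have [LZ EZ] := hk dl t dl0 t0.
suff : c ^+ 2 * p <= kappa * t by rewrite cp gerDl ler10.
apply: le_trans EZ; rewrite -(ExZ _ iI); apply: Ex_le.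
- exact: int1Z.
- exact: LZ.2.
- move=> w; rewrite indicE; have [wE|_] := boolP (w \in E); last by rewrite mulr0 sqr_ge0.
  rewrite mulr1; move: wE; rewrite inE => wE.
  have : regularized_error dl t w <= - c.
    rewrite /regularized_error (_ : Y t w l 0 = 0) // add0r /dl expRK -/dl.
    have h1 : ln (x0 l 0) <= ln (x0 l 0 + dl).
      by rewrite ler_ln ?posrE ?lerDl ?(ltW dl0) // addr_gt0.
    have := timeint_le (jointly_measurable_section w (rs_jointly_measurable rsY (ng dl0)))
       (fun r => hG dl _ dl0 (sY r w)) (ltW t0).
    rewrite subr0 ler_norml => /andP[h2 _]; move: h1 h2; lra.
  move: (regularized_error dl t w) => z hz.
  have cz : c <= - z by rewrite lerNr.
  by rewrite -[leRHS]sqrrN; apply: lerXn2r; rewrite ?nnegrE // (le_trans c0).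
Qed.

Let boundary_time t w := timeint 0 t (fun r => \1_[set 0 : R] (Y r w l 0)).

Let measurable_boundary : measurable_fun setT (\1_[set 0 : R] : R -> R).
Proof. by apply: measurable_indic. Qed.

Let jm_boundary : jointly_measurable (fun r w => \1_[set 0 : R] (Y r w l 0) : R).
Proof.
by apply: (measurableT_comp measurable_boundary); exact: (rs_jointly_measurable rsY (nice_coord l)).
Qed.

Let indic_norm_le1 (y : R) : `|\1_[set 0 : R] y : R| <= 1.
Proof. by rewrite indicE; case: (y \in _); rewrite ?normr1 ?normr0. Qed.

(** Positivity is known at each fixed time only. Integrating over time and exchanging the integrals
    shows that almost every path spends zero Lebesgue time at the boundary, which is enough for time
    integrals. *)
Lemma boundary_time0 t : 0 <= t -> {ae P, forall w, boundary_time t w = 0}.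
Proof.
move=> t0.
have := @sq_norm_bound _ _ _ P 0 _ 0 t jm_boundary t0.
rewrite mul0r => hs.
have [] := @Ex_timeint_sq _ _ _ P 1 _ 0 t 0 jm_boundary (fun r w => indic_norm_le1 _) t0.
  apply: hs => r /andP[r0 _]; split.
    apply: (int1_bdd P _ (c := 1)).
      by apply: measurable_funX; apply: (measurableT_comp measurable_boundary).
    by move=> w; rewrite normrX expr_le1.
  rewrite (@Ex_ae _ _ _ P _ (fun=> 0)) ?Ex_cst //.
  - by apply: measurable_funX; apply: (measurableT_comp measurable_boundary).
  - apply: filterS (solution_gt0 r0) => w Y0.
    by rewrite indicE memNset ?expr0n //= => h; rewrite h ltxx in Y0.
rewrite mulr0 -/(boundary_time t) => L E.
have := (ae_eq_integral_abs P (D := setT) measurableT (f := fun w => (boundary_time t w ^+ 2)%:E)).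
case; first by apply/measurable_EFinP; exact: int1_meas L.2.
move=> h _; apply: filterS (h _).
  by move=> w /(_ Logic.I) [] /eqP; rewrite sqrf_eq0 => /eqP.
under eq_integral do rewrite abse_EFin ger0_norm ?sqr_ge0 //.
rewrite (Ex_fin L.2); congr EFin; apply: le_anti; rewrite E.
by apply: Ex_ge0 => w; exact: sqr_ge0.
Qed.

Let harmonic_gt0' m : 0 < harmonic m :> R. Proof. by rewrite /harmonic invr_gt0. Qed.

Let growth_cvg (x : 'cV[R]_n) : 0 < x l 0 ->
  regularized_growth (harmonic m) x @[m --> \oo] --> log_growth A sigma l x.
Proof.
move=> xl.
have qc : x l 0 / (x l 0 + harmonic m) @[m --> \oo] --> (1 : R).
  rewrite (_ : (1 : R) = x l 0 / (x l 0 + 0)); last by rewrite addr0 divff // gt_eqF.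
  apply: cvgM; first exact: cvg_cst.
  apply: cvgV; first by rewrite addr0 gt_eqF.
  by apply: cvgD; [exact: cvg_cst|exact: cvg_harmonic].
rewrite (_ : (fun m => _) = fun m => x l 0 / (x l 0 + harmonic m) * relative_fitness A sigma l x
   - 2^-1 * ((x l 0 / (x l 0 + harmonic m)) * (x l 0 / (x l 0 + harmonic m)) * relative_variance sigma l x)); last first.
  by apply/funext => m; rewrite regularized_growthE.
rewrite (_ : log_growth A sigma l x = 1 * relative_fitness A sigma l x - 2^-1 * (1 * 1 * relative_variance sigma l x)); last first.
  by rewrite /log_growth !mul1r.
apply: cvgB; first by apply: cvgM => //; exact: cvg_cst.
apply: cvgM; first exact: cvg_cst.
by apply: cvgM; [exact: cvgM|exact: cvg_cst].
Qed.

(** The process N_l of the overview, defined as what remains of the logarithm and not as a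
    stochastic integral. *)
Definition log_error t w := ln (Y t w l 0) - ln (x0 l 0)
  - timeint 0 t (fun r => log_growth A sigma l (Y r w)).

Lemma measurable_log_error t : 0 <= t -> measurable_fun setT (log_error t).
Proof.
move=> t0; have [G [G0 _ hG]] := growth_bound.
apply: measurable_funB.
  apply: measurable_funB; last exact: measurable_cst.
  by apply: measurableT_comp; [exact: measurable_ln|exact: mYl].
apply: (measurable_timeint (K := G)) => //.
- exact: (rs_jointly_measurable rsY (nice_log_growth A sigma l)).
- by move=> r w; exact: hG.
Qed.

(** The regularized growth converges only where x_l > 0, since it is 0 at x_l = 0 for every [dl];
    hence the hypothesis on the boundary time. The common bound [G] dominates. *)
Let growth_timeint_cvg t w : 0 <= t -> boundary_time t w = 0 ->
  timeint 0 t (fun r => regularized_growth (harmonic m) (Y r w)) @[m --> \oo] -->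
  timeint 0 t (fun r => log_growth A sigma l (Y r w)).
Proof.
move=> t0 bt; have [G [G0 hG hG']] := growth_bound.
have mI := jointly_measurable_section w jm_boundary.
have iI := bounded_integrable_itv 0 t mI (fun r => indic_norm_le1 _).
have mI' : measurable_fun `[0, t]%classic (fun r => (\1_[set 0 : R] (Y r w l 0) : R)%:E).
  by apply/measurable_EFinP; exact: measurable_funTS.
have [ae0 _] := ae_eq_integral_abs mu (measurable_itv `[0, t]) mI'.
have z : (\int[mu]_(r in `[0%R, t]) `|(\1_[set 0 : R] (Y r w l 0) : R)%:E| = 0)%E.
  have bt' : (boundary_time t w)%:E = 0%E by rewrite bt.
  rewrite -[RHS]bt' /boundary_time /timeint /Rintegral fineK; last first.
    exact: integrable_fin_num iI.
  by apply: eq_integral => r _; rewrite abse_EFin ger0_norm.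
have {}ae0 := ae0 z.
have [] := @dominated_convergence _ _ _ mu `[0, t]%classic (measurable_itv _)
  (fun m r => (regularized_growth (harmonic m) (Y r w))%:E)
  (fun r => (log_growth A sigma l (Y r w))%:E) (fun=> G%:E).
- move=> m; apply/measurable_EFinP; apply: measurable_funTS.
  exact (jointly_measurable_section w (rs_jointly_measurable rsY (ng (harmonic_gt0' m)))).
- apply/measurable_EFinP; apply: measurable_funTS.
  exact (jointly_measurable_section w (rs_jointly_measurable rsY (nice_log_growth A sigma l))).
- apply: filterS ae0 => r h rt; have {h} [] := h rt.
  rewrite indicE => h; apply: cvg_EFin; first exact: nearW.
  apply: growth_cvg; rewrite lt_neqAle; case/andP: (Yl01 r w) => -> _; rewrite andbT.
  apply/eqP => e; move: h; rewrite mem_set //= => /eqP; by rewrite oner_eq0.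
- by apply: (@bounded_integrable_itv _ G) => // r; rewrite ger0_norm.
- by apply: aeW => r m _; rewrite abse_EFin lee_fin hG.
move=> ig _; rewrite -[X in _ --> X -> _]fineK; last exact: integrable_fin_num ig.
by move=> /fine_cvg.
Qed.

Lemma log_error_sq : exists kappa, 0 <= kappa /\ forall t, 0 < t ->
  (\int[P]_w (log_error t w ^+ 2)%:E <= (kappa * t)%:E)%E.
Proof.
have [kappa [kappa0 hk]] := regularized_error_sq.
exists kappa; split => // t t0; have t0' := ltW t0.
pose f m w := (regularized_error (harmonic m) t w ^+ 2)%:E.
have mf m : measurable_fun setT (f m).
  by apply/measurable_EFinP; exact: int1_meas (hk _ t (harmonic_gt0' m) t0).1.2.
have fc : {ae P, forall w, f m w @[m --> \oo] --> (log_error t w ^+ 2)%:E}.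
  apply: filterS2 (solution_gt0 t0') (boundary_time0 t0') => w Y0 b0.
  apply: cvg_EFin; first exact: nearW.
  have lnc (u : R) : 0 < u -> ln (u + harmonic m) @[m --> \oo] --> ln u.
    move=> u0; have h : u + harmonic m @[m --> \oo] --> u.
      by rewrite -[X in _ --> X]addr0; apply: cvgD; [exact: cvg_cst|exact: cvg_harmonic].
    exact: (cvg_comp _ _ h (continuous_ln u0)).
  have ec : regularized_error (harmonic m) t w @[m --> \oo] --> log_error t w.
    apply: cvgB; last exact: growth_timeint_cvg.
    by apply: cvgB; exact: lnc.
  exact: (cvgM ec ec).
(* Almost surely the squared regularized errors converge, so their lower limit is the squared error
   and Fatou's lemma applies. *)
have -> : (\int[P]_w (log_error t w ^+ 2)%:E = \int[P]_w limn_einf (f ^~ w))%E.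
  apply: ge0_ae_eq_integral => //.
  - apply/measurable_EFinP; apply: measurable_funX; exact: measurable_log_error.
  - have mN (u : T -> \bar R) : measurable_fun setT u -> measurable_fun setT (fun w => - u w)%E.
      by move=> mu_; exact: (measurableT_comp (@oppe_measurable R setT) mu_).
    by apply: (mN); apply: (@measurable_fun_limn_esup _ _ _ _ (fun m w => - f m w)%E) => m; exact: mN.
  - by move=> w _; rewrite lee_fin sqr_ge0.
  - move=> w _; rewrite limn_einf_lim; apply: lime_ge; first exact: is_cvg_einfs.
    apply: nearW => m; apply: le_ereal_inf_tmp => _ [k _ <-].
    by rewrite lee_fin sqr_ge0.
  - by apply: filterS fc => w /cvg_limn_einf_sup [-> _].
apply: (le_trans (fatou P measurableT mf _)); first by move=> m w _; rewrite lee_fin sqr_ge0.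
rewrite limn_einf_lim; apply: lime_le; first exact: is_cvg_einfs.
apply: nearW => m; apply: (@le_trans _ _ (\int[P]_w f m w)%E).
  by apply: ereal_inf_lbound; exists m => /=.
have [L E] := hk _ t (harmonic_gt0' m) t0.
by rewrite /f (Ex_fin L.2) lee_fin.
Qed.

End log_equation.

(** * Time averages *)

Section square_summable_means.
Context {d : measure_display} {T : measurableType d} {R : realType}.
Variable P : probability T R.

(** The series of the Z_k^2 has finite expectation, so it converges almost surely and its terms tend
    to 0. *)
Lemma ae_cvg0_of_sq (Z : nat -> T -> R) K : (forall k, measurable_fun setT (Z k)) ->
  (forall k, \int[P]_w (Z k w ^+ 2)%:E <= (K * k.+1%:R^-1 ^+ 2)%:E)%E ->
  {ae P, forall w, Z k w @[k --> \oo] --> 0}.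
Proof.
move=> mZ bZ.
pose f k w := (Z k w ^+ 2)%:E.
have f0 k w : setT w -> (0 <= f k w)%E by move=> _; rewrite lee_fin sqr_ge0.
have mf k : measurable_fun setT (f k).
  by apply/measurable_EFinP; exact: measurable_funX.
have K0 : 0 <= K.
  have := bZ 0%N; rewrite invr1 expr1n mulr1 -lee_fin; apply: le_trans.
  by apply: integral_ge0 => w _; exact: f0.
(* Telescoping comparison with 1/N - 1/(N + 1). At N = 0 the inverse is 0 and the bound reads 0 <=
   2. *)
have inv_sq N : \sum_(0 <= k < N) (k.+1%:R^-1 ^+ 2 : R) <= 2 - N%:R^-1.
  elim: N => [|N ih]; first by rewrite big_nil invr0 subr0.
  rewrite big_nat_recr //=; case: N ih => [_|N ih].
    by rewrite big_nil invr1 expr1n; lra.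
  apply: (le_trans (lerD ih (lexx _))).
  rewrite -[N.+2%:R]natr1; move: (N.+1%:R : R) (ltr0Sn R N) => a a0.
  have a1 : 0 < a + 1 by rewrite addr_gt0.
  have : a^-1 - (a + 1)^-1 - (a + 1)^-1 ^+ 2 = (a * (a + 1) ^+ 2)^-1.
    by field; rewrite !gt_eqF.
  have : 0 <= (a * (a + 1) ^+ 2)^-1 by rewrite invr_ge0 mulr_ge0 ?sqr_ge0 ?ltW.
  lra.
have S : (\int[P]_w (\sum_(0 <= k <oo) f k w) < +oo)%E.
  rewrite integral_nneseries //; apply: (@le_lt_trans _ _ (K * 2)%:E); last exact: ltry.
  apply: lime_le.
    by apply: is_cvg_nneseries => k _ _; apply: integral_ge0 => w; exact: f0.
  apply: nearW => N.
  apply: (@le_trans _ _ (\sum_(0 <= k < N) (K * k.+1%:R^-1 ^+ 2)%:E)%E).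
    by apply: lee_sum => k _; exact: bZ.
  rewrite sumEFin lee_fin -mulr_sumr ler_wpM2l // (le_trans (inv_sq N)) //.
  by rewrite gerBl.
have iS : P.-integrable setT (fun w => \sum_(0 <= k <oo) f k w)%E.
apply/integrableP; split.
    by apply: ge0_emeasurable_sum => [k w Dw _|k _]; [exact: f0|exact: mf].
  apply: le_lt_trans S; rewrite le_eqVlt; apply/orP; left; apply/eqP.
  apply: eq_integral => w _; rewrite gee0_abs //.
  by apply: nneseries_ge0 => k _ _; exact: f0.
apply: filterS (integrable_ae measurableT iS) => w /(_ Logic.I) fin.
have c2 : Z k w ^+ 2 @[k --> \oo] --> (0 : R).
  apply: cvg_series_cvg_0; apply: nondecreasing_is_cvgn.
    by apply: nondecreasing_series => k _ _; exact: sqr_ge0.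
  exists (fine (\sum_(0 <= k <oo) f k w)%E) => _ [N _ <-].
  rewrite -lee_fin fineK // /series /= -sumEFin.
  by apply: nneseries_lim_ge => k _ _; exact: f0.
apply/cvgrPdist_lt => e e0.
have e2 : 0 < e ^+ 2 by rewrite exprn_gt0.
move/cvgrPdist_lt : c2 => /(_ _ e2); apply: filterS => k.
rewrite !sub0r !normrN (ger0_norm (sqr_ge0 _)) => h.
by rewrite -(@ltr_pXn2r _ 2) ?nnegrE ?(ltW e0) // real_normK ?num_real.
Qed.

End square_summable_means.

(** * Deterministic analysis of one path along the squares *)

Section time_averages.
Context {R : realType} (n : nat) (A : 'M[R]_n) (sigma : 'I_n -> R).
Local Notation mu := (@lebesgue_measure R).
Local Notation At := (modified_payoff A sigma).

(** The quadratic form of [log_growth] with x_i x_j replaced by free entries. At a limit point it is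
    D_l, the left side of the claim minus the right side. *)
Definition growth_form (l : 'I_n) (q : 'I_n -> 'I_n -> R) : R :=
  \sum_i \sum_j At l i * q i j
    - (\sum_i \sum_j At i j * q i j
       + 2^-1 * \sum_j sigma j ^+ 2 * (\sum_i q j i - q j j)).

(** Collecting one coefficient for each entry makes the form visibly linear, hence compatible with
    limits, scaling and time integration. *)
Let coef l i j : R :=
  At l i - (At i j + 2^-1 * (sigma i ^+ 2 - (i == j)%:R * sigma i ^+ 2)).

Let growth_formE l q : growth_form l q = \sum_i \sum_j coef l i j * q i j.
Proof.
rewrite /growth_form mulr_sumr -big_split -sumrB /=; apply: eq_bigr => i _.
have -> : q i i = \sum_j (i == j)%:R * q i j.
  rewrite (bigD1 i) //= eqxx mul1r big1 ?addr0 // => j /negPf ji.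
  by rewrite eq_sym ji mul0r.
rewrite -sumrB !mulr_sumr -big_split -sumrB /=; apply: eq_bigr => j _.
by rewrite /coef; ring.
Qed.

Lemma growth_form_cvg (q : nat -> 'I_n -> 'I_n -> R) p l :
  (forall i j, q k i j @[k --> \oo] --> p i j) ->
  growth_form l (q k) @[k --> \oo] --> growth_form l p.
Proof.
move=> qp; rewrite growth_formE; under eq_fun do rewrite growth_formE.
apply: cvg_big => [|i _]; first exact: add_continuous.
apply: cvg_big => [|j _]; first exact: add_continuous.
by apply: cvgM => //; exact: cvg_cst.
Qed.

Variable y : R -> 'cV[R]_n.
Hypothesis sy : forall t, in_simplex (y t).
Hypothesis my : forall i, measurable_fun setT (fun t => y t i 0).

Let ybd i j t : `|y t i 0 * y t j 0| <= 1.
Proof. by rewrite normrM mulr_ile1 // in_simplex_le1. Qed.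

Let timeint_sum (I : finType) (c : I -> R) (u : I -> R -> R) a b :
  (forall i, measurable_fun setT (u i)) -> (forall i t, `|u i t| <= 1) ->
  timeint a b (fun t => \sum_i c i * u i t) = \sum_i c i * timeint a b (u i).
Proof.
move=> mu_ bu; rewrite /timeint.
have iu i : mu.-integrable `[a, b] (EFin \o (fun t => c i * u i t)).
  apply: (@bounded_integrable_itv _ `|c i|).
    by apply: measurable_funM => //; exact: measurable_cst.
  by move=> t; rewrite normrM ler_piMr.
transitivity (fine (\int[mu]_(t in `[a, b]) (\sum_i (EFin \o (fun t => c i * u i t)%R) t))%E).
  by congr fine; apply: eq_integral => t _; rewrite sumEFin.
rewrite integral_sum // -sum_fine; last by move=> i _; exact: integrable_fin_num (iu i).
apply: eq_bigr => i _; rewrite -/(Rintegral _ _ _) RintegralZl //.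
exact: (bounded_integrable_itv a b (mu_ i) (bu i)).
Qed.

Lemma timeint_log_growth a b l :
  timeint a b (fun t => log_growth A sigma l (y t)) =
  growth_form l (fun i j => timeint a b (fun t => y t i 0 * y t j 0)).
Proof.
have -> : (fun t => log_growth A sigma l (y t)) =
    (fun t => \sum_(ij : 'I_n * 'I_n) coef l ij.1 ij.2 * (y t ij.1 0 * y t ij.2 0)).
  apply/funext => t; rewrite log_growthE // -[LHS]/(growth_form l (fun i j => y t i 0 * y t j 0)).
  by rewrite growth_formE pair_bigA.
rewrite timeint_sum ?growth_formE ?pair_bigA //.
by move=> ij; exact: measurable_funM.
Qed.

Lemma growth_formZ l c q : growth_form l (fun i j => c * q i j) = c * growth_form l q.
Proof.
rewrite !growth_formE mulr_sumr; apply: eq_bigr => i _; rewrite mulr_sumr.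
by apply: eq_bigr => j _; rewrite mulrCA.
Qed.

Variable x0 : 'cV[R]_n.
Local Notation growth_int l t := (timeint 0 t (fun r => log_growth A sigma l (y r))).
Hypothesis y0 : y 0 = x0.
Hypothesis mean_log_error : forall l,
  (ln (y (k%:R ^+ 2) l 0) - ln (x0 l 0) - growth_int l (k%:R ^+ 2)) / k%:R ^+ 2
    @[k --> \oo] --> 0.
Variables (tau : nat -> R) (p : 'M[R]_n).
Hypothesis tau_y : tau k @[k --> \oo] --> +oo.
Hypothesis averages : forall i j,
  (tau k)^-1 * timeint 0 (tau k) (fun t => y t i 0 * y t j 0) @[k --> \oo] --> p i j.

(* The largest perfect square below tau k is (root k)^2. *)
Let root k := Num.trunc (Num.sqrt (tau k)).

Let cvgy_inv (u : nat -> R) : u k @[k --> \oo] --> +oo -> (u k)^-1 @[k --> \oo] --> 0.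
Proof.
move=> uy; have u0 : \forall k \near \oo, 0 < u k by move/cvgryPgt : uy; exact.
exact/(gtr0_cvgV0 u0).
Qed.

Let sqrt_tau_y : Num.sqrt (tau k) @[k --> \oo] --> +oo.
Proof.
apply/cvgryPge => a; move/cvgryPge : tau_y => /(_ (a ^+ 2)); apply: filterS => k h.
by apply: (le_trans (ler_norm a)); rewrite -sqrtr_sqr ler_wsqrtr.
Qed.

Let root_y : root k @[k --> \oo] --> \oo.
Proof.
apply/cvgnyPge => N; move/cvgryPge : sqrt_tau_y => /(_ N%:R); apply: filterS => k h.
have /andP[_ h2] := truncn_itv (sqrtr_ge0 (tau k)).
by rewrite -ltnS -(ltr_nat R); exact: le_lt_trans h2.
Qed.

Lemma log_rate_cvg l :
  ln (y ((root k)%:R ^+ 2) l 0) / tau k @[k --> \oo] --> growth_form l p.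
Proof.
have [[G [G0 hG _]] mG] := nice_log_growth A sigma l.
have mg : measurable_fun setT (fun r => log_growth A sigma l (y r)) by exact: mG.
have bg r : `|log_growth A sigma l (y r)| <= G by exact: hG.
pose e k := (ln (y (k%:R ^+ 2) l 0) - ln (x0 l 0) - growth_int l (k%:R ^+ 2)) / k%:R ^+ 2.
pose D := growth_form l p.
(* Four errors: the averaged log error at the square, the initial value, the distance of the time
   average from its limit, and the growth between the square and [tau k]. For the last, that gap is
   at most 2 sqrt (tau k) + 1. *)
pose bnd k := `|e (root k)| + `|ln (x0 l 0)| * (tau k)^-1
  + `|(tau k)^-1 * growth_int l (tau k) - D| + G * (2 * (Num.sqrt (tau k))^-1 + (tau k)^-1).
have av : (tau k)^-1 * growth_int l (tau k) @[k --> \oo] --> D.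
  have h := @growth_form_cvg _ _ l averages.
  by under eq_fun do rewrite timeint_log_growth -growth_formZ.
have bnd0 : bnd k @[k --> \oo] --> 0.
  have e0 : `|0 : R| + `|ln (x0 l 0)| * 0 + `|D - D| + G * (2 * 0 + 0) = 0 :> R.
    by rewrite subrr !(@normr0 R R) !(mulr0, addr0).
  rewrite -[X in _ --> X]e0.
  have t0 := cvgy_inv tau_y; have s0 := cvgy_inv sqrt_tau_y.
  have ec : e (root k) @[k --> \oo] --> 0 := cvg_comp _ _ root_y (mean_log_error l).
  apply: cvgD; [apply: cvgD; [apply: cvgD|]|].
  - exact (cvg_norm ec).
  - by apply: cvgM => //; exact: cvg_cst.
  - by apply: (@cvg_norm _ _ _ _ _ (fun k => (tau k)^-1 * growth_int l (tau k) - D)); apply: cvgB => //; exact: cvg_cst.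
  - apply: cvgM; first exact: cvg_cst.
    by apply: cvgD => //; apply: cvgM => //; exact: cvg_cst.
apply: (@squeeze_cvgr _ _ _ _ (fun k => D - bnd k) (fun k => D + bnd k)); last 2 first.
- by rewrite -[X in _ --> X]subr0; apply: cvgB => //; exact: cvg_cst.
- by rewrite -[X in _ --> X]addr0; apply: cvgD => //; exact: cvg_cst.
move/cvgryPgt : tau_y => /(_ 0); apply: filterS => k tk.
rewrite -ler_distl.
have /andP[h1 h2] := truncn_itv (sqrtr_ge0 (tau k)).
rewrite -/(root k) in h1 h2.
set s := Num.sqrt (tau k) in h1 h2 *; set m := root k in h1 h2 *.
have s0 : 0 < s by rewrite sqrtr_gt0.
have ss : s ^+ 2 = tau k by rewrite sqr_sqrtr // ltW.
have mt : m%:R ^+ 2 <= tau k by rewrite -ss ler_pXn2r ?nnegrE // ltW.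
have tm : tau k - m%:R ^+ 2 <= 2 * s + 1.
  by rewrite -ss; move: h1 h2; rewrite -natr1; nra.
have split_int := timeint_split mg bg (sqr_ge0 m%:R) mt.
have err := timeint_le mg bg mt.
have em : ln (y (m%:R ^+ 2) l 0) = m%:R ^+ 2 * e m + ln (x0 l 0) + growth_int l (m%:R ^+ 2).
  (* For m = 0 the quotient e 0 is 0 by the convention on division by 0, and the identity reduces to
     y 0 = x0. *)
  rewrite /e; have [->|m_n0] := eqVneq (m%:R : R) 0; last by field.
  rewrite expr0n /= mul0r add0r y0 /timeint set_itv1 Rintegral_set1 addr0 //.
set I := growth_int l _ in em split_int; set J := timeint (m%:R ^+ 2) _ _ in split_int err.
have -> : ln (y (m%:R ^+ 2) l 0) / tau k - D = (m%:R ^+ 2 / tau k) * e m + ln (x0 l 0) * (tau k)^-1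
   + ((tau k)^-1 * growth_int l (tau k) - D) - J / tau k.
  rewrite em split_int; ring.
apply: (le_trans (ler_normB _ _)); apply: lerD.
  apply: (le_trans (ler_normD _ _)); rewrite lerD2r.
  apply: (le_trans (ler_normD _ _)); apply: lerD.
    rewrite normrM ler_piMl // ger0_norm ?divr_ge0 ?sqr_ge0 ?(ltW tk) //.
    by rewrite ler_pdivrMr // mul1r.
  by rewrite normrM [`|(tau k)^-1|]ger0_norm // invr_ge0 ltW.
rewrite normrM [`|(tau k)^-1|]ger0_norm ?invr_ge0 ?(ltW tk) // ler_pdivrMr //.
apply: (le_trans err); rewrite -mulrA ler_wpM2l //; apply: (le_trans tm).
rewrite -/s -ss le_eqVlt; apply/orP; left; apply/eqP; field.
by rewrite gt_eqF.
Qed.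

(** A coordinate is at most 1, so its logarithm divided by a positive time is at most 0, and this
    passes to the limit. *)
Lemma growth_form_le0 l : growth_form l p <= 0.
Proof.
apply: (cvgr_to_le (@log_rate_cvg l)).
move/cvgryPgt : tau_y => /(_ 0); apply: filterS => k tk.
rewrite pmulr_lle0 ?invr_gt0 // ln_le0 //.
by case: (sy ((root k)%:R ^+ 2)) => /(_ l) /andP[].
Qed.

Lemma growth_form_eq0 : exists l, growth_form l p = 0.
Proof.
apply: contrapT => none.
have neg l : growth_form l p < 0.
  rewrite lt_neqAle growth_form_le0 andbT; apply/eqP => e; apply: none; by exists l.
(* The threshold 1 / (n + 1) is chosen because n coordinates below it add up to less than 1. *)
have near_small : \forall k \near \oo, forall l, ln (y ((root k)%:R ^+ 2) l 0) < - ln n.+1%:R.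
  apply: filter_forall => l.
  (* Half of a negative limit is larger than the limit, so the rate is eventually below it;
     multiplied by a large tau k, it falls below any constant. *)
  have half : growth_form l p < growth_form l p / 2.
    by rewrite ltr_pdivlMr // mulr_natr mulr2n gtrDl.
  have h1 : \forall k \near \oo, ln (y ((root k)%:R ^+ 2) l 0) / tau k < growth_form l p / 2.
    exact: cvgr_lt (@log_rate_cvg l) _ half.
  move/cvgryPgt : tau_y => hy.
  apply: filterS3 (hy 0) (hy (- ln n.+1%:R / (growth_form l p / 2))) h1 => k tk.
  rewrite ltr_ndivrMr; last by rewrite pmulr_llt0 // neg.
  move=> h2; rewrite ltr_pdivrMr // mulrC => h3.
  exact: lt_trans h3 h2.
have [k hk] := filter_ex near_small.
have [_ sum1] := sy ((root k)%:R ^+ 2).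
have : \sum_l y ((root k)%:R ^+ 2) l 0 <= \sum_(l < n) (n.+1%:R^-1 : R).
  (* At a vanishing coordinate the value of ln carries no information, but the required bound is
     then immediate. *)
  apply: ler_sum => l _; have [y_le0|y_gt0] := leP (y ((root k)%:R ^+ 2) l 0) 0.
    by apply: (le_trans y_le0); rewrite invr_ge0.
  apply: ltW; rewrite -ltr_ln ?posrE ?invr_gt0 //.
  by rewrite lnV ?posrE //; exact: hk.
rewrite sum1 sumr_const card_ord -[_ *+ n]mulr_natl ler_pdivlMr // mul1r ler_nat.
by rewrite ltnn.
Qed.

End time_averages.



Section almost_sure_rates.
Context {d : measure_display} {T : measurableType d} {R : realType}.
Variable P : probability T R.
Variables (n : nat) (A : 'M[R]_n) (sigma : 'I_n -> R) (x0 : 'cV[R]_n).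
Variable W : R -> T -> 'cV[R]_n.
Hypothesis W_bm : standard_brownian_motion P W.
Variable Y : R -> T -> 'cV[R]_n.
Hypothesis rsY : regular_solution P A sigma x0 W Y.

(** At time k^2 the second moment of the error divided by k^2 is at most kappa / k^2, which is
    summable. *)
Lemma mean_log_error_cvg0 l : 0 < x0 l 0 ->
  {ae P, forall w, log_error A sigma x0 Y l (k%:R ^+ 2) w / k%:R ^+ 2 @[k --> \oo] --> 0}.
Proof.
move=> x0l; have [kappa [kappa0 hk]] := log_error_sq W_bm rsY x0l.
have me k : measurable_fun setT (log_error A sigma x0 Y l (k%:R ^+ 2)).
  by apply: (measurable_log_error rsY); exact: sqr_ge0.
(* The shift to k + 1 keeps the time positive, as the second-moment bound requires; the limit is
   unaffected. *)
pose Z k w := log_error A sigma x0 Y l (k.+1%:R ^+ 2) w / k.+1%:R ^+ 2.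
have : {ae P, forall w, Z k w @[k --> \oo] --> 0}.
  apply: (@ae_cvg0_of_sq _ _ _ _ _ kappa) => k.
    by apply: measurable_funM => //; exact: measurable_cst.
  pose c : R := (k.+1%:R ^+ 2)^-1 ^+ 2.
  have -> : (\int[P]_w (Z k w ^+ 2)%:E =
      \int[P]_w (c%:E * (log_error A sigma x0 Y l (k.+1%:R ^+ 2) w ^+ 2)%:E))%E.
    by apply: eq_integral => w _; rewrite -EFinM /Z exprMn mulrC.
  rewrite ge0_integralZl_EFin //; last 3 first.
  - by move=> w _; rewrite lee_fin sqr_ge0.
  - by apply/measurable_EFinP; exact: measurable_funX.
  - exact: sqr_ge0.
  apply: (@le_trans _ _ (c%:E * (kappa * k.+1%:R ^+ 2)%:E)%E).
    by apply: lee_wpmul2l; [rewrite lee_fin sqr_ge0|exact: hk].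
  rewrite -EFinM lee_fin /c le_eqVlt; apply/orP; left; apply/eqP.
  by field; rewrite nat1r pnatr_eq0.
apply: filterS => w h.
by rewrite -(cvg_shiftS (fun k => log_error A sigma x0 Y l (k%:R ^+ 2) w / k%:R ^+ 2)).
Qed.

End almost_sure_rates.

Theorem theorem2p2 (R : realType) (d : measure_display) (T : measurableType d)
    (P : probability T R) (n : nat) (n_ge2 : (2 <= n)%N)
    (A : 'M[R]_n) (sigma : 'I_n -> R) (sigma_gt0 : forall i, 0 < sigma i)
    (x0 : 'cV[R]_n) (x0_int : in_int_simplex x0)
    (W X : R -> T -> 'cV[R]_n)
    (W_bm : standard_brownian_motion P W)
    (X_sol : stochastic_replicator P A sigma x0 W X) :
  {ae P, forall w, forall pij : 'M[R]_n, time_average_limit_point X w pij ->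
    let At := modified_payoff A sigma in
    let p : 'cV[R]_n := \col_i \sum_j pij i j in
    let rhs := \sum_i \sum_j At i j * pij i j
               + 2^-1 * \sum_j sigma j ^+ 2 * (p j 0 - pij j j) in
    (forall l : 'I_n, (At *m p) l 0 <= rhs) /\
    (exists l : 'I_n, (At *m p) l 0 = rhs)}.
Proof.
have [x0s x0_gt0] := x0_int.
have [Y [rsY XY]] := regular_version W_bm x0s X_sol.
have rates : {ae P, forall w, forall l,
    log_error A sigma x0 Y l (k%:R ^+ 2) w / k%:R ^+ 2 @[k --> \oo] --> 0}.
  by apply: filter_forall => l; exact (mean_log_error_cvg0 W_bm rsY (x0_gt0 l)).
(* From here w is fixed and the argument is deterministic, so a single null event serves all limit
   points and all sequences of times. *)
apply: filterS2 XY rates => w YX rate pij [tau tau_y av].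
set At := modified_payoff A sigma; set p := \col_i _; set rhs := (_ + 2^-1 * _).
have sy t : in_simplex (Y t w) by case: rsY.
have my i : measurable_fun setT (fun t => Y t w i 0).
  exact (jointly_measurable_section w (rs_jointly_measurable rsY (nice_coord i))).
have y0 : Y 0 w = x0 by case: rsY.
have avY i j : (tau k)^-1 * timeint 0 (tau k) (fun t => Y t w i 0 * Y t w j 0)
    @[k --> \oo] --> pij i j.
  rewrite (_ : (fun k => _) = fun k => (tau k)^-1 *
      \int[lebesgue_measure]_(t in `[0%R, tau k]) (X t w i 0 * X t w j 0)) //.
  apply/funext => k; congr (_ * _); apply: eq_Rintegral => t.
  by rewrite inE /= in_itv /= => /andP[t0 _]; rewrite YX.
(* Row sums of the limit point are the entries of [p], which turns the quadratic form into the
   difference of the two sides. *)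
have formE l : growth_form A sigma l (fun i j => pij i j) = (At *m p) l 0 - rhs.
  rewrite /growth_form /rhs; congr (_ - (_ + _ * _)).
    by rewrite mxE; apply: eq_bigr => i _; rewrite -mulr_sumr [p i 0]mxE.
  by apply: eq_bigr => j _; rewrite [p j 0]mxE.
split=> [l|].
  by rewrite -subr_le0 -formE; exact: (growth_form_le0 sy my y0 rate tau_y avY).
have [l hl] := growth_form_eq0 sy my y0 rate tau_y avY.
by exists l; apply/eqP; rewrite -subr_eq0 -formE hl.
Qed.
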